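(* Let $(d_n)_{n\in\mathbb{N}}$ be a sequence of natural numbers with $d_n\to\infty$. Let $Z_i$, $i\in\mathbb{N}$, be i.i.d. random variables on $(\Omega,\mathcal{A},\mathbb{P})$ with values in $l^2$ such that $\mathbb{E}[Z_1]=0$ and $\mathbb{E}[\|Z_1\|^2]<\infty$. Put $X_{ni}:=(Z_i^{(1)},\ldots,Z_i^{(d_n)})$ for $1\le i\le n$, $\overline{X}_n:=n^{-1}\sum_{i=1}^nX_{ni}$, $V_n(d_n):=n\|\overline{X}_n\|_{d_n}^2$, and let $d_{n,\alpha}^*$ be the bootstrap critical value. Then for each $\alpha\in(0,1)$ the test that rejects $H_0:\mu=0$ (zero mean) if $V_n(d_n)>d_{n,\alpha}^*$ satisfies $$\mathbb{P}(H_0\text{ is rejected at level }\alpha)=\mathbb{P}(V_n(d_n)>d_{n,\alpha}^* )\to\alpha,\quad n\to\infty.$$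
   Context: $l^2$ is the Hilbert space of square-summable real sequences $x=(x^{(i)})_{i\in\mathbb{N}}$ with norm $\|\cdot\|$; $\|\cdot\|_d$ is the Euclidean norm on $\mathbb{R}^d$. Bootstrap construction: for every $n\in\mathbb{N}$ let $i_{n1},\ldots,i_{nn}$ be random variables on some probability space $(\Omega^*,\mathcal{A}^*,\mathbb{P}^* )$ that are $\mathbb{P}^*$-independent and each uniformly distributed on $\{1,\ldots,n\}$. For $\omega\in\Omega$ and $1\le k\le n$ define $\xi_{nk}(\omega):\Omega^*\to\mathbb{R}^{d_n}$ by $\xi_{nk}(\omega)(\omega^* ):=X_{n\,i_{nk}(\omega^* )}(\omega)$. Put $\overline{\xi}_n(\omega):=n^{-1}\sum_{k=1}^n(\xi_{nk}(\omega)-\overline{X}_n(\omega))$ and $W_n^*(\omega):=n\|\overline{\xi}_n(\omega)\|_{d_n}^2$, a random variable on $(\Omega^*,\mathcal{A}^*,\mathbb{P}^* )$ for each fixed $\omega$. Let $G_n^*(\omega)$ be the distribution function of $W_n^*(\omega)$ under $\mathbb{P}^*$ and $d_{n,\alpha}^*(\omega):=(G_n^*(\omega))^{-1}(1-\alpha)$, where $G^{-1}(u)=\inf\{x\in\mathbb{R}:G(x)\ge u\}$ denotes the quantile function of a distribution function $G$. Thus $d_{n,\alpha}^*$ is a random variable on $\Omega$.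
   Formalization: The formal statement additionally assumes that Z_1 is not almost surely 0; if Z_1 = 0 a.s. then V_n(d_n) = d*_{n,α} = 0 a.s., so the rejection probability is 0 for all n and does not tend to α. *)

(* Defs.v *)
From HB Require Import structures.
From mathcomp Require Import all_boot all_order all_algebra.
From mathcomp Require Import finmap.
From mathcomp Require Import ring.
From mathcomp Require Import all_classical all_reals all_analysis measurable_realfun.

Set Implicit Arguments.
Unset Strict Implicit.
Unset Printing Implicit Defensive.

Import Order.TTheory GRing.Theory Num.Theory.
Import numFieldNormedType.Exports.

Local Open Scope classical_set_scope.
Local Open Scope ring_scope.

Definition square_summable (R : realType) : {pred nat -> R} :=
  fun x => `[< cvgn (series (fun j => x j ^+ 2)) >].

Record l2 (R : realType) : Type := L2 {
  l2val :> nat -> R;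
  l2valP : l2val \in @square_summable R }.

Section l2_lmodule.
Variable R : realType.
Implicit Types x y : nat -> R.

HB.instance Definition _ := [isSub for @l2val R].
HB.instance Definition _ := [Choice of l2 R by <:].

Lemma square_summableP x :
  reflect (cvgn (series (fun j => x j ^+ 2))) (x \in @square_summable R).
Proof. exact: asboolP. Qed.

Lemma square_summableM x y : x \in @square_summable R ->
  y \in @square_summable R -> cvgn (series (fun j => x j * y j)).
Proof.
move=> /square_summableP cx /square_summableP cy.
apply: normed_cvg; apply: (series_le_cvg (v_ := fun j => x j ^+ 2 + y j ^+ 2)).
- by move=> j; exact: normr_ge0.
- by move=> j; rewrite addr_ge0 ?sqr_ge0.
- move=> j; rewrite /= normrM -[x j ^+ 2]real_normK ?num_real//.
  rewrite -[y j ^+ 2]real_normK ?num_real//.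
  have h0 : 0 <= (`|x j| - `|y j|) ^+ 2 by rewrite sqr_ge0.
  have h1 : 0 <= `|x j| * `|y j| by rewrite mulr_ge0.
  rewrite sqrrB in h0.
  move: h0; rewrite addrAC subr_ge0 => h0; apply: le_trans h0.
  by rewrite mulr2n lerDl.
- rewrite (_ : series _ =
    series (fun j => x j ^+ 2) + series (fun j => y j ^+ 2)); last first.
    by apply/funext => n; rewrite /series/= fctE big_split.
  exact: is_cvgD.
Qed.

Lemma square_summable_submod_closed : submod_closed (@square_summable R).
Proof.
split.
  apply/square_summableP; rewrite (_ : series _ = cst 0); first exact: is_cvg_cst.
  apply/funext => n; rewrite /series/= big1// => j _.
  by rewrite expr0n.
move=> a x y hx hy; apply/square_summableP.
have [/square_summableP cx /square_summableP cy] := (hx, hy).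
have cxy := square_summableM hx hy.
rewrite (_ : series _ = a ^+ 2 *: series (fun j => x j ^+ 2) +
   (a *+ 2) *: series (fun j => x j * y j) + series (fun j => y j ^+ 2)).
  by apply: is_cvgD => //; apply: is_cvgD; exact: is_cvgZr.
apply/funext => n.
rewrite -[RHS]/(a ^+ 2 * (\sum_(0 <= j < n) x j ^+ 2) +
  (a *+ 2) * (\sum_(0 <= j < n) x j * y j) + \sum_(0 <= j < n) y j ^+ 2).
rewrite /series/= !mulr_sumr -!big_split/=.
apply: eq_bigr => j _.
by rewrite -[(a *: x + y) j]/(a * x j + y j); ring.
Qed.

HB.instance Definition _ := GRing.isSubmodClosed.Build R (nat -> R)
  (@square_summable R) square_summable_submod_closed.
HB.instance Definition _ := [SubChoice_isSubLmodule of l2 R by <:].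

End l2_lmodule.

Section l2_norm.
Variable R : realType.
Implicit Types x y z : l2 R.

Definition l2dot x y : R := limn (series (fun j => x j * y j)).

Definition l2norm x : R := Num.sqrt (l2dot x x).

Lemma l2dotC x y : l2dot x y = l2dot y x.
Proof.
by congr (limn (series _)); apply/funext => j; rewrite mulrC.
Qed.

Lemma l2dotDl a x y z : l2dot (a *: x + y) z = a * l2dot x z + l2dot y z.
Proof.
have cv u v : cvgn (series (fun j => (u : l2 R) j * (v : l2 R) j)).
  exact: square_summableM (l2valP u) (l2valP v).
rewrite /l2dot (_ : series _ = a *: series (fun j => x j * z j) +
  series (fun j => y j * z j)).
  rewrite limD//; last exact: is_cvgZr.
  by rewrite limZr.
apply/funext => n.
rewrite -[RHS]/(a * (\sum_(0 <= j < n) x j * z j) + \sum_(0 <= j < n) y j * z j).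
rewrite /series/= mulr_sumr -big_split/=.
by apply: eq_bigr => j _; rewrite -[_ j]/(a * x j + y j); ring.
Qed.

Lemma l2dot0l x : l2dot 0 x = 0.
Proof.
have := l2dotDl 1 0 0 x; rewrite scaler0 addr0 mul1r => /eqP.
by rewrite -subr_eq0 opprD addNKr oppr_eq0 => /eqP.
Qed.

Lemma l2dotZl a x y : l2dot (a *: x) y = a * l2dot x y.
Proof. by rewrite -[_ *: x]addr0 l2dotDl l2dot0l addr0. Qed.

Lemma l2dot_ge0 x : 0 <= l2dot x x.
Proof.
apply: limr_ge; first exact: square_summableM (l2valP x) (l2valP x).
by apply: nearW => n; apply: sumr_ge0 => j _; rewrite -expr2 sqr_ge0.
Qed.

Lemma l2dot_eq0 x : l2dot x x = 0 -> x = 0.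
Proof.
move=> x0; apply: val_inj; apply/funext => j /=; apply/eqP.
rewrite -sqrf_eq0 eq_le sqr_ge0 andbT -x0.
have cx := square_summableM (l2valP x) (l2valP x).
apply: le_trans (nondecreasing_cvgn_le _ cx j.+1); last first.
  by apply: nondecreasing_series => i _ _; rewrite -expr2 sqr_ge0.
rewrite /series/= big_nat_recr//= -expr2 lerDr sumr_ge0// => i _.
by rewrite -expr2 sqr_ge0.
Qed.

Lemma l2dot_CauchySchwarz x y : l2dot x y ^+ 2 <= l2dot x x * l2dot y y.
Proof.
have := l2dot_ge0 y; rewrite le_eqVlt => /predU1P[/esym y0|y0].
  by rewrite y0 mulr0 (l2dot_eq0 y0) l2dotC l2dot0l expr0n.
have := l2dot_ge0 (l2dot y y *: x + (- l2dot x y) *: y).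
rewrite l2dotDl l2dotZl ![l2dot _ (_ + _)]l2dotC !l2dotDl !l2dotZl (l2dotC y x).
set a := l2dot x x; set b := l2dot y y; set c := l2dot x y.
rewrite (_ : _ + _ = b * (a * b - c ^+ 2)); last by ring.
by rewrite pmulr_rge0// subr_ge0.
Qed.

Lemma sqr_l2norm x : l2norm x ^+ 2 = l2dot x x.
Proof. by rewrite sqr_sqrtr// l2dot_ge0. Qed.

Lemma l2norm_triangle x y : l2norm (x + y) <= l2norm x + l2norm y.
Proof.
rewrite -(@ler_pXn2r _ 2)// ?nnegrE ?addr_ge0 ?sqrtr_ge0//.
rewrite sqrrD !sqr_l2norm.
have -> : l2dot (x + y) (x + y) = l2dot x x + l2dot x y *+ 2 + l2dot y y.
  rewrite -[x]scale1r l2dotDl ![l2dot _ (_ *: _ + _)]l2dotC !l2dotDl !scale1r.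
  by rewrite (l2dotC y x); ring.
rewrite lerD2r lerD2l lerMn2r/=.
apply: le_trans (ler_norm _) _; rewrite -sqrtr_sqr -sqrtrM ?l2dot_ge0//.
by rewrite ler_wsqrtr// l2dot_CauchySchwarz.
Qed.

Lemma l2normZ a x : l2norm (a *: x) = `|a| * l2norm x.
Proof.
rewrite /l2norm (_ : l2dot _ _ = a ^+ 2 * l2dot x x).
  by rewrite sqrtrM ?sqr_ge0// sqrtr_sqr.
by rewrite l2dotZl l2dotC l2dotZl; ring.
Qed.

Lemma l2norm_eq0 x : l2norm x = 0 -> x = 0.
Proof.
by move=> x0; apply: l2dot_eq0; rewrite -sqr_l2norm x0 expr0n.
Qed.

HB.instance Definition _ := @Lmodule_isNormed.Build R (l2 R)
  l2norm l2norm_triangle l2normZ l2norm_eq0.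

(* The Borel sigma-algebra of the norm topology. *)
HB.instance Definition _ := Measurable.copy (l2 R)
  (g_sigma_algebraType (@open (l2 R))).

End l2_norm.

Definition mutually_independent (d d' : measure_display)
    (T : measurableType d) (S : measurableType d') (R : realType)
    (P : probability T R) (I : choiceType) (X : I -> T -> S) : Prop :=
  forall (J : {fset I}) (B : I -> set S),
    (forall i, i \in J -> measurable (B i)) ->
    P (\bigcap_(i in [set` J]) (X i @^-1` B i)) =
      (\prod_(i <- J) P (X i @^-1` B i))%E.

(* Equality is required on measurable sets only: the value of a measure on a
   non-measurable set is unspecified. *)
Definition same_distribution (d d' : measure_display)
    (T : measurableType d) (S : measurableType d') (R : realType)
    (P : probability T R) (X Y : {RV P >-> S}) : Prop :=
  forall B, measurable B -> distribution P X B = distribution P Y B.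

(* The expectation in l^2, as the vector representing h |-> E<X, h>. *)
Definition l2_expectation (d : measure_display) (T : measurableType d)
    (R : realType) (P : probability T R) (X : T -> l2 R) (m : l2 R) : Prop :=
  ('E_P[fun w => `|X w|%R] < +oo)%E /\
  forall h : l2 R, ('E_P[fun w => l2dot (X w) h] = (l2dot m h)%:E)%E.

(* Generalized inverse of a distribution function. *)
Definition quantile (R : realType) (G : R -> R) (u : R) : R :=
  inf [set x | u <= G x].

(* The library norm on matrices is the maximum norm. *)
Definition euclid_norm (R : realType) (m : nat) (x : 'rV[R]_m) : R :=
  Num.sqrt (\sum_(j < m) x ord0 j ^+ 2).

Definition sample_mean (R : realType) (m n : nat) (x : nat -> 'rV[R]_m) :
    'rV[R]_m :=
  n%:R^-1 *: \sum_(i < n) x i.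

Definition test_stat (R : realType) (m n : nat) (x : nat -> 'rV[R]_m) : R :=
  n%:R * euclid_norm (sample_mean n x) ^+ 2.

(* Uniform distribution on {0, ..., n - 1}. *)
Definition uniform_index (d : measure_display) (T : measurableType d)
    (R : realType) (P : probability T R) (n : nat) (K : {RV P >-> nat}) : Prop :=
  forall j, (j < n)%N -> distribution P K [set j] = (n%:R^-1)%:E.

Section bootstrap.
Context (d : measure_display) (T : measurableType d) (R : realType).
Context (P : probability T R) (m n : nat).
Variables (x : nat -> 'rV[R]_m) (K : nat -> {RV P >-> nat}).

Definition bootstrap_obs (k : nat) (w : T) : 'rV[R]_m := x (K k w).

Definition bootstrap_mean (w : T) : 'rV[R]_m :=
  n%:R^-1 *: \sum_(k < n) (bootstrap_obs k w - sample_mean n x).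

Definition bootstrap_stat (w : T) : R :=
  n%:R * euclid_norm (bootstrap_mean w) ^+ 2.

Lemma measurable_bootstrap_stat : measurable_fun setT bootstrap_stat.
Proof.
rewrite (_ : bootstrap_stat = fun w => n%:R * \sum_(j < m)
    (n%:R^-1 * \sum_(k < n) (x (K k w) - sample_mean n x) ord0 j) ^+ 2).
  apply: measurable_funM => //; apply: measurable_sum => j.
  apply: measurable_funX; apply: measurable_funM => //.
  apply: measurable_sum => k.
  rewrite (_ : (fun _ => _) =
    (fun i => (x i - sample_mean n x) ord0 j) \o K k)//.
  by apply: measurableT_comp.
apply/funext => w; rewrite /bootstrap_stat /euclid_norm sqr_sqrtr; last first.
  by apply: sumr_ge0 => j _; rewrite sqr_ge0.
by congr (_ * _); apply: eq_bigr => j _; rewrite mxE summxE.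
Qed.

HB.instance Definition _ :=
  isMeasurableFun.Build _ _ _ _ bootstrap_stat measurable_bootstrap_stat.

Definition bootstrap_cdf (t : R) : R :=
  fine (cdf (bootstrap_stat : {RV P >-> R}) t).

Definition bootstrap_critical (alpha : R) : R :=
  quantile bootstrap_cdf (1 - alpha).

End bootstrap.

Definition truncation (R : realType) (m : nat) (z : l2 R) : 'rV[R]_m :=
  \row_(j < m) z j.

(* Main.v *)
(* Statistics are tested against f_t(x) = step ((|x|^2 - t) / e), a smooth
   version of the indicator of |x|^2 > t, and laws of normalised sums are compared
   by Lindeberg's exchange argument in Trotter's operator form: exchanging all n
   summands costs at most n times the effect of exchanging one, and by Taylor's
   formula that effect is governed by the difference of the two covariances. No
   bound depends on the dimension d n, and no limit law is needed.

   Applied conditionally on the data, the exchange of the observations for the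
   resampled ones shows that the bootstrap law and the law of V n are close in
   mean, since the empirical covariance obeys a law of large numbers in
   Hilbert-Schmidt norm and in trace.

   It remains to see that the law of V n asymptotically has no atoms. With
   s2 = E Z_j^2 > 0 and v = E (Z_j Z), the vector Z - (Z_j / s2) v +- v / sqrt s2,
   where +- is an independent random sign, has the covariance of Z, so it may be
   exchanged for Z. The signs sum up to a rescaled binomial variable g, and given
   everything else V n is a quadratic polynomial in g with leading coefficient at
   least s2; as binomial weights are O(n^(-1/2)), the probability of a shell of
   width e is O(sqrt e) + o(1).

   Levels t at which the smoothed tail of V n equals alpha +- kappa then enclose
   the bootstrap critical value with high probability. *)

From HB Require Import structures.
Require Import Defs.
From mathcomp Require Import all_boot all_order all_algebra.
From mathcomp Require Import finmap.
From mathcomp Require Import all_classical all_reals all_analysis.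
From mathcomp Require Import measurable_realfun ring lra zify.

Set Implicit Arguments.
Unset Strict Implicit.
Unset Printing Implicit Defensive.

Import Order.TTheory GRing.Theory Num.Theory.
Import numFieldNormedType.Exports.

Local Open Scope classical_set_scope.
Local Open Scope ring_scope.

(** * Integrals of real functions and independence *)

(** Since d n tends to infinity, the test functions need Taylor bounds free of the dimension. f_t
    has them because an increment h enters |x + h|^2 only through <x, h> and |h|^2. As <x, h> is
    unbounded in x, it is decisive that [step] is constant beyond 3: the derivatives vanish outside
    a ball whose radius depends on t. Hence every estimate carries an upper bound M for the levels,
    and Markov's inequality has to confine the levels that matter. Only second moments exist, so
    Taylor remainders and products of coordinates are truncated as in Lindeberg's condition. Random
    signs do the smoothing because binomial weights have an elementary bound. Closeness of the
    bootstrap law is expressed by one integrable function of the data that has small mean and bounds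
    the error at all admissible levels at once; Markov's inequality then bounds the probability of a
    bad sample. The width e is chosen from eps and s2, then M, then a threshold for n that serves
    all dimensions; d n tending to infinity makes the coordinate j of positive variance visible. *)

Definition seqR (R : realType) : Type := nat -> R.

Section seqR_measurable.
Context (R : realType).

(** Generators of the product sigma-algebra. Sequences hold vectors of every dimension in one type;
    the dimension [m] enters only through [ip m] and [qn m]. *)
Definition coordinate_cylinders : set (set (seqR R)) :=
  [set A | exists j (B : set R), measurable B /\ A = (fun x => x j) @^-1` B].

HB.instance Definition _ := isPointed.Build (seqR R) (fun=> 0).

HB.instance Definition _ := Measurable.copy (seqR R)
  (g_sigma_algebraType coordinate_cylinders).

Lemma measurable_coord j : measurable_fun setT (fun x : seqR R => x j).
Proof.
move=> _ B mB; rewrite setTI; apply: sub_sigma_algebra.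
by exists j, B.
Qed.

Lemma measurable_fun_coord d (T : measurableType d) (f : T -> seqR R) j :
  measurable_fun setT f -> measurable_fun setT (fun t => f t j).
Proof. by move=> mf; exact: (measurableT_comp (measurable_coord j)). Qed.

Lemma measurable_fun_seqP d (T : measurableType d) (f : T -> seqR R) :
  (forall j, measurable_fun setT (fun t => f t j)) -> measurable_fun setT f.
Proof.
move=> mf; apply: (@measurability _ _ _ _ _ _ coordinate_cylinders) => //.
move=> _ [_ [j [B [mB ->]]] <-].
exact: mf.
Qed.

End seqR_measurable.

Section bounded_integrals.
Context d (T : measurableType d) (R : realType) (P : probability T R).
Implicit Types f g : T -> R.

Lemma bounded_integrable f K : measurable_fun setT f ->
  (forall x, `|f x| <= K) -> P.-integrable setT (EFin \o f).
Proof.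
move=> mf fK.
apply: (@le_integrable _ _ _ _ _ _ _ (EFin \o cst K)) => //.
- exact/measurable_EFinP.
- by move=> x _; rewrite lee_fin (le_trans (fK x))// ler_norm.
- exact: finite_measure_integrable_cst.
Qed.

Lemma Rintegral_EFin f : P.-integrable setT (EFin \o f) ->
  (\int[P]_x f x)%:E = (\int[P]_x (f x)%:E)%E.
Proof. by move=> If; rewrite /Rintegral fineK//; exact: integrable_fin_num. Qed.

Lemma Rintegral_prob_cst r : \int[P]_x r = r.
Proof. by rewrite Rintegral_cst// [X in fine X]probability_setT /= mulr1. Qed.

Lemma norm_Rintegral_le f K : measurable_fun setT f ->
  (forall x, `|f x| <= K) -> `|\int[P]_x f x| <= K.
Proof.
move=> mf fK; have If := bounded_integrable mf fK.
apply: le_trans (le_normr_Rintegral _ _) _ => //.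
rewrite -[leRHS]Rintegral_prob_cst; apply: le_Rintegral => //.
- exact: integrable_norm.
- exact: finite_measure_integrable_cst.
Qed.

End bounded_integrals.

Section joint_law.
Context d d1 d2 (T : measurableType d) (S1 : measurableType d1)
  (S2 : measurableType d2) (R : realType) (P : probability T R).
Variables (U : {mfun T >-> S1}) (V : {mfun T >-> S2}).

Let UV t := (U t, V t).
Let mUV : measurable_fun setT UV. Proof. exact: measurable_fun_pair. Qed.
HB.instance Definition _ := isMeasurableFun.Build _ _ _ _ UV mUV.

(** Conditioned on [E], the law of the pair agrees with the product on rectangles, hence everywhere
    by uniqueness of product measures; if [P E] is 0, both sides vanish. The additional event
    carries the later observations through the induction on partial sums. *)
Lemma joint_law (E : set T) : measurable E ->
  (forall A B, measurable A -> measurable B ->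
    P (U @^-1` A `&` V @^-1` B `&` E) =
    (P (U @^-1` A) * P (V @^-1` B) * P E)%E) ->
  forall C, measurable C -> P ((fun t => (U t, V t)) @^-1` C `&` E) =
    ((distribution P U \x distribution P V) C * P E)%E.
Proof.
move=> mE ind C mC.
have mCE : measurable (UV @^-1` C `&` E).
  apply: measurableI => //; rewrite -[X in measurable X]setTI; exact: mUV.
have [E0|E0] := eqVneq (P E) 0%E.
  rewrite E0 mule0; apply/eqP; rewrite eq_le measure_ge0 andbT -E0.
  by apply: le_measure; [exact: mem_set|exact: mem_set|exact: subIsetr].
have PEfin : P E \is a fin_num by exact: fin_num_measure.
have p0 : 0 < fine (P E).
  by rewrite fine_gt0// lt0e E0 measure_ge0/= ltey_eq PEfin.
have p0' : 0 <= (fine (P E))^-1 by rewrite invr_ge0 ltW.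
pose m' := mscale (NngNum p0') (pushforward (mrestr P mE) UV).
rewrite (@product_measure_unique _ _ _ _ _ _ _ (m' mUV)) => [|A B mA mB|//].
  rewrite /m' /mscale/= /pushforward /mrestr/= muleAC.
  rewrite -[X in (_ * X * _)%E](fineK PEfin).
  by rewrite -EFinM mulVf ?mul1e// gt_eqF.
rewrite -[LHS]/(((fine (P E))^-1)%:E *
  P (U @^-1` A `&` V @^-1` B `&` E))%E ind// muleC.
rewrite -[X in (_ * X * _)%E](fineK PEfin) -muleA -EFinM divff ?mule1//.
by rewrite gt_eqF.
Qed.

Hypothesis indep : forall A B, measurable A -> measurable B ->
  P (U @^-1` A `&` V @^-1` B) = (P (U @^-1` A) * P (V @^-1` B))%E.

Let law C : measurable C -> distribution P UV C =
  (distribution P U \x distribution P V)%E C.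
Proof.
move=> mC; rewrite /distribution/= /pushforward.
rewrite -[UV @^-1` C]setIT joint_law ?probability_setT ?mule1// => A B mA mB.
by rewrite setIT indep// mule1.
Qed.

(** Fubini for the product of the two laws. Both variables of the iterated integral range over [T]
    itself, which is the form that averaging operators take. *)
Lemma indep_integral_bounded (g : S1 * S2 -> R) K :
    measurable_fun setT g -> (forall z, `|g z| <= K) ->
  \int[P]_t g (U t, V t) = \int[P]_s \int[P]_t g (U s, V t).
Proof.
move=> mg gK.
have Ig : (distribution P U \x distribution P V)%E.-integrable setT (EFin \o g).
  exact: bounded_integrable mg gK.
have IgV s : (distribution P V).-integrable setT (EFin \o fun y => g (s, y)).
  apply: (@bounded_integrable _ _ _ _ _ K) => //; exact: measurable_fun_pair2.
congr fine.
transitivity (\int[distribution P UV]_z (g z)%:E)%E.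
  rewrite /distribution integral_pushforward//=; first exact/measurable_EFinP.
  apply: (@bounded_integrable _ _ _ _ _ K) => //.
  exact: measurableT_comp.
rewrite (eq_measure_integral (distribution P U \x distribution P V)%E); last first.
  by move=> C mC _; exact: law.
rewrite -integral12_prod_meas1// /fubini_F.
have mF := measurable_fubini_F Ig.
have FE s : (\int[distribution P V]_y (EFin \o g) (s, y) =
  (\int[P]_t g (s, V t))%:E)%E.
  rewrite Rintegral_EFin; last first.
    apply: (@bounded_integrable _ _ _ _ _ K) => //.
    by apply: measurableT_comp => //; exact: measurable_fun_pair.
  rewrite /distribution integral_pushforward//=.
    apply/measurable_EFinP; exact: measurable_fun_pair2.
  apply: (@bounded_integrable _ _ _ _ _ K) => //.
  by apply: measurableT_comp => //; exact: measurable_fun_pair.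
rewrite (eq_integral (fun s => (\int[P]_t g (s, V t))%:E)); last first.
  by move=> s _; exact: FE.
have mFE : measurable_fun setT (fun s => \int[P]_t g (s, V t)).
  apply/measurable_EFinP; apply: eq_measurable_fun mF => s _ /=.
  by rewrite /fubini_F FE.
rewrite /distribution integral_pushforward//=; first exact/measurable_EFinP.
apply: (@bounded_integrable _ _ _ _ _ K) => //.
  exact: (measurableT_comp mFE).
move=> s; apply: norm_Rintegral_le => //.
by apply: measurableT_comp => //; exact: measurable_fun_pair.
Qed.

Lemma indep_integral_mul (g : S1 -> R) (h : S2 -> R) :
    measurable_fun setT g -> measurable_fun setT h ->
    P.-integrable setT (EFin \o (g \o U)) ->
    P.-integrable setT (EFin \o (h \o V)) ->
  P.-integrable setT (EFin \o fun t => g (U t) * h (V t)) /\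
  \int[P]_t (g (U t) * h (V t)) =
    (\int[P]_t g (U t)) * (\int[P]_t h (V t)).
Proof.
move=> mg mh IgU IhV.
have mgE : measurable_fun setT (EFin \o g) by exact/measurable_EFinP.
have mhE : measurable_fun setT (EFin \o h) by exact/measurable_EFinP.
have Ig : (distribution P U).-integrable setT (EFin \o g).
  by apply: integrable_pushforward.
have Ih : (distribution P V).-integrable setT (EFin \o h).
  by apply: integrable_pushforward.
pose f (z : S1 * S2) := (g z.1 * h z.2)%:E.
have mf : measurable_fun setT f.
  apply/measurable_EFinP; apply: measurable_funM.
    exact: (measurableT_comp mg).
  exact: (measurableT_comp mh).
have If : (distribution P U \x distribution P V)%E.-integrable setT f.
  apply/integrable12ltyP => //.
  under eq_integral => x _.
    under eq_integral => y _ do rewrite /f /= normrM EFinM.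
    rewrite integralZl//; last exact: (integrable_norm Ih).
    over.
  have Ih' := integrable_fin_num measurableT (integrable_norm Ih).
  have Ig' := integrable_fin_num measurableT (integrable_norm Ig).
  rewrite /= -(fineK Ih') integralZr//; last exact: (integrable_norm Ig).
  by rewrite -(fineK Ig') -EFinM ltry.
have IUV : P.-integrable setT (EFin \o fun t => g (U t) * h (V t)).
  have mgh : measurable_fun setT (fun t => g (U t) * h (V t)).
    by apply: measurable_funM; exact: measurableT_comp.
  apply/integrableP; split; first exact/measurable_EFinP.
  have /integrableP[_] := If; rewrite [ltLHS](_ : _ =
    \int[distribution P UV]_z `|f z|)%E; last first.
    by apply: eq_measure_integral => C mC _; exact/esym/law.
  rewrite /distribution ge0_integral_pushforward//=.
  have : measurable_fun setT (abse \o f) by exact: measurableT_comp.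
  by [].
split=> //.
have -> : \int[P]_t (g (U t) * h (V t)) =
    fine (\int[distribution P U \x distribution P V]_z f z)%E.
  congr fine; rewrite (eq_measure_integral (distribution P UV)); last first.
    by move=> C mC _; exact/esym/law.
  by rewrite /distribution integral_pushforward.
rewrite -integral12_prod_meas1// /fubini_F /f /=.
transitivity (fine (\int[distribution P U]_x
  ((g x)%:E * \int[distribution P V]_y (h y)%:E))%E).
  congr fine; apply: eq_integral => x _.
  by under eq_integral do rewrite EFinM; rewrite integralZl.
have fh : (\int[distribution P V]_y (h y)%:E)%E \is a fin_num.
  exact: integrable_fin_num.
rewrite -(fineK fh) integralZr// fineM ?fineK//; last exact: integrable_fin_num.
congr (fine _ * fine _).
  by rewrite /distribution integral_pushforward.
by rewrite /distribution integral_pushforward.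
Qed.

End joint_law.

Section real_integrability.
Context d (T : measurableType d) (R : realType) (P : probability T R).
Implicit Types (f g : T -> R) (k : R).

Definition rintegrable f := P.-integrable setT (EFin \o f).

Lemma rintegrable_measurable f : rintegrable f -> measurable_fun setT f.
Proof. by move=> /integrableP[/measurable_EFinP]. Qed.

Lemma rintegrableD f g : rintegrable f -> rintegrable g ->
  rintegrable (fun x => f x + g x).
Proof. by move=> If Ig; apply: eq_integrable (integrableD measurableT If Ig). Qed.

Lemma rintegrableB f g : rintegrable f -> rintegrable g ->
  rintegrable (fun x => f x - g x).
Proof. by move=> If Ig; apply: eq_integrable (integrableB measurableT If Ig). Qed.

Lemma rintegrableZ k f : rintegrable f -> rintegrable (fun x => k * f x).
Proof. by move=> If; apply: eq_integrable (integrableZl measurableT k If). Qed.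

Lemma rintegrable_cst k : rintegrable (fun=> k).
Proof. exact: finite_measure_integrable_cst. Qed.

Lemma rintegrable_le f g : measurable_fun setT f -> rintegrable g ->
  (forall x, `|f x| <= g x) -> rintegrable f.
Proof.
move=> mf Ig fg; apply: (@le_integrable _ _ _ _ _ _ _ (EFin \o g)) => //.
  exact/measurable_EFinP.
by move=> x _; rewrite lee_fin (le_trans (fg x))// ler_norm.
Qed.

Lemma rintegrable_sum I (s : seq I) (F : I -> T -> R) :
  (forall i, rintegrable (F i)) -> rintegrable (fun x => \sum_(i <- s) F i x).
Proof.
move=> IF; elim: s => [|i s IH].
  by under eq_fun do rewrite big_nil; exact: rintegrable_cst.
by under eq_fun do rewrite big_cons; exact: rintegrableD.
Qed.

Lemma Rintegral_sum I (s : seq I) (F : I -> T -> R) :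
  (forall i, rintegrable (F i)) ->
  \int[P]_x (\sum_(i <- s) F i x) = \sum_(i <- s) \int[P]_x F i x.
Proof.
move=> IF; elim: s => [|i s IH].
  rewrite big_nil -[RHS](Rintegral_prob_cst P).
  by apply: eq_Rintegral => x _; rewrite big_nil.
rewrite big_cons -IH -RintegralD//; [|exact: IF|exact: rintegrable_sum].
by apply: eq_Rintegral => x _; rewrite big_cons.
Qed.

Lemma le_Rint f g : rintegrable f -> rintegrable g -> (forall x, f x <= g x) ->
  \int[P]_x f x <= \int[P]_x g x.
Proof. by move=> If Ig fg; exact: le_Rintegral. Qed.

Lemma norm_Rint_le f g : measurable_fun setT f -> rintegrable g ->
  (forall x, `|f x| <= g x) -> `|\int[P]_x f x| <= \int[P]_x g x.
Proof.
move=> mf Ig fg; have If := rintegrable_le mf Ig fg.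
apply: le_trans (le_normr_Rintegral _ _) _ => //.
by apply: le_Rint => //; exact: integrable_norm.
Qed.

End real_integrability.

(** * Averaging operators and Lindeberg's exchange argument *)

Section bounded_fubini.
Context d1 d2 (T1 : measurableType d1) (T2 : measurableType d2) (R : realType).
Variables (P1 : probability T1 R) (P2 : probability T2 R).
Variables (g : T1 * T2 -> R) (K : R).
Hypothesis mg : measurable_fun setT g.
Hypothesis gK : forall z, `|g z| <= K.

Let Ig : (P1 \x P2)%E.-integrable setT (EFin \o g).
Proof. exact: bounded_integrable mg gK. Qed.

Let FE x : fubini_F P2 (EFin \o g) x = (\int[P2]_y g (x, y))%:E.
Proof.
rewrite Rintegral_EFin//; apply: (@bounded_integrable _ _ _ _ _ K) => //.
exact: measurable_fun_pair2.
Qed.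

Let GE y : fubini_G P1 (EFin \o g) y = (\int[P1]_x g (x, y))%:E.
Proof.
rewrite Rintegral_EFin//; apply: (@bounded_integrable _ _ _ _ _ K) => //.
exact: measurable_fun_pair1.
Qed.

Lemma measurable_Rintegral_snd : measurable_fun setT (fun x => \int[P2]_y g (x, y)).
Proof.
apply/measurable_EFinP; apply: eq_measurable_fun (measurable_fubini_F Ig).
by move=> x _; exact: FE.
Qed.

Lemma Rintegral_fubini_bounded :
  \int[P1]_x \int[P2]_y g (x, y) = \int[P2]_y \int[P1]_x g (x, y).
Proof.
congr fine; transitivity (\int[P1]_x fubini_F P2 (EFin \o g) x)%E.
  by apply: eq_integral => x _; rewrite FE.
rewrite integral12_prod_meas1// -integral21_prod_meas1//.
by apply: eq_integral => x _; rewrite GE.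
Qed.

End bounded_fubini.

Section averaging_operators.
Context (R : realType).
Implicit Types (c x y : seqR R) (f g : seqR R -> R).

Definition sadd x y : seqR R := fun j => x j + y j.
Definition szero : seqR R := fun=> 0.

Lemma saddA x y z : sadd x (sadd y z) = sadd (sadd x y) z.
Proof. by apply/funext => j; rewrite /sadd addrA. Qed.

Lemma saddC x y : sadd x y = sadd y x.
Proof. by apply/funext => j; rewrite /sadd addrC. Qed.

Lemma saddx0 x : sadd x szero = x.
Proof. by apply/funext => j; rewrite /sadd addr0. Qed.

Lemma measurable_sadd d (T : measurableType d) (u v : T -> seqR R) :
  measurable_fun setT u -> measurable_fun setT v ->
  measurable_fun setT (fun t => sadd (u t) (v t)).
Proof.
move=> mu mv; apply: measurable_fun_seqP => j; apply: measurable_funD.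
  by apply: (measurableT_comp (@measurable_coord R j)).
by apply: (measurableT_comp (@measurable_coord R j)).
Qed.

Definition bounded_measurable f :=
  measurable_fun setT f /\ exists K, forall x, `|f x| <= K.

Lemma bounded_measurableB f g : bounded_measurable f -> bounded_measurable g ->
  bounded_measurable (fun x => f x - g x).
Proof.
move=> [mf [K fK]] [mg [L gL]]; split; first exact: measurable_funB.
by exists (K + L) => x; rewrite (le_trans (ler_normB _ _))// lerD.
Qed.

Section avg.
Context d (T : measurableType d) (P : probability T R) (xi : T -> seqR R).

(** Trotter's operator, the convolution with the law of [xi]. Its iterates describe sums of
    independent copies, so that no product space has to be built. *)
Definition avg f c := \int[P]_t f (sadd c (xi t)).

Hypothesis mxi : measurable_fun setT xi.

Let mfc f c : measurable_fun setT f ->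
  measurable_fun setT (fun t => f (sadd c (xi t))).
Proof. by move=> mf; apply: (measurableT_comp mf); exact: measurable_sadd. Qed.

Let Ifc f c : bounded_measurable f ->
  P.-integrable setT (EFin \o fun t => f (sadd c (xi t))).
Proof.
move=> [mf [K fK]]; apply: (@bounded_integrable _ _ _ _ _ K) => //.
exact: mfc.
Qed.

Lemma avg_norm_le f K c : measurable_fun setT f ->
  (forall x, `|f x| <= K) -> `|avg f c| <= K.
Proof. by move=> mf fK; apply: norm_Rintegral_le => //; exact: mfc. Qed.

Lemma avg_bounded_measurable f :
  bounded_measurable f -> bounded_measurable (avg f).
Proof.
move=> [mf [K fK]]; split; last by exists K => c; exact: avg_norm_le.
(* Measurability in [c] is read off the Fubini lemma, with a Dirac mass as the probability on the
   side of [c]. *)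
have := @measurable_Rintegral_snd _ _ (seqR R) T R (@dirac _ (seqR R) szero R) P
  (fun z => f (sadd z.1 (xi z.2))) K; apply => //.
apply: (measurableT_comp mf); apply: measurable_sadd => //.
exact: measurableT_comp.
Qed.

Lemma avgB f g c : bounded_measurable f -> bounded_measurable g ->
  avg (fun x => f x - g x) c = avg f c - avg g c.
Proof. by move=> bf bg; rewrite /avg RintegralB//; exact: Ifc. Qed.

Lemma le_avg f g c : bounded_measurable f -> bounded_measurable g ->
  (forall x, f x <= g x) -> avg f c <= avg g c.
Proof. by move=> bf bg fg; apply: le_Rintegral => //; exact: Ifc. Qed.

End avg.

Lemma avg_comm d1 d2 (T1 : measurableType d1) (T2 : measurableType d2)
    (P1 : probability T1 R) (P2 : probability T2 R) xi1 xi2 f c :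
  measurable_fun setT xi1 -> measurable_fun setT xi2 -> bounded_measurable f ->
  avg P1 xi1 (avg P2 xi2 f) c = avg P2 xi2 (avg P1 xi1 f) c.
Proof.
move=> m1 m2 [mf [K fK]]; rewrite /avg.
rewrite (Rintegral_fubini_bounded P1 P2
  (g := fun z => f (sadd (sadd c (xi1 z.1)) (xi2 z.2))) (K := K)) => //.
  apply: eq_Rintegral => y _; apply: eq_Rintegral => x _ /=.
  by rewrite -!saddA [sadd (xi1 _) _]saddC.
apply: (measurableT_comp mf); apply: measurable_sadd.
  apply: measurable_sadd => //.
  by apply: (measurableT_comp m1).
by apply: (measurableT_comp m2).
Qed.

(* Only the abstract properties of an averaging operator are kept, so that the
   Rademacher operator and products of operators are covered as well. *)
Record averaging (A : (seqR R -> R) -> seqR R -> R) : Prop := Averaging {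
  averaging_bm : forall f, bounded_measurable f -> bounded_measurable (A f);
  averagingB : forall f g c, bounded_measurable f -> bounded_measurable g ->
    A (fun x => f x - g x) c = A f c - A g c;
  averaging_le : forall f K c, measurable_fun setT f ->
    (forall x, `|f x| <= K) -> `|A f c| <= K }.

Lemma avg_averaging d (T : measurableType d) (P : probability T R) xi :
  measurable_fun setT xi -> averaging (avg P xi).
Proof.
move=> mxi; split.
- by move=> f; exact: avg_bounded_measurable.
- by move=> f g c; exact: avgB.
- by move=> f K c; exact: avg_norm_le.
Qed.

Lemma iter_averaging A k : averaging A -> averaging (iter k A).
Proof.
move=> aA; elim: k => [|k IH]; first by split.
split=> /=.
- by move=> f bf; apply: averaging_bm => //; exact: averaging_bm.
- move=> f g c bf bg; rewrite -averagingB//; try exact: averaging_bm.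
  by congr (A _ c); apply/funext => x; exact: averagingB.
- move=> f K c mf fK; apply: averaging_le => //.
    by apply: (proj1 (averaging_bm IH _)); split => //; exists K.
  by move=> x; exact: averaging_le.
Qed.

Lemma comp_averaging A B : averaging A -> averaging B ->
  averaging (fun f => A (B f)).
Proof.
move=> aA aB; split=> /=.
- by move=> f bf; apply: averaging_bm => //; exact: averaging_bm.
- move=> f g c bf bg; rewrite -averagingB//; try exact: averaging_bm.
  by congr (A _ c); apply/funext => x; exact: averagingB.
- move=> f K c mf fK; apply: averaging_le => //.
    by apply: (proj1 (averaging_bm aB _)); split => //; exists K.
  by move=> x; exact: averaging_le.
Qed.

Lemma iter_comm A B k f : averaging A -> averaging B ->
  (forall g, bounded_measurable g -> A (B g) = B (A g)) ->
  bounded_measurable f -> iter k A (B f) = B (iter k A f).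
Proof.
move=> aA aB AB bf; elim: k => //= k ->; apply: AB.
by apply: averaging_bm => //; exact: iter_averaging.
Qed.

Lemma iter_comp A B k f : averaging A -> averaging B ->
  (forall g, bounded_measurable g -> A (B g) = B (A g)) ->
  bounded_measurable f ->
  iter k (fun g => A (B g)) f = iter k A (iter k B f).
Proof.
move=> aA aB AB; elim: k f => //= k IH f bf; rewrite IH//.
congr (A _); rewrite -(iter_comm _ aA aB) ?iterS//.
by apply: averaging_bm => //; exact: iter_averaging.
Qed.

(** Telescoping: A^(n+1) f - B^(n+1) f = A^n (A f - B f) + B (A^n f - B^n f), by commutation. As
    averaging operators are contractions for the supremum norm, each exchange adds at most [D]. *)
Lemma iter_averaging_dist A B n f D : averaging A -> averaging B ->
  (forall g, bounded_measurable g -> A (B g) = B (A g)) ->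
  bounded_measurable f -> (forall x, `|A f x - B f x| <= D) ->
  forall c, `|iter n A f c - iter n B f c| <= n%:R * D.
Proof.
move=> aA aB AB bf fD; elim: n => [|n IH] c.
  by rewrite subrr normr0 mul0r.
have bAf : bounded_measurable (A f) by exact: averaging_bm.
have bBf : bounded_measurable (B f) by exact: averaging_bm.
have aAn := iter_averaging n aA; have aBn := iter_averaging n aB.
have -> : iter n.+1 A f c - iter n.+1 B f c =
    iter n A (fun x => A f x - B f x) c +
    B (fun x => iter n A f x - iter n B f x) c.
  rewrite !averagingB//; [|exact: averaging_bm..].
  rewrite -(iter_comm n aA aB AB bf) iterSr iterS.
  by rewrite addrA subrK.
rewrite (le_trans (ler_normD _ _))// -natr1 mulrDl mul1r addrC lerD//.
  apply: averaging_le => //.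
  exact: (proj1 (bounded_measurableB (averaging_bm aAn bf) (averaging_bm aBn bf))).
apply: averaging_le => //.
exact: (proj1 (bounded_measurableB bAf bBf)).
Qed.

End averaging_operators.

(** * Sums of independent identically distributed terms as iterated operators *)

Section iid_sums.
Context d dS (T : measurableType d) (S : measurableType dS) (R : realType).
Context (P : probability T R) (n : nat) (X : nat -> {mfun T >-> S}).
Variable xi : S -> seqR R.
Hypothesis mxi : measurable_fun setT xi.

Definition product_rule := forall B : nat -> set S,
  (forall i, measurable (B i)) ->
  P (\bigcap_(i < n) (X i @^-1` B i)) = (\prod_(i < n) P (X i @^-1` B i))%E.

Definition identically_distributed := forall i (B : set S), (i < n)%N ->
  measurable B -> P (X i @^-1` B) = P (X 0%N @^-1` B).

Definition psum k (t : T) : seqR R := fun j => \sum_(i < k) xi (X i t) j.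

Lemma psumS k t : psum k.+1 t = sadd (psum k t) (xi (X k t)).
Proof. by apply/funext => j; rewrite /psum /sadd big_ord_recr. Qed.

Lemma measurable_psum k : measurable_fun setT (psum k).
Proof.
apply: measurable_fun_seqP => j; apply: measurable_sum => i.
apply: (measurable_fun_coord (f := fun t => xi (X i t))).
exact: (measurableT_comp mxi).
Qed.

HB.instance Definition _ k :=
  isMeasurableFun.Build _ _ _ _ (psum k) (measurable_psum k).

Hypothesis indep : product_rule.
Hypothesis ident : identically_distributed.

Let tail k (B : nat -> set S) : set T :=
  \bigcap_(i in [set i | (k <= i < n)%N]) (X i @^-1` B i).

Let mpre i B : measurable B -> measurable (X i @^-1` B).
Proof. by move=> mB; exact: measurable_funPTI. Qed.

Let mtail k B : (forall i, measurable (B i)) -> measurable (tail k B).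
Proof. by move=> mB; apply: bigcap_measurableType => i _; exact: mpre. Qed.



Let tailE k (B : nat -> set S) : (k < n)%N ->
  tail k B = X k @^-1` B k `&` tail k.+1 B.
Proof.
move=> kn; rewrite /tail; apply/seteqP; split=> t /=.
  move=> tB; split; first by apply: tB => /=; rewrite leqnn.
  by move=> i /= /andP[ki ltin]; apply: tB => /=; rewrite ltin ltnW.
move=> [tk tB] i /= /andP[]; rewrite leq_eqVlt => /predU1P[<-//|ki ltin].
by apply: tB; rewrite /= ki.
Qed.

(** Independence of a partial sum from all later observations jointly. Keeping the later events in
    the statement is what lets the induction run on [k]: the next summand is split off from them,
    and [joint_law] absorbs it into the sum. *)
Let claim k : (k <= n)%N -> forall A B, measurable A ->
  (forall i, measurable (B i)) ->
  P (psum k @^-1` A `&` tail k B) =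
  (P (psum k @^-1` A) * \prod_(k <= i < n) P (X i @^-1` B i))%E.
Proof.
elim: k => [|k IH] kn A B mA mB.
  have [A0|A0] := pselect (A (fun=> 0)).
    have -> : psum 0 @^-1` A = setT.
      apply/seteqP; split=> // t _ /=; rewrite (_ : psum 0 t = fun=> 0)//.
      by apply/funext => j; rewrite /psum big_ord0.
    rewrite setTI probability_setT mul1e big_mkord -indep//.
  have -> : psum 0 @^-1` A = set0.
    apply/seteqP; split=> // t /=; rewrite (_ : psum 0 t = fun=> 0)//.
    by apply/funext => j; rewrite /psum big_ord0.
  by rewrite set0I measure0 mul0e.
have {}IH := IH (ltnW kn).
have tailT : tail k.+1 (fun=> setT) = setT.
  by apply/seteqP; split=> // t _ i _.
have joint (B' : nat -> set S) (C : set (seqR R * S)) :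
    (forall i, measurable (B' i)) -> measurable C ->
    P ((fun t => (psum k t, X k t)) @^-1` C `&` tail k.+1 B') =
    ((distribution P (psum k) \x distribution P (X k)) C *
       \prod_(k.+1 <= i < n) P (X i @^-1` B' i))%E.
  move=> mB' mC.
  have ptail : P (tail k.+1 B') = (\prod_(k.+1 <= i < n) P (X i @^-1` B' i))%E.
    (* Trivial events for the sum and at index [k] isolate the probability of the later events. *)
    have := IH setT (fun i => if i == k then setT else B' i) measurableT.
    rewrite setTI tailE// eqxx preimage_setT probability_setT mul1e.
    rewrite (big_ltn kn) eqxx preimage_setT probability_setT mul1e setTI.
    have -> : tail k.+1 (fun i => if i == k then setT else B' i) = tail k.+1 B'.
      apply: eq_bigcapr => i /= /andP[ki _].
      by rewrite ifF//; apply/negbTE; rewrite neq_ltn ki orbT.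
    move=> ->; last by move=> i; case: ifP.
    by apply: eq_big_nat => i /andP[ki _]; rewrite gtn_eqF.
  rewrite -ptail; apply: joint_law => //; first exact: mtail.
  move=> A1 B1 mA1 mB1.
  have := IH A1 (fun i => if i == k then B1 else B' i) mA1.
  rewrite tailE// eqxx (big_ltn kn) eqxx setIA.
  have -> : tail k.+1 (fun i => if i == k then B1 else B' i) = tail k.+1 B'.
    apply: eq_bigcapr => i /= /andP[ki _].
    by rewrite ifF//; apply/negbTE; rewrite neq_ltn ki orbT.
  move=> ->; last by move=> i; case: ifP.
  rewrite -muleA ptail; congr (_ * (_ * _))%E.
  by apply: eq_big_nat => i /andP[ki _]; rewrite gtn_eqF.
have mC : measurable ((fun z : seqR R * S => sadd z.1 (xi z.2)) @^-1` A).
  rewrite -[X in measurable X]setTI.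
  have m : measurable_fun setT (fun z : seqR R * S => sadd z.1 (xi z.2)).
    by apply: measurable_sadd => //; exact: (measurableT_comp mxi).
  exact: m.
have E : psum k.+1 @^-1` A = (fun t => (psum k t, X k t)) @^-1`
    ((fun z : seqR R * S => sadd z.1 (xi z.2)) @^-1` A).
  by apply/seteqP; split=> t /=; rewrite psumS.
rewrite E joint//; congr (_ * _)%E.
(* The same identity with trivial later events identifies the remaining factor as the probability
   for the sum of [k.+1] terms. *)
have := joint (fun=> setT) _ (fun=> measurableT) mC.
rewrite tailT setIT => ->.
rewrite big_nat big1 ?mule1// => i _.
by rewrite preimage_setT probability_setT.
Qed.

Lemma indep_psum k A B : (k < n)%N -> measurable A -> measurable B ->
  P (psum k @^-1` A `&` X k @^-1` B) =
  (P (psum k @^-1` A) * P (X k @^-1` B))%E.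
Proof.
move=> kn mA mB.
have := claim (ltnW kn) (B := fun i => if i == k then B else setT) mA.
rewrite tailE// eqxx (big_ltn kn) eqxx.
have -> : tail k.+1 (fun i => if i == k then B else setT) = setT.
  apply/seteqP; split=> // t _ i /= /andP[ki _].
  by rewrite ifF//; apply/negbTE; rewrite neq_ltn ki orbT.
rewrite setIT big_nat big1 ?mule1; last first.
  by move=> i /andP[ki _]; rewrite gtn_eqF// preimage_setT probability_setT.
by apply=> i; case: ifP.
Qed.

Lemma identically_distributed_Rintegral k (g : S -> R) : (k < n)%N ->
  measurable_fun setT g -> rintegrable P (fun t => g (X 0%N t)) ->
  rintegrable P (fun t => g (X k t)) /\
  \int[P]_t g (X k t) = \int[P]_t g (X 0%N t).
Proof.
move=> kn mg I0.
have mgE : measurable_fun setT (EFin \o g) by exact/measurable_EFinP.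
have eqm A : measurable A -> distribution P (X k) A = distribution P (X 0%N) A.
  by move=> mA; exact: ident.
have I0' : (distribution P (X 0%N)).-integrable setT (EFin \o g).
  by apply: integrable_pushforward.
have Ik : rintegrable P (fun t => g (X k t)).
  have /integrableP[_] := I0'.
  rewrite (eq_measure_integral (distribution P (X k))); last first.
    by move=> A mA _; exact/esym/eqm.
  rewrite /distribution ge0_integral_pushforward//=; last first.
    have : measurable_fun setT (abse \o (EFin \o g)) by exact: measurableT_comp.
    by [].
  move=> h; apply/integrableP; split=> //.
  by apply/measurable_EFinP; exact: measurableT_comp.
split=> //; congr fine.
transitivity (\int[distribution P (X k)]_y (g y)%:E)%E.
  by rewrite /distribution integral_pushforward.
rewrite (eq_measure_integral (distribution P (X 0%N))); last first.
  by move=> A mA _; exact: eqm.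
by rewrite /distribution integral_pushforward.
Qed.

(** The last summand is independent of the others and distributed like that of index 0, so
    integrating it out first replaces [f] by [avg f]; the induction hypothesis applies to this new
    function. *)
Lemma integral_psum k f c : (k <= n)%N -> bounded_measurable f ->
  \int[P]_t f (sadd c (psum k t)) = iter k (avg P (fun t => xi (X 0%N t))) f c.
Proof.
have mxX : measurable_fun setT (fun t => xi (X 0%N t)).
  exact: (measurableT_comp mxi).
elim: k f => [|k IH] f kn bf /=.
  rewrite (_ : (fun t => f (sadd c (psum 0 t))) = cst (f c)).
    by rewrite /cst Rintegral_prob_cst.
  apply/funext => t; congr f; apply/funext => j.
  by rewrite /sadd /psum big_ord0 addr0.
rewrite -iterS iterSr -IH//; [|exact: ltnW|exact: avg_bounded_measurable].
have [mf [K fK]] := bf.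
under eq_Rintegral do rewrite psumS saddA.
have mg : measurable_fun setT
    (fun z : seqR R * S => f (sadd (sadd c z.1) (xi z.2))).
  apply: (measurableT_comp mf); apply: measurable_sadd.
    exact: measurable_sadd.
  exact: (measurableT_comp mxi).
rewrite (indep_integral_bounded (U := psum k) (V := X k) _ mg (fun=> fK _));
  last first.
  by move=> A B mA mB; exact: indep_psum.
apply: eq_Rintegral => s _ /=.
pose g x := f (sadd (sadd c (psum k s)) (xi x)).
have mg' : measurable_fun setT g.
  by apply: (measurableT_comp mf); exact: measurable_sadd.
apply: (@identically_distributed_Rintegral k g kn mg' _).2.
have mgX : measurable_fun setT (fun t => g (X 0%N t)) by exact: measurableT_comp.
exact: bounded_integrable mgX (fun t => fK _).
Qed.

End iid_sums.

(** * A smooth step function and its Taylor expansion *)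

Section cubic_step.
Context (R : realType).
Implicit Types t e : R.

Definition pospart t : R := if 0 <= t then t else 0.

(** The cube of the positive part is twice differentiable, and its second derivative [6 * pospart]
    is Lipschitz with constant 6; hence the remainder constant 6 / 3! = 1. *)
Lemma pospart_taylor3 t e :
  `|pospart (t + e) ^+ 3 - pospart t ^+ 3 - 3 * pospart t ^+ 2 * e -
    3 * pospart t * e ^+ 2| <= `|e| ^+ 3.
Proof.
rewrite -normrX /pospart; case: (leP 0 t) => t0; case: (leP 0 (t + e)) => te0.
- by rewrite [X in `|X| <= _](_ : _ = e ^+ 3)//; ring.
- have e0 : e <= 0 by lra.
  have e3 : e ^+ 3 <= 0 by rewrite exprS mulr_le0_ge0// sqr_ge0.
  have te3 : (t + e) ^+ 3 <= 0 by rewrite exprS mulr_le0_ge0 ?sqr_ge0// ltW.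
  have -> : 0 ^+ 3 - t ^+ 3 - 3 * t ^+ 2 * e - 3 * t * e ^+ 2 =
    e ^+ 3 - (t + e) ^+ 3 by ring.
  rewrite [leRHS]ler0_norm// ler0_norm; first lra.
  have : 0 <= t * ((t + e) ^+ 2 + (t + e) * e + e ^+ 2).
    by rewrite mulr_ge0// addr_ge0 ?sqr_ge0// addr_ge0 ?sqr_ge0// mulr_le0// ltW.
  rewrite (_ : _ * _ = (t + e) ^+ 3 - e ^+ 3); last by ring.
  by lra.
- have e0 : 0 <= e by lra.
  have e3 : 0 <= e ^+ 3 by rewrite exprn_ge0.
  have te3 : 0 <= (t + e) ^+ 3 by rewrite exprn_ge0.
  have -> : (t + e) ^+ 3 - 0 ^+ 3 - 3 * 0 ^+ 2 * e - 3 * 0 * e ^+ 2 =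
    (t + e) ^+ 3 by ring.
  by rewrite !ger0_norm// lerXn2r ?nnegrE//; lra.
- have -> : 0 ^+ 3 - 0 ^+ 3 - 3 * 0 ^+ 2 * e - 3 * 0 * e ^+ 2 = 0 by ring.
  by rewrite normr0.
Qed.

(* The integral of the quadratic cardinal B-spline, and its first two
   derivatives. *)
Definition step t : R := (pospart t ^+ 3 - 3 * pospart (t - 1) ^+ 3 +
  3 * pospart (t - 2) ^+ 3 - pospart (t - 3) ^+ 3) / 6.

Definition step1 t : R := (pospart t ^+ 2 - 3 * pospart (t - 1) ^+ 2 +
  3 * pospart (t - 2) ^+ 2 - pospart (t - 3) ^+ 2) / 2.

Definition step2 t : R := pospart t - 3 * pospart (t - 1) +
  3 * pospart (t - 2) - pospart (t - 3).

(** The four shifted cubes have weights 1, 3, 3, 1 over 6; their remainders add up to 4/3, rounded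
    up to 2. *)
Lemma step_taylor t e :
  `|step (t + e) - step t - step1 t * e - step2 t * e ^+ 2 / 2| <=
  2 * `|e| ^+ 3.
Proof.
have h0 := pospart_taylor3 t e.
have h1 := pospart_taylor3 (t - 1) e.
have h2 := pospart_taylor3 (t - 2) e.
have h3 := pospart_taylor3 (t - 3) e.
have e3 : 0 <= `|e| ^+ 3 by rewrite exprn_ge0.
rewrite /step /step1 /step2.
rewrite (addrAC t e (-1)) (addrAC t e (-2)) (addrAC t e (-3)).
move: h0 h1 h2 h3; rewrite !ler_norml => /andP[? ?] /andP[? ?] /andP[? ?] /andP[? ?].
by apply/andP; split; lra.
Qed.

Variant step_pieces t : R -> R -> R -> R -> Prop :=
  | StepLeft of t < 0 : step_pieces t 0 0 0 0
  | StepPiece1 of 0 <= t & t <= 1 : step_pieces t t 0 0 0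
  | StepPiece2 of 1 <= t & t <= 2 : step_pieces t t (t - 1) 0 0
  | StepPiece3 of 2 <= t & t <= 3 : step_pieces t t (t - 1) (t - 2) 0
  | StepRight of 3 <= t : step_pieces t t (t - 1) (t - 2) (t - 3).

Lemma step_piecesP t : step_pieces t
  (pospart t) (pospart (t - 1)) (pospart (t - 2)) (pospart (t - 3)).
Proof.
rewrite /pospart; case: (leP 0 t) => h0; case: (leP 0 (t - 1)) => h1;
  case: (leP 0 (t - 2)) => h2; case: (leP 0 (t - 3)) => h3; try lra;
  constructor; lra.
Qed.

Lemma step_eq0 t : t <= 0 -> step t = 0.
Proof.
move=> t0; rewrite /step; case: step_piecesP => [h|h h'|h h'|h h'|h]; try lra.
have -> : t = 0 by lra.
by ring.
Qed.

Lemma step_eq1 t : 3 <= t -> step t = 1.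
Proof.
move=> t3; rewrite /step; case: step_piecesP => [h|h h'|h h'|h h'|h]; try lra.
have -> : t = 3 by lra.
by field.
Qed.

Lemma step_itv t : 0 <= step t <= 1.
Proof.
rewrite /step; case: step_piecesP => [h|h0 h1|h0 h1|h0 h1|h].
- by lra.
- have : 0 <= t ^+ 3 <= 1 by rewrite exprn_ge0//= exprn_ile1.
  lra.
- set s := t - 1.
  have [s0 s1] : 0 <= s /\ s <= 1 by rewrite /s; lra.
  have -> : t = s + 1 by rewrite /s; ring.
  have s2 : 0 <= s ^+ 2 <= s by rewrite sqr_ge0 expr2 ler_piMl.
  have s3 : 0 <= s ^+ 3 by rewrite exprn_ge0.
  have s3' : 3 * s ^+ 2 - 2 * s ^+ 3 <= 1.
    have : 0 <= (1 - s) ^+ 2 * (1 + 2 * s) by rewrite mulr_ge0 ?sqr_ge0//; lra.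
    lra.
  have s3'' : s ^+ 3 <= s by rewrite exprS ler_piMr// exprn_ile1.
  apply/andP; split; lra.
(* By the symmetry of the spline, the value here is 1 - s^3 / 6. *)
- set s := 3 - t.
  have [s0 s1] : 0 <= s /\ s <= 1 by rewrite /s; lra.
  have : 0 <= s ^+ 3 <= 1 by rewrite exprn_ge0//= exprn_ile1.
  rewrite /s; lra.
- lra.
Qed.

(** A crude bound, as is the 24 for [step2]; the sharp ones are 3/4 and 1. The values enter only
    through constants that are fixed before [n]. *)
Lemma step1_le t : `|step1 t| <= 36.
Proof.
rewrite /step1 ler_norml; case: step_piecesP => [h|h h'|h h'|h h'|h];
  apply/andP; split; nra.
Qed.

Lemma step2_le t : `|step2 t| <= 24.
Proof.
rewrite /step2 ler_norml; case: step_piecesP => [h|h h'|h h'|h h'|h];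
  apply/andP; split; lra.
Qed.

Lemma step1_eq0 t : 3 <= t -> step1 t = 0.
Proof.
move=> t3; rewrite /step1; case: step_piecesP => [h|h h'|h h'|h h'|h]; try lra.
have -> : t = 3 by lra.
by field.
Qed.

Lemma step2_eq0 t : 3 <= t -> step2 t = 0.
Proof.
by move=> t3; rewrite /step2; case: step_piecesP => [h|h h'|h h'|h h'|h]; lra.
Qed.

(** The constant is 36 + 24 / 2 + 2, from the three terms of the Taylor estimate. *)
Lemma step_lipschitz t e : `|e| <= 1 -> `|step (t + e) - step t| <= 50 * `|e|.
Proof.
move=> e1; have h := step_taylor t e.
have h1 := step1_le t; have h2 := step2_le t.
have a0 : 0 <= `|e| by [].
have e2 : `|e| ^+ 2 <= `|e| by rewrite expr2 ler_piMl.
have e3 : `|e| ^+ 3 <= `|e| by rewrite exprS ler_piMr// exprn_ile1.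
have k1 : `|step1 t * e| <= 36 * `|e| by rewrite normrM ler_wpM2r.
have k2 : `|step2 t * e ^+ 2 / 2| <= 12 * `|e|.
  rewrite normrM normfV (@ger0_norm _ 2)// [X in X / 2]normrM normrX.
  have : `|step2 t| * `|e| ^+ 2 <= 24 * `|e| by rewrite ler_pM// exprn_ge0.
  lra.
move: h k1 k2; rewrite !ler_norml => /andP[? ?] /andP[? ?] /andP[? ?].
by apply/andP; split; lra.
Qed.

Lemma measurable_step : measurable_fun setT step.
Proof.
have mp (a : R) : measurable_fun setT (fun t : R => pospart (t - a)).
  rewrite (_ : (fun t => _) = fun t : R => Num.max 0 (t - a)); last first.
    by apply/funext => t; rewrite /pospart; case: leP => h.
  by apply: measurable_maxr => //; exact: measurable_funB.
rewrite /step; apply: measurable_funM => //.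
apply: measurable_funB; last exact: measurable_funX.
apply: measurable_funD; last by apply: measurable_funM => //; exact: measurable_funX.
apply: measurable_funB; last by apply: measurable_funM => //; exact: measurable_funX.
apply: measurable_funX; have := mp 0.
by under eq_fun do rewrite subr0.
Qed.

End cubic_step.

(** * Finite-dimensional sections of sequences and the smoothed indicator of a norm *)

Section truncated_inner_product.
Context (R : realType) (m : nat).
Implicit Types (x y c h : seqR R) (a b : R).

Definition ip x y : R := \sum_(j < m) x j * y j.
Definition qn x : R := \sum_(j < m) x j ^+ 2.
Definition sscale a x : seqR R := fun j => a * x j.

Lemma qn_ge0 x : 0 <= qn x.
Proof. by apply: sumr_ge0 => j _; exact: sqr_ge0. Qed.

Lemma qn_sadd x y : qn (sadd x y) = qn x + 2 * ip x y + qn y.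
Proof.
rewrite /qn /ip mulr_sumr -!big_split/=; apply: eq_bigr => j _.
by rewrite /sadd; ring.
Qed.

Lemma qn_sscale a x : qn (sscale a x) = a ^+ 2 * qn x.
Proof. by rewrite /qn mulr_sumr; apply: eq_bigr => j _; rewrite exprMn. Qed.

Lemma ip_sscale a x y : ip x (sscale a y) = a * ip x y.
Proof.
by rewrite /ip mulr_sumr; apply: eq_bigr => j _; rewrite /sscale; ring.
Qed.

Lemma ip_sadd x y z : ip x (sadd y z) = ip x y + ip x z.
Proof.
by rewrite /ip -big_split; apply: eq_bigr => j _; rewrite /sadd/=; ring.
Qed.

Lemma ipC x y : ip x y = ip y x.
Proof. by apply: eq_bigr => j _; rewrite mulrC. Qed.

Lemma qn_sadd_le x y : qn (sadd x y) <= 2 * qn x + 2 * qn y.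
Proof.
have h := qn_ge0 (sadd x (sscale (-1) y)).
rewrite qn_sadd ip_sscale qn_sscale in h; rewrite qn_sadd; lra.
Qed.

Lemma ip_sqr_le x y : ip x y ^+ 2 <= qn x * qn y.
Proof.
have [y0|y0] := eqVneq (qn y) 0.
  suff -> : ip x y = 0 by rewrite expr0n/= y0 mulr0.
  rewrite /ip big1// => j _; suff -> : y j = 0 by rewrite mulr0.
  apply/eqP; rewrite -sqrf_eq0.
  have := psumr_eq0P _ y0; move=> ->//.
  by move=> i _; exact: sqr_ge0.
have y1 : 0 < qn y by rewrite lt_def y0 qn_ge0.
have := qn_ge0 (sadd (sscale (qn y) x) (sscale (- ip x y) y)).
have [w wE] : exists w, ip x y = w by exists (ip x y).
rewrite wE qn_sadd ip_sscale ipC ip_sscale !qn_sscale ipC wE => h.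
rewrite -(ler_pM2l y1) -subr_ge0; apply: le_trans h _.
by rewrite le_eqVlt; apply/orP; left; apply/eqP; ring.
Qed.

Lemma measurable_ip d (T : measurableType d) c (u : T -> seqR R) :
  measurable_fun setT u -> measurable_fun setT (fun t => ip c (u t)).
Proof.
move=> mu; apply: measurable_sum => j; apply: measurable_funM => //.
exact: measurable_fun_coord.
Qed.

Lemma measurable_qn d (T : measurableType d) (u : T -> seqR R) :
  measurable_fun setT u -> measurable_fun setT (fun t => qn (u t)).
Proof.
move=> mu; apply: measurable_sum => j; apply: measurable_funX.
exact: measurable_fun_coord.
Qed.

Lemma measurable_sscale d (T : measurableType d) a (u : T -> seqR R) :
  measurable_fun setT u -> measurable_fun setT (fun t => sscale a (u t)).
Proof.
move=> mu; apply: measurable_fun_seqP => j; apply: measurable_funM => //.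
exact: measurable_fun_coord.
Qed.

Definition qstep e t x : R := step ((qn x - t) / e).

Lemma qstep_itv e t x : 0 <= qstep e t x <= 1.
Proof. exact: step_itv. Qed.

Lemma bounded_measurable_qstep e t : bounded_measurable (qstep e t).
Proof.
split; last first.
  by exists 1 => x; have /andP[h0 h1] := qstep_itv e t x; rewrite ger0_norm.
have mq : measurable_fun setT (fun x : seqR R => (qn x - t) / e).
  apply: measurable_funM => //; apply: measurable_funB => //.
  by apply: (@measurable_qn _ (seqR R) id).
exact: (measurableT_comp (@measurable_step R) mq).
Qed.

End truncated_inner_product.

(** The integrand of Lindeberg's condition. *)
Definition above (R : realType) (b x : R) : R := if b < x then x else 0.

Section above.
Context (R : realType).
Implicit Types b x y : R.

Lemma above_ge0 b x : 0 <= x -> 0 <= above b x.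
Proof. by rewrite /above; case: ifP. Qed.

Lemma above_le b x : 0 <= x -> above b x <= x.
Proof. by rewrite /above; case: ifP. Qed.

Lemma above_homo b x y : 0 <= y -> x <= y -> above b x <= above b y.
Proof.
rewrite /above => y0 xy; case: ifPn => bx; first by rewrite (lt_le_trans bx).
by case: ifP.
Qed.

Lemma aboveM a b x : 0 < a -> above (a * b) (a * x) = a * above b x.
Proof. by move=> a0; rewrite /above ltr_pM2l//; case: ifP; rewrite ?mulr0. Qed.

(** If the sum exceeds [b], its larger term exceeds [b / 2] and is at least half the sum. *)
Lemma above_add b x y : 0 <= x -> 0 <= y ->
  above b (x + y) <= 2 * above (b / 2) x + 2 * above (b / 2) y.
Proof.
move=> x0 y0; rewrite /above; case: ifP => h; case: ifP => h1; case: ifP => h2.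
all: lra.
Qed.

Lemma measurable_above d (T : measurableType d) b (u : T -> R) :
  measurable_fun setT u -> measurable_fun setT (fun t => above b (u t)).
Proof.
move=> mu; rewrite /above; apply: measurable_fun_ifT => //.
exact: measurable_fun_ltr.
Qed.

End above.

(* The Taylor remainder in the form of Lindeberg's condition: third order for
   [|h| <= th], second order beyond. *)
Definition qstep_remainder_le (R : realType) (e M C : R) : Prop :=
  forall m (t : R) (c h : seqR R) (th : R), t + 3 * e <= M -> 0 < th -> th <= 1 ->
    `|qstep m e t (sadd c h) - qstep m e t c -
      step1 ((qn m c - t) / e) / e * (2 * ip m c h + qn m h) -
      2 * (step2 ((qn m c - t) / e) / e ^+ 2) * ip m c h ^+ 2| <=
    C * (th * qn m h + above (th ^+ 2) (qn m h)).

(** The constant depends on [e] and [M] only. For [c] in the ball of radius [B], Cauchy-Schwarz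
    bounds [ip m c h] by [B] times the norm of [h]; outside the ball both derivatives vanish, and a
    short increment does not leave the region where the function is 1. *)
Lemma qstep_taylor (R : realType) (e M : R) : 0 < e -> 0 <= M ->
  exists2 C : R, 0 <= C & qstep_remainder_le e M C.
Proof.
move=> e0 M0.
(* If [qn m c] exceeds 2M + 3 and [qn m h] is at most 1, then |c|^2 <= 2 |c + h|^2 + 2 |h|^2 leaves
   more than M for |c + h|^2. It also makes [B] at least 1. *)
pose B := Num.sqrt (2 * M + 3).
have B1 : 1 <= B by rewrite -sqrtr1 ler_wsqrtr//; lra.
have B2 : B ^+ 2 = 2 * M + 3 by rewrite sqr_sqrtr//; lra.
(* [C1] is the coefficient of |h|^3 for |h| <= 1 and [C2] that of |h|^2 for |h| > 1, where the
   difference and the two Taylor terms are bounded separately. *)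
pose C1 := 54 * B ^+ 3 / e ^+ 3 + 48 * B / e ^+ 2 + 12 / e ^+ 2.
pose C2 := 1 + 108 * B / e + 48 * B ^+ 2 / e ^+ 2.
have ei : 0 < e^-1 by rewrite invr_gt0.
have B3 : 0 <= B ^+ 3 by rewrite exprn_ge0//; lra.
have C10 : 0 <= C1.
  by rewrite /C1 !addr_ge0// !mulr_ge0// ?invr_ge0 ?exprn_ge0// ?ltW//; lra.
have C20 : 0 <= C2.
  by rewrite /C2 !addr_ge0// !mulr_ge0// ?invr_ge0 ?exprn_ge0// ?ltW//; lra.
exists (C1 + C2); first by rewrite addr_ge0.
move=> m t c h th tM th0 th1.
set Q := qn m h; set p := ip m c h.
have Q0 : 0 <= Q by exact: qn_ge0.
have c0 : 0 <= qn m c by exact: qn_ge0.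
set y := (qn m c - t) / e.
set a := step1 y / e; set b := step2 y / e ^+ 2.
pose s := Num.sqrt Q.
have s0 : 0 <= s by exact: sqrtr_ge0.
have s2 : s ^+ 2 = Q by rewrite sqr_sqrtr.
have a36 : `|a| <= 36 / e.
  by rewrite /a normrM (@gtr0_norm _ e^-1)// ler_wpM2r ?step1_le// ltW.
have b24 : `|b| <= 24 / e ^+ 2.
  rewrite /b normrM (@ger0_norm _ (e ^+ 2)^-1) ?invr_ge0 ?sqr_ge0//.
  by rewrite ler_wpM2r ?step2_le// invr_ge0 sqr_ge0.
set L := (X in `|X| <= _).
have i0 := qstep_itv m e t c; have i1 := qstep_itv m e t (sadd c h).
have d1 : `|qstep m e t (sadd c h) - qstep m e t c| <= 1.
  by move: i0 i1 => /andP[? ?] /andP[? ?]; rewrite ler_norml; apply/andP; split; lra.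
(* For [s <= th] the cubic bound is at most [th * s ^+ 2]; for larger [s] the term with [above] is
   the whole of [Q], and a quadratic bound is enough. *)
suff [sm bg] : (s <= 1 -> `|L| <= C1 * s ^+ 3) /\ (1 < s -> `|L| <= C2 * s ^+ 2).
  have [sth|sth] := leP s th.
    have s1 : s <= 1 by exact: le_trans th1.
    apply: le_trans (sm s1) _; apply: ler_pM => //; first by rewrite exprn_ge0.
      by rewrite lerDl.
    rewrite -[leLHS]addr0 lerD ?above_ge0// exprSr -s2 mulrC ler_wpM2r ?sqr_ge0//.
  have -> : above (th ^+ 2) Q = Q.
    by rewrite /above -s2 ltr_pXn2r ?nnegrE ?sth// ltW.
  apply: (@le_trans _ _ ((C1 + C2) * Q)); last first.
    apply: ler_wpM2l; first exact: addr_ge0.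
    by rewrite lerDr mulr_ge0// ltW.
  have [s1|s1] := leP s 1.
    apply: le_trans (sm s1) _; apply: ler_pM; rewrite ?exprn_ge0 ?lerDl//.
    by rewrite -s2 exprS ler_piMl ?sqr_ge0.
  by rewrite -s2; apply: le_trans (bg s1) _; rewrite ler_wpM2r ?sqr_ge0// lerDr.
have [cB|cB] := leP (qn m c) (B ^+ 2).
  have pB : `|p| <= B * s.
    rewrite -(@ler_pXn2r _ 2)// ?nnegrE// ?mulr_ge0//; last by lra.
    rewrite real_normK ?num_real// exprMn s2.
    by apply: le_trans (ip_sqr_le _ _ _) _; rewrite ler_wpM2r.
  split=> s1.
    pose dl := (2 * p + Q) / e.
    (* The square of [dl] also contains p Q and Q^2, of order three and four in h; they are no part
       of the quadratic term in the statement and are bounded as remainder. *)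
    have LE : L = (step (y + dl) - step y - step1 y * dl - step2 y * dl ^+ 2 / 2)
       + 2 * b * (p * Q) + b * Q ^+ 2 / 2.
      rewrite /L /qstep; have -> : (qn m (sadd c h) - t) / e = y + dl.
        by rewrite /y /dl qn_sadd -/p -/Q -mulrDl; congr (_ / _); ring.
      rewrite -/y /a /b /dl; field; lra.
    have ss : s ^+ 2 <= s by rewrite expr2 ler_piMl.
    have dlB : `|dl| <= 3 * B * s / e.
      rewrite /dl normrM (@gtr0_norm _ e^-1)// ler_wpM2r ?(ltW ei)//.
      rewrite (le_trans (ler_normD _ _))// normrM (@ger0_norm _ 2)// (@ger0_norm _ Q)//.
      have sB : s <= B * s by rewrite ler_peMl.
      rewrite -s2; lra.
    have t1 : 2 * `|dl| ^+ 3 <= 54 * B ^+ 3 / e ^+ 3 * s ^+ 3.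
      have -> : 54 * B ^+ 3 / e ^+ 3 * s ^+ 3 = 2 * (3 * B * s / e) ^+ 3.
        by field; lra.
      by rewrite ler_wpM2l// lerXn2r ?nnegrE//; apply: le_trans dlB.
    have t2 : `|2 * b * (p * Q)| <= 48 * B / e ^+ 2 * s ^+ 3.
      have -> : 48 * B / e ^+ 2 * s ^+ 3 = (2 * (24 / e ^+ 2)) * (B * s * s ^+ 2).
        by field; lra.
      rewrite normrM ler_pM//.
        by rewrite normrM (@ger0_norm _ 2)// ler_wpM2l.
      by rewrite normrM (@ger0_norm _ Q)// s2 ler_wpM2r.
    have t3 : `|b * Q ^+ 2 / 2| <= 12 / e ^+ 2 * s ^+ 3.
      have -> : 12 / e ^+ 2 * s ^+ 3 = (24 / e ^+ 2) * s ^+ 3 / 2.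
        by field; lra.
      rewrite normrM (@ger0_norm _ 2^-1)// ler_wpM2r// normrM ler_pM//.
      rewrite ger0_norm ?sqr_ge0// -s2 -exprM (exprS s 3) ler_piMl// exprn_ge0//.
    rewrite LE; have -> : C1 * s ^+ 3 = 54 * B ^+ 3 / e ^+ 3 * s ^+ 3 +
      48 * B / e ^+ 2 * s ^+ 3 + 12 / e ^+ 2 * s ^+ 3 by rewrite /C1; ring.
    apply: le_trans (ler_normD _ _) _; apply: lerD => //.
    apply: le_trans (ler_normD _ _) _; apply: lerD => //.
    by apply: le_trans (step_taylor _ _) _.
  have ss : s <= s ^+ 2 by rewrite expr2 ler_peMl// ltW.
  have t1 : `|a * (2 * p + Q)| <= 108 * B / e * s ^+ 2.
    have -> : 108 * B / e * s ^+ 2 = 36 / e * (3 * B * s ^+ 2) by field; lra.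
    rewrite normrM ler_pM//.
    rewrite (le_trans (ler_normD _ _))// normrM (@ger0_norm _ 2)// (@ger0_norm _ Q)//.
    have sB : s ^+ 2 <= B * s ^+ 2 by rewrite ler_peMl// sqr_ge0.
    have sB' : B * s <= B * s ^+ 2 by rewrite ler_wpM2l//; lra.
    rewrite -s2; lra.
  have t2 : `|2 * b * p ^+ 2| <= 48 * B ^+ 2 / e ^+ 2 * s ^+ 2.
    have -> : 48 * B ^+ 2 / e ^+ 2 * s ^+ 2 = (2 * (24 / e ^+ 2)) * (B * s) ^+ 2.
      by field; lra.
    rewrite normrM ler_pM//.
      by rewrite normrM (@ger0_norm _ 2)// ler_wpM2l.
    by rewrite normrX lerXn2r ?nnegrE// mulr_ge0//; lra.
  have t3 : 1 <= s ^+ 2 by rewrite exprn_ege1// ltW.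
  rewrite /L; have -> : C2 * s ^+ 2 = s ^+ 2 + 108 * B / e * s ^+ 2 +
    48 * B ^+ 2 / e ^+ 2 * s ^+ 2 by rewrite /C2; ring.
  apply: le_trans (ler_normB _ _) _; apply: lerD => //.
  apply: le_trans (ler_normB _ _) _; apply: lerD => //.
  by apply: le_trans t3.
have y3 : 3 <= y by rewrite /y ler_pdivlMr//; lra.
have a0 : a = 0 by rewrite /a step1_eq0// mul0r.
have b0 : b = 0 by rewrite /b step2_eq0// mul0r.
have LE : L = qstep m e t (sadd c h) - qstep m e t c.
  by rewrite /L a0 b0; ring.
have f1 : qstep m e t c = 1 by rewrite /qstep step_eq1.
split=> s1.
  have Q1 : Q <= 1 by rewrite -s2 exprn_ile1.
  have := qn_sadd_le m (sadd c h) (sscale (-1) h).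
  have -> : sadd (sadd c h) (sscale (-1) h) = c.
    by apply/funext => j; rewrite /sadd /sscale; ring.
  rewrite qn_sscale -/Q => hc.
  have f2 : qstep m e t (sadd c h) = 1.
    rewrite /qstep step_eq1// ler_pdivlMr//; lra.
  by rewrite LE f1 f2 subrr normr0 mulr_ge0// exprn_ge0.
rewrite LE (le_trans d1)//.
have t3 : 1 <= s ^+ 2 by rewrite exprn_ege1// ltW.
rewrite (le_trans t3)// ler_peMl ?sqr_ge0// /C2 -addrA lerDl addr_ge0//.
  by rewrite !mulr_ge0 ?(ltW ei)//; lra.
by apply: mulr_ge0; [apply: mulr_ge0 => //; exact: sqr_ge0|rewrite invr_ge0 sqr_ge0].
Qed.

Section averaged_taylor.
Context d (T : measurableType d) (R : realType) (P : probability T R).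
Variables (m : nat) (xi : T -> seqR R) (N : T -> R).
Hypothesis mxi : measurable_fun setT xi.
Hypothesis IN : rintegrable P N.
Hypothesis xiN : forall w, qn m (xi w) <= N w.

Lemma rintegrable_qn : rintegrable P (fun w => qn m (xi w)).
Proof.
apply: rintegrable_le IN _; first exact: measurable_qn.
by move=> w; rewrite ger0_norm ?qn_ge0.
Qed.

Lemma rintegrable_ip2 c : rintegrable P (fun w => ip m c (xi w) ^+ 2).
Proof.
apply: rintegrable_le (rintegrableZ (qn m c) IN) _.
  by apply: measurable_funX; exact: measurable_ip.
move=> w; rewrite ger0_norm ?sqr_ge0// (le_trans (ip_sqr_le _ _ _))//.
by rewrite ler_wpM2l// qn_ge0.
Qed.

Lemma rintegrable_ip c : rintegrable P (fun w => ip m c (xi w)).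
Proof.
apply: rintegrable_le (rintegrableD (rintegrable_cst P 1) (rintegrable_ip2 c)) _.
  exact: measurable_ip.
move=> w; have := sqr_ge0 (`|ip m c (xi w)| - 1).
rewrite sqrrB real_normK ?num_real// => h.
have : 0 <= `|ip m c (xi w)| by [].
lra.
Qed.

Lemma rintegrable_above b : rintegrable P (fun w => above b (N w)).
Proof.
have N0 w : 0 <= N w by exact: le_trans (qn_ge0 _ _) (xiN w).
apply: rintegrable_le IN _.
  by apply: measurable_above; exact: rintegrable_measurable IN.
by move=> w; rewrite ger0_norm ?above_ge0// above_le.
Qed.

(** The pointwise expansion, integrated for the increment [r] times [xi]. In the remainder the
    envelope [N] replaces [qn m], which frees it from the dimension. Scaling moves the truncation
    level to [th ^+ 2 / r ^+ 2], of order n when r^2 n = 1. *)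
Lemma avg_taylor (e M C : R) : 0 <= C -> qstep_remainder_le e M C ->
  forall (t : R) c (th r : R), t + 3 * e <= M -> 0 < th -> th <= 1 -> 0 < r ->
  `|avg P (fun w => sscale r (xi w)) (qstep m e t) c - qstep m e t c -
    step1 ((qn m c - t) / e) / e *
      (2 * (r * \int[P]_w ip m c (xi w)) + r ^+ 2 * \int[P]_w qn m (xi w)) -
    2 * (step2 ((qn m c - t) / e) / e ^+ 2) *
      (r ^+ 2 * \int[P]_w ip m c (xi w) ^+ 2)| <=
  C * (r ^+ 2 * (th * \int[P]_w N w + \int[P]_w above (th ^+ 2 / r ^+ 2) (N w))).
Proof.
move=> C0 taylor t c th r tM th0 th1 r0.
have r2 : 0 < r ^+ 2 by rewrite exprn_gt0.
set a := step1 _ / _; set b := step2 _ / _; set f := qstep m e t.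
have [mf _] : bounded_measurable f by exact: bounded_measurable_qstep.
have mfh : measurable_fun setT (fun w => f (sadd c (sscale r (xi w)))).
  apply: (measurableT_comp mf); apply: measurable_sadd => //.
  exact: measurable_sscale.
have If : rintegrable P (fun w => f (sadd c (sscale r (xi w)))).
  apply: (@bounded_integrable _ _ _ _ _ 1) => // w.
  by have /andP[h0 h1] := qstep_itv m e t (sadd c (sscale r (xi w))); rewrite ger0_norm.
have I1 := rintegrable_ip c; have I2 := rintegrable_ip2 c.
have I3 := rintegrable_qn; have I4 := rintegrable_above (th ^+ 2 / r ^+ 2).
have I12 := rintegrableD (rintegrableZ (2 * r) I1) (rintegrableZ (r ^+ 2) I3).
have Ia := rintegrableZ a I12.
have Ib := rintegrableZ (2 * b * r ^+ 2) I2.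
pose L w := f (sadd c (sscale r (xi w))) - f c -
  a * (2 * r * ip m c (xi w) + r ^+ 2 * qn m (xi w)) -
  2 * b * r ^+ 2 * ip m c (xi w) ^+ 2.
have IfC := rintegrableB If (rintegrable_cst P (f c)).
have IL : rintegrable P L by apply: rintegrableB => //; exact: rintegrableB.
have -> : avg P (fun w => sscale r (xi w)) f c - f c -
    a * (2 * (r * \int[P]_w ip m c (xi w)) + r ^+ 2 * \int[P]_w qn m (xi w)) -
    2 * b * (r ^+ 2 * \int[P]_w ip m c (xi w) ^+ 2) = \int[P]_w L w.
  rewrite /L RintegralB//; last exact: rintegrableB.
  rewrite RintegralB// RintegralB//; last exact: rintegrable_cst.
  rewrite Rintegral_prob_cst RintegralZl// RintegralD//;
    [|exact: rintegrableZ|exact: rintegrableZ].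
  by rewrite !RintegralZl// !mulrA.
have IR := rintegrableZ (C * r ^+ 2) (rintegrableD (rintegrableZ th IN) I4).
have -> : C * (r ^+ 2 * (th * \int[P]_w N w +
      \int[P]_w above (th ^+ 2 / r ^+ 2) (N w))) =
    \int[P]_w (C * r ^+ 2 * (th * N w + above (th ^+ 2 / r ^+ 2) (N w))).
  rewrite RintegralZl//; last by apply: rintegrableD => //; exact: rintegrableZ.
  by rewrite RintegralD//; [rewrite RintegralZl// mulrA|exact: rintegrableZ].
apply: norm_Rint_le => //; first exact: rintegrable_measurable IL.
move=> w; have := taylor m t c (sscale r (xi w)) th tM th0 th1.
rewrite -/a -/b -/f ip_sscale qn_sscale => h.
have {}h : `|L w| <= C * (th * (r ^+ 2 * qn m (xi w)) +
    above (th ^+ 2) (r ^+ 2 * qn m (xi w))).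
  by apply: le_trans h; rewrite le_eqVlt; apply/orP; left; apply/eqP; rewrite /L;
    congr (`| _ |); ring.
apply: le_trans h _; rewrite -mulrA ler_wpM2l//.
have -> : th * (r ^+ 2 * qn m (xi w)) + above (th ^+ 2) (r ^+ 2 * qn m (xi w)) =
    r ^+ 2 * (th * qn m (xi w) + above (th ^+ 2 / r ^+ 2) (qn m (xi w))).
  rewrite -[th ^+ 2 in LHS](divfK (lt0r_neq0 r2)) [_ / _ * _]mulrC aboveM//.
  by rewrite mulrDr; congr (_ + _); ring.
rewrite ler_wpM2l ?(ltW r2)// lerD// ?ler_wpM2l ?(ltW th0)//.
by rewrite above_homo// (le_trans _ (xiN w))// qn_ge0.
Qed.

End averaged_taylor.

(** * Rademacher smoothing *)

Lemma bin_mono n k l : (k <= l)%N -> (l.*2 <= n)%N -> ('C(n, k) <= 'C(n, l))%N.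
Proof.
elim: l => [|l IH]; first by rewrite leqn0 => /eqP->.
rewrite leq_eqVlt => /predU1P[->//|]; rewrite ltnS => kl ln.
apply: leq_trans (IH kl _) _; first lia.
have := mul_bin_left n l; have : (l.+1 <= n - l)%N by lia.
by case: (n - l)%N => //= p; nia.
Qed.

(** Induction by (n+1) C(2n+2, n+1) = 2 (2n+1) C(2n, n) together with (2n+1) (2n+3) <= (2n+2)^2. *)
Lemma bin_half_sqr n : ('C(n.*2, n) ^ 2 * n.*2.+1 <= 4 ^ n.*2)%N.
Proof.
elim: n => [|n IH]; first by [].
have h1 := mul_bin_diag n.*2.+2 n.
have h4 := mul_bin_down n.*2.+1 n.
rewrite doubleS.
have e : (n.+1 * 'C(n.*2.+2, n.+1) = 2 * n.*2.+1 * 'C(n.*2, n))%N.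
  have e1 : (n.*2.+1 - n = n.+1)%N by lia.
  rewrite e1 /= in h4; rewrite /= in h1.
  have : (n.+1 * (n.+1 * 'C(n.*2.+2, n.+1)) = n.+1 * (2 * n.*2.+1 * 'C(n.*2, n)))%N.
    by rewrite -h1; nia.
  by move/eqP; rewrite eqn_pmul2l// => /eqP.
have : (n.+1 ^ 2 * ('C(n.*2.+2, n.+1) ^ 2 * n.*2.+3) <= n.+1 ^ 2 * 4 ^ n.*2.+2)%N.
  rewrite mulnA -expnMn e !expnMn.
  have -> : (4 ^ n.*2.+2 = 16 * 4 ^ n.*2)%N by rewrite !expnS; lia.
  apply: (@leq_trans (4 * n.*2.+1 * n.*2.+3 * ('C(n.*2, n) ^ 2 * n.*2.+1))%N).
    by rewrite -!mulnn; lia.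
  apply: (@leq_trans (4 * n.*2.+1 * n.*2.+3 * 4 ^ n.*2)%N).
    by rewrite leq_mul2l IH orbT.
  rewrite mulnA leq_mul2r; apply/orP; right; rewrite -mulnn; nia.
by rewrite leq_pmul2l// expn_gt0.
Qed.

Lemma bin_sqr_le n k : ('C(n, k) ^ 2 * n.+1 <= 4 ^ n)%N.
Proof.
have bound p l : ('C(p.*2, l) <= 'C(p.*2, p))%N.
  have [lp|pl] := leqP l p; first by rewrite bin_mono.
  have [l2|l2] := leqP l p.*2; last by rewrite bin_small.
  by rewrite -bin_sub// bin_mono//; lia.
have [p [->|->]] : exists p, n = p.*2 \/ n = p.*2.+1.
  by exists n./2; rewrite -{1 3}[n]odd_double_half; case: odd; [right|left].
  apply: leq_trans (bin_half_sqr p).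
  by rewrite leq_mul2r leq_exp2r// bound orbT.
(* The two middle coefficients of an odd row are equal and add up to the central one of the next
   row. *)
have h : (2 * 'C(p.*2.+1, k) <= 'C(p.*2.+2, p.+1))%N.
  have e1 : 'C(p.*2.+1, p.+1) = 'C(p.*2.+1, p).
    by rewrite -(@bin_sub p.*2.+1 p); [congr 'C(_, _); lia|lia].
  rewrite binS e1 addnn -[X in (_ <= X)%N]mul2n leq_mul2l /=.
  have [kp|pk] := leqP k p; first by rewrite bin_mono.
  have [k2|k2] := leqP k p.*2.+1; last by rewrite (bin_small k2).
  by rewrite -bin_sub// bin_mono//; lia.
have := bin_half_sqr p.+1; rewrite doubleS.
have -> : (4 ^ p.*2.+2 = 4 * 4 ^ p.*2.+1)%N by rewrite expnS.
move=> hp; rewrite -(@leq_pmul2l 4)//; apply: leq_trans hp.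
rewrite mulnA leq_mul//.
by rewrite -[4%N]/(2 ^ 2)%N -expnMn leq_exp2r.
Qed.

Lemma count_clustered (p : pred nat) n D :
  (forall i j, p i -> p j -> (i <= j)%N -> (j - i <= D)%N) ->
  (count p (iota 0 n) <= D.+1)%N.
Proof.
move=> pD; rewrite -size_filter.
case E : [seq i <- iota 0 n | p i] => [//|i0 s]; rewrite -E.
have i0s : i0 \in [seq i <- iota 0 n | p i] by rewrite E mem_head.
have [pi0 _] : p i0 /\ True by move: i0s; rewrite mem_filter => /andP[].
rewrite -[D.+1](size_iota i0); apply: uniq_leq_size.
  by rewrite filter_uniq// iota_uniq.
move=> j js; have pj : p j by move: js; rewrite mem_filter => /andP[].
have i0j : (i0 <= j)%N.
  have : sorted leq [seq i <- iota 0 n | p i].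
    by rewrite sorted_filter//; [exact: leq_trans|exact: iota_sorted].
  rewrite E /= => /(order_path_min leq_trans)/allP h.
  by move: js; rewrite E inE => /predU1P[->//|/h].
by rewrite mem_iota i0j/=; have := pD _ _ pi0 pj i0j; lia.
Qed.

Section rademacher.
Context (R : realType).
Implicit Types (f : seqR R -> R) (c u : seqR R).

(** The averaging operator of a random sign times [u], written out so that no probability space has
    to carry the sign. *)
Definition rademacher u f c : R :=
  2^-1 * f (sadd c u) + 2^-1 * f (sadd c (sscale (-1) u)).

Lemma rademacher_averaging u : averaging (rademacher u).
Proof.
have ms v (f : seqR R -> R) : measurable_fun setT f ->
    measurable_fun setT (fun c => f (sadd c v)).
  by move=> mf; apply: (measurableT_comp mf); exact: measurable_sadd.
have bd (f : seqR R -> R) K c : (forall x, `|f x| <= K) -> `|rademacher u f c| <= K.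
  move=> fK; rewrite /rademacher (le_trans (ler_normD _ _))// !normrM.
  rewrite (@ger0_norm _ 2^-1)//; have := fK (sadd c u).
  have := fK (sadd c (sscale (-1) u)); lra.
split=> [f [mf [K fK]]|f g c _ _|f K c _]; [|by rewrite /rademacher; ring|exact: bd].
split; last by exists K => c; exact: bd.
by apply: measurable_funD; apply: measurable_funM => //; exact: ms.
Qed.

Lemma rademacher_avg_comm d (T : measurableType d) (P : probability T R) xi u f c :
  measurable_fun setT xi -> bounded_measurable f ->
  rademacher u (avg P xi f) c = avg P xi (rademacher u f) c.
Proof.
move=> mxi [mf [K fK]].
have I v : rintegrable P (fun w => f (sadd (sadd c (xi w)) v)).
  apply: (@bounded_integrable _ _ _ _ _ K) => //.
  apply: (measurableT_comp mf); apply: measurable_sadd => //.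
  exact: measurable_sadd.
rewrite /rademacher /avg RintegralD//; [|exact: rintegrableZ|exact: rintegrableZ].
have E v : \int[P]_w f (sadd (sadd c v) (xi w)) =
    \int[P]_w f (sadd (sadd c (xi w)) v).
  by apply: eq_Rintegral => w _; rewrite -!saddA [sadd (xi _) _]saddC.
rewrite !E RintegralZl//; last exact: I.
by rewrite RintegralZl//; exact: I.
Qed.

(** With [k] plus signs the total is [2 * k - n]; the induction is Pascal's rule. *)
Lemma iter_rademacher u f n c : iter n (rademacher u) f c =
  \sum_(k < n.+1) 'C(n, k)%:R / 2 ^+ n * f (sadd c (sscale (2 * k%:R - n%:R) u)).
Proof.
elim: n c => [|n IH] c.
  rewrite big_ord1 /= bin0 expr0 divr1 mul1r; congr f.
  by apply/funext => j; rewrite /sadd /sscale; ring.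
rewrite iterS /rademacher !IH.
pose G k : R := f (sadd c (sscale (2 * k%:R - n.+1%:R) u)).
have E1 : \sum_(k < n.+1) 'C(n, k)%:R / 2 ^+ n *
    f (sadd (sadd c u) (sscale (2 * k%:R - n%:R) u)) =
    \sum_(k < n.+1) 'C(n, k)%:R / 2 ^+ n * G k.+1.
  apply: eq_bigr => k _; congr (_ * f _); apply/funext => j.
  by rewrite /sadd /sscale -!natr1; ring.
have E2 : \sum_(k < n.+1) 'C(n, k)%:R / 2 ^+ n *
    f (sadd (sadd c (sscale (-1) u)) (sscale (2 * k%:R - n%:R) u)) =
    \sum_(k < n.+1) 'C(n, k)%:R / 2 ^+ n * G k.
  apply: eq_bigr => k _; congr (_ * f _); apply/funext => j.
  by rewrite /sadd /sscale -!natr1; ring.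
rewrite E1 E2 [RHS]big_ord_recl /= bin0.
have -> : \sum_(k < n.+1) 'C(n, k)%:R / 2 ^+ n * G k =
    1 / 2 ^+ n * G 0%N + \sum_(k < n.+1) 'C(n, k.+1)%:R / 2 ^+ n * G k.+1.
  rewrite big_ord_recl/= bin0; congr (_ + _).
  by rewrite [RHS]big_ord_recr/= bin_small// !mul0r addr0.
have e2 : 2 ^+ n.+1 = 2 * 2 ^+ n :> R by rewrite exprS.
rewrite mulrDr addrCA; congr (_ + _).
  by rewrite e2 invfM -/(G 0%N); ring.
rewrite !mulr_sumr -big_split/=; apply: eq_bigr => k _.
by rewrite /bump /= binS natrD -/(G _) e2 invfM; ring.
Qed.

End rademacher.

Lemma sum_count (R : realType) (p : pred nat) n :
  \sum_(k < n) (p k)%:R = (count p (iota 0 n))%:R :> R.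
Proof.
rewrite -(big_mkord xpredT (fun k => (p k)%:R : R)) -sum1_count natr_sum.
by rewrite /index_iota subn0 [RHS]big_mkcond; apply: eq_bigr => k _; case: (p k).
Qed.

(** Along the points reached by the signs, [qn m] is U z^2 plus a constant, where z runs through an
    arithmetic progression of step 2r. On either side of 0, the z that land in the shell lie within
    sqrt ((b - a) / U) of each other, so at most 1 + sqrt ((b - a) / U) / (2r) of them do. Each
    weight is at most r, and the two sides add up to the bound. *)
Lemma iter_rademacher_shell (R : realType) m (u : seqR R) (f : seqR R -> R)
    (a b r : R) n c : 0 < r -> r ^+ 2 * n%:R = 1 -> 0 < qn m u -> a <= b ->
  (forall x, f x <= 1) -> (forall x, ~~ (a <= qn m x <= b) -> f x <= 0) ->
  iter n (rademacher (sscale r u)) f c <= Num.sqrt ((b - a) / qn m u) + 2 * r.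
Proof.
move=> r0 rn U0 ab f1 f0; rewrite iter_rademacher.
set U := qn m u in U0 *; set s := Num.sqrt _.
have n0 : 0 < n%:R :> R.
  rewrite lt_def ler0n andbT; apply: contra_eq_neq rn => ->.
  by rewrite mulr0 eq_sym oner_eq0.
pose x k := sadd c (sscale (2 * k%:R - n%:R) (sscale r u)).
pose p k := a <= qn m (x k) <= b.
(* The variable after completion of the square. *)
pose z k : R := (2 * k%:R - n%:R) * r + ip m c u / U.
pose p1 k := p k && (0 <= z k); pose p2 k := p k && (z k <= 0).
have xE k : qn m (x k) = U * z k ^+ 2 + (qn m c - ip m c u ^+ 2 / U).
  rewrite /x qn_sadd !ip_sscale !qn_sscale -/U /z; field.
  by rewrite gt_eqF.
have s0 : 0 <= s by exact: sqrtr_ge0.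
have s2 : s ^+ 2 = (b - a) / U.
  by rewrite sqr_sqrtr// divr_ge0 ?subr_ge0// ltW.
pose D := Num.truncn (s / (2 * r)).
have sr0 : 0 <= s / (2 * r) by rewrite divr_ge0// mulr_ge0// ltW.
have zE i j : (i <= j)%N -> z j - z i = 2 * r * (j - i)%N%:R.
  by move=> ij; rewrite /z natrB//; ring.
have near i j : (i <= j)%N -> (z j - z i) ^+ 2 <= (b - a) / U -> (j - i <= D)%N.
  move=> ij; rewrite -s2 zE// => h; rewrite /D truncn_ge_nat//.
  rewrite ler_pdivlMr ?mulr_gt0// mulrC -(@ler_pXn2r _ 2)// nnegrE.
  by rewrite mulr_ge0// mulr_ge0// ltW.
have dist i j : p i -> p j -> z i ^+ 2 - z j ^+ 2 <= (b - a) / U.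
  rewrite /p !xE => /andP[? ?] /andP[? ?]; rewrite ler_pdivlMr//; lra.
have c1 : (count p1 (iota 0 n.+1) <= D.+1)%N.
  apply: count_clustered => i j /andP[pi zi] /andP[pj zj] ij; apply: near => //.
  (* For 0 <= z_i <= z_j the square of the difference is at most the difference of the squares. *)
  apply: le_trans (dist _ _ pj pi).
  have : 0 <= z j - z i by rewrite zE// !mulr_ge0// ltW.
  nra.
have c2 : (count p2 (iota 0 n.+1) <= D.+1)%N.
  apply: count_clustered => i j /andP[pi zi] /andP[pj zj] ij; apply: near => //.
  apply: le_trans (dist _ _ pi pj).
  have : 0 <= z j - z i by rewrite zE// !mulr_ge0// ltW.
  nra.
have wr k : 'C(n, k)%:R / 2 ^+ n <= r.
  rewrite -(@ler_pXn2r _ 2)// ?nnegrE ?divr_ge0 ?ler0n ?exprn_ge0 ?(ltW r0)//.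
  have -> : r ^+ 2 = n%:R^-1.
    by apply: (mulIf (lt0r_neq0 n0)); rewrite rn mulVf// lt0r_neq0.
  rewrite -[n%:R^-1]div1r ler_pdivlMr// expr_div_n mulrAC ler_pdivrMr ?exprn_gt0//.
  rewrite mul1r -exprM mulnC exprM -natrX -natrX -natrM -natrX ler_nat.
  by apply: leq_trans (bin_sqr_le n k); rewrite leq_mul2l leqnSn orbT.
have w0 k : 0 <= 'C(n, k)%:R / 2 ^+ n :> R by rewrite divr_ge0 ?ler0n ?exprn_ge0.
apply: (@le_trans _ _ (\sum_(k < n.+1) r * ((p1 k)%:R + (p2 k)%:R))).
  apply: ler_sum => k _.
  have [pk|pk] := boolP (p k).
    apply: (@le_trans _ _ (r * 1)).
      apply: le_trans (_ : 'C(n, k)%:R / 2 ^+ n * 1 <= _).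
        by rewrite ler_wpM2l.
      by rewrite ler_wpM2r.
    rewrite ler_wpM2l ?(ltW r0)// /p1 /p2 pk /=.
    by case: (leP 0 (z k)) => h /=; rewrite ?lerDl ?(ltW h)//= add0r.
  apply: (@le_trans _ _ 0); first by rewrite mulr_ge0_le0// f0.
  by rewrite mulr_ge0 ?(ltW r0)// addr_ge0.
rewrite -mulr_sumr big_split/= !sum_count.
apply: (@le_trans _ _ (r * (2 * (s / (2 * r) + 1)))).
  rewrite ler_wpM2l ?(ltW r0)//.
  have D1 : D.+1%:R <= s / (2 * r) + 1.
    by rewrite -natr1 lerD2r; have /andP[] := truncn_itv sr0.
  have : (count p1 (iota 0 n.+1))%:R <= D.+1%:R :> R by rewrite ler_nat.
  have : (count p2 (iota 0 n.+1))%:R <= D.+1%:R :> R by rewrite ler_nat.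
  lra.
rewrite le_eqVlt; apply/orP; left; apply/eqP; field; lra.
Qed.

(** * Weak laws of large numbers *)

Section moments.
Context d dS (T : measurableType d) (S : measurableType dS) (R : realType).
Context (P : probability T R) (n : nat) (X : nat -> {mfun T >-> S}).
Hypothesis indep : product_rule P n X.
Hypothesis ident : identically_distributed P n X.

Lemma product_rule_pair i j A B : i != j -> (i < n)%N -> (j < n)%N ->
  measurable A -> measurable B ->
  P (X i @^-1` A `&` X j @^-1` B) = (P (X i @^-1` A) * P (X j @^-1` B))%E.
Proof.
move=> ij ltin jn mA mB.
pose C k := if k == i then A else if k == j then B else setT.
have mC k : measurable (C k) by rewrite /C; do 2 case: ifP => // _.
have := indep mC.
have -> : \bigcap_(k < n) (X k @^-1` C k) = X i @^-1` A `&` X j @^-1` B.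
  apply/seteqP; split=> t /=.
    move=> h; have := h i ltin; have := h j jn.
    by rewrite /C !eqxx eq_sym (negbTE ij).
  by move=> [hi hj] k /= _; rewrite /C; case: eqP => [->//|_]; case: eqP => [->|].
move=> ->; rewrite (bigD1 (Ordinal ltin))//= (bigD1 (Ordinal jn)) /=; last first.
  by rewrite -val_eqE /= eq_sym.
rewrite big1 ?mule1 => [|k /andP[ki kj]].
  by rewrite /C !eqxx eq_sym (negbTE ij).
rewrite /C; move: ki kj; rewrite -!val_eqE /= => /negbTE -> /negbTE ->.
by rewrite preimage_setT probability_setT.
Qed.

Lemma rintegrable_sqr (f : T -> R) : measurable_fun setT f ->
  rintegrable P (fun t => f t ^+ 2) -> rintegrable P f.
Proof.
move=> mf If; apply: rintegrable_le (rintegrableD (rintegrable_cst P 1) If) _ => //.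
move=> t; have := sqr_ge0 (`|f t| - 1).
by rewrite sqrrB real_normK ?num_real// => h; have : 0 <= `|f t| by []; lra.
Qed.

Lemma sum_second_moment (g : S -> R) : measurable_fun setT g ->
  rintegrable P (fun t => g (X 0%N t) ^+ 2) -> \int[P]_t g (X 0%N t) = 0 ->
  rintegrable P (fun t => (\sum_(i < n) g (X i t)) ^+ 2) /\
  \int[P]_t (\sum_(i < n) g (X i t)) ^+ 2 =
    n%:R * \int[P]_t g (X 0%N t) ^+ 2.
Proof.
move=> mg Ig g0.
have mgX i : measurable_fun setT (fun t => g (X i t)) by exact: measurableT_comp.
have mg2 : measurable_fun setT (fun x => g x ^+ 2) by exact: measurable_funX.
have I2 (i : 'I_n) := identically_distributed_Rintegral ident (ltn_ord i) mg2 Ig.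
have Ig1 := rintegrable_sqr (mgX 0%N) Ig.
have I1 (i : 'I_n) := identically_distributed_Rintegral ident (ltn_ord i) mg Ig1.
have cross (i j : 'I_n) : rintegrable P (fun t => g (X i t) * g (X j t)) /\
    \int[P]_t (g (X i t) * g (X j t)) =
    (i == j)%:R * \int[P]_t g (X 0%N t) ^+ 2.
  have [<-|ij] := eqVneq i j.
    rewrite mul1r; have [h1 <-] := I2 i; split.
      by apply: eq_integrable h1 => // t _ /=; rewrite expr2.
    by apply: eq_Rintegral => t _; rewrite expr2.
  have pr A B : measurable A -> measurable B ->
      P (X i @^-1` A `&` X j @^-1` B) = (P (X i @^-1` A) * P (X j @^-1` B))%E.
    by move=> mA mB; apply: product_rule_pair.
  have [h1 h2] := indep_integral_mul pr mg mg (I1 i).1 (I1 j).1.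
  by split; [exact: h1|rewrite h2 (I1 i).2 g0 !mul0r].
have E t : (\sum_(i < n) g (X i t)) ^+ 2 =
    \sum_(i < n) \sum_(j < n) g (X i t) * g (X j t).
  by rewrite expr2 mulr_suml; apply: eq_bigr => i _; rewrite mulr_sumr.
have Iin (i : 'I_n) : rintegrable P (fun t => \sum_(j < n) g (X i t) * g (X j t)).
  by apply: rintegrable_sum => j; exact: (cross i j).1.
split.
  by under eq_fun do rewrite E; apply: rintegrable_sum.
under eq_Rintegral do rewrite E.
rewrite Rintegral_sum// (eq_bigr (fun=> \int[P]_t g (X 0%N t) ^+ 2)); last first.
  move=> i _; rewrite Rintegral_sum; last by move=> j; exact: (cross i j).1.
  rewrite (bigD1 i)//= (cross i i).2 eqxx mul1r big1 ?addr0// => j ji.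
  by rewrite (cross i j).2 eq_sym (negbTE ji) mul0r.
by rewrite sumr_const card_ord mulr_natl.
Qed.

Lemma deviation_second_moment (g : S -> R) : (0 < n)%N -> measurable_fun setT g ->
  rintegrable P (fun t => g (X 0%N t) ^+ 2) ->
  rintegrable P (fun t => (n%:R^-1 * (\sum_(i < n) g (X i t)) -
      \int[P]_s g (X 0%N s)) ^+ 2) /\
  \int[P]_t (n%:R^-1 * (\sum_(i < n) g (X i t)) - \int[P]_s g (X 0%N s)) ^+ 2
    <= n%:R^-1 * \int[P]_t g (X 0%N t) ^+ 2.
Proof.
move=> n0 mg Ig.
have Ig1 : rintegrable P (fun t => g (X 0%N t)).
  by apply: rintegrable_sqr Ig; exact: measurableT_comp.
set mu := \int[P]_s g (X 0%N s).
have nn : n%:R != 0 :> R by rewrite pnatr_eq0 -lt0n.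
have mg' : measurable_fun setT (fun x => g x - mu) by exact: measurable_funB.
have Ec t : (g (X 0%N t) - mu) ^+ 2 = g (X 0%N t) ^+ 2 - 2 * mu * g (X 0%N t) + mu ^+ 2.
  by ring.
have IZ := rintegrableZ (2 * mu) Ig1.
have IB := rintegrableB Ig IZ.
have Ig' : rintegrable P (fun t => (g (X 0%N t) - mu) ^+ 2).
  under eq_fun do rewrite Ec.
  by apply: rintegrableD => //; exact: rintegrable_cst.
have E0 : \int[P]_t (g (X 0%N t) - mu) = 0.
  rewrite RintegralB//; last exact: rintegrable_cst.
  by rewrite Rintegral_prob_cst subrr.
have [J1 J2] := sum_second_moment mg' Ig' E0.
have E t : (n%:R^-1 * (\sum_(i < n) g (X i t)) - mu) ^+ 2 =
    n%:R^-1 ^+ 2 * (\sum_(i < n) (g (X i t) - mu)) ^+ 2.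
  rewrite -exprMn; congr (_ ^+ 2).
  by rewrite sumrB mulrBr sumr_const card_ord -[mu *+ n]mulr_natl mulKf.
split.
  by under eq_fun do rewrite E; exact: rintegrableZ.
under eq_Rintegral do rewrite E.
rewrite RintegralZl// J2 mulrA expr2 mulfVK// ler_wpM2l ?invr_ge0//.
have -> : \int[P]_t (g (X 0%N t) - mu) ^+ 2 =
    \int[P]_t g (X 0%N t) ^+ 2 - mu ^+ 2.
  under eq_Rintegral do rewrite Ec.
  rewrite RintegralD//; last exact: rintegrable_cst.
  by rewrite RintegralB// RintegralZl// Rintegral_prob_cst -/mu; ring.
by rewrite gerBl sqr_ge0.
Qed.

End moments.

(** Dominated convergence along integer levels; monotonicity in the level extends the bound to all
    larger real ones. *)
Lemma tail_vanishes d (T : measurableType d) (R : realType) (P : probability T R)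
    (N : T -> R) (e : R) : rintegrable P N -> (forall t, 0 <= N t) -> 0 < e ->
  exists2 b0 : R, 0 < b0 &
    forall b, b0 <= b -> \int[P]_t above b (N t) <= e.
Proof.
move=> IN N0 e0.
have mN := rintegrable_measurable IN.
have Iab b : rintegrable P (fun t => above b (N t)).
  apply: rintegrable_le IN _; first exact: measurable_above.
  by move=> t; rewrite ger0_norm ?above_ge0// above_le.
have m1 k : measurable_fun setT (fun t => (above k%:R (N t))%:E).
  by apply/measurable_EFinP; exact: measurable_above.
have cv : {ae P, forall t, setT t -> (above k%:R (N t))%:E @[k --> \oo] --> cst 0%E t}.
  apply: aeW => t _; apply: cvg_near_cst.
  near=> k; rewrite /above ifF//; apply/negbTE; rewrite -leNgt.
  by near: k; exact: nbhs_infty_ger.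
have le : {ae P, forall t k, setT t -> (`|(above k%:R (N t))%:E| <= (N t)%:E)%E}.
  by apply: aeW => t k _; rewrite lee_fin ger0_norm ?above_ge0// above_le.
have [_ _ h] := dominated_convergence measurableT m1 (measurable_cst 0%E) cv IN le.
rewrite integral_cst// mul0e in h.
have [k _ hk] := cvgr_lt _ (fine_cvg h) _ e0.
exists k.+1%:R => // b kb.
apply: le_trans (ltW (hk k.+1 (leqnSn k))).
apply: le_Rint => // t; rewrite /above; case: ifP => bN; case: ifP => // kN.
by rewrite (le_lt_trans kb bN) in kN.
Unshelve. all: by end_near.
Qed.

Lemma sqr_coord_le_qn (R : realType) (x : seqR R) j : x j ^+ 2 <= qn j.+1 x.
Proof.
rewrite /qn big_ord_recr/= lerDr; apply: sumr_ge0 => i _; exact: sqr_ge0.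
Qed.

(** The operator norm is at most the Hilbert-Schmidt norm, by Cauchy-Schwarz for [c] against D c and
    then row by row. *)
Lemma quadratic_form_le (R : realType) m (c : seqR R) (D : nat -> seqR R) :
  `|\sum_(j < m) \sum_(k < m) c j * c k * D j k| <=
  qn m c * Num.sqrt (\sum_(j < m) \sum_(k < m) D j k ^+ 2).
Proof.
have c0 := qn_ge0 m c.
have S0 : 0 <= \sum_(j < m) \sum_(k < m) D j k ^+ 2.
  by apply: sumr_ge0 => j _; apply: sumr_ge0 => k _; exact: sqr_ge0.
rewrite -(@ler_pXn2r _ 2)// ?nnegrE ?mulr_ge0 ?sqrtr_ge0//.
rewrite real_normK ?num_real// exprMn sqr_sqrtr//.
have -> : \sum_(j < m) \sum_(k < m) c j * c k * D j k =
    ip m c (fun j => ip m c (D j)).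
  apply: eq_bigr => j _; rewrite /ip mulr_sumr; apply: eq_bigr => k _.
  by rewrite mulrA.
apply: le_trans (ip_sqr_le _ _ _) _; rewrite expr2 -mulrA ler_wpM2l//.
rewrite mulr_sumr; apply: ler_sum => j _.
exact: ip_sqr_le.
Qed.

(** Stands in for Jensen's inequality: after integration, a small mean of [x] gives a small mean of
    its root. *)
Lemma sqrt_le_split (R : realType) (l x : R) : 0 < l -> 0 <= x ->
  Num.sqrt x <= l + x / l.
Proof.
move=> l0 x0; have s0 := sqrtr_ge0 x.
have s2 : Num.sqrt x ^+ 2 = x by rewrite sqr_sqrtr.
rewrite -(ler_pM2r l0) mulrDl divfK ?lt0r_neq0//.
have := sqr_ge0 (Num.sqrt x - l); rewrite sqrrB s2.
have : 0 <= l * Num.sqrt x by rewrite mulr_ge0// ltW.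
by have := sqr_ge0 l; lra.
Qed.

Section covariance.
Context d dS (T : measurableType d) (S : measurableType dS) (R : realType).
Context (P : probability T R) (n : nat) (X : nat -> {mfun T >-> S}).
Hypothesis indep : product_rule P n X.
Hypothesis ident : identically_distributed P n X.
Hypothesis n0 : (0 < n)%N.
Variables (zeta : S -> seqR R) (N : S -> R).
Hypothesis mzeta : measurable_fun setT zeta.
Hypothesis mN : measurable_fun setT N.
Hypothesis zetaN : forall m x, qn m (zeta x) <= N x.
Hypothesis IN : rintegrable P (fun t => N (X 0%N t)).
Hypothesis centred : forall j, \int[P]_t zeta (X 0%N t) j = 0.
Variable m : nat.

Let N0 x : 0 <= N x. Proof. exact: le_trans (qn_ge0 0 _) (zetaN 0 x). Qed.

Let nn : n%:R != 0 :> R. Proof. by rewrite pnatr_eq0 -lt0n. Qed.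

Let mX i (g : S -> R) : measurable_fun setT g ->
  measurable_fun setT (fun t => g (X i t)).
Proof. by move=> mg; exact: measurableT_comp. Qed.

Let mcoord j : measurable_fun setT (fun x => zeta x j).
Proof. exact: measurable_fun_coord. Qed.

Definition empirical (g : S -> R) (t : T) : R :=
  n%:R^-1 * \sum_(i < n) g (X i t).

Lemma empirical_integral g : measurable_fun setT g ->
  rintegrable P (fun t => g (X 0%N t)) ->
  rintegrable P (empirical g) /\
  \int[P]_t empirical g t = \int[P]_t g (X 0%N t).
Proof.
move=> mg Ig.
have I (i : 'I_n) := identically_distributed_Rintegral ident (ltn_ord i) mg Ig.
have Is : rintegrable P (fun t => \sum_(i < n) g (X i t)).
  by apply: rintegrable_sum => i; exact: (I i).1.
split; first exact: rintegrableZ.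
rewrite RintegralZl// Rintegral_sum; last by move=> i; exact: (I i).1.
rewrite (eq_bigr (fun=> \int[P]_t g (X 0%N t))); last by move=> i _; exact: (I i).2.
by rewrite sumr_const card_ord -[X in _ * X = _]mulr_natl mulKf.
Qed.

Lemma empirical_ge0 g t : (forall x, 0 <= g x) -> 0 <= empirical g t.
Proof. by move=> g0; rewrite mulr_ge0 ?invr_ge0// sumr_ge0. Qed.

Lemma le_empirical f g t : (forall x, f x <= g x) -> empirical f t <= empirical g t.
Proof. by move=> fg; rewrite ler_wpM2l ?invr_ge0// ler_sum. Qed.

Lemma empiricalD f g t :
  empirical (fun x => f x + g x) t = empirical f t + empirical g t.
Proof. by rewrite /empirical big_split mulrDr. Qed.

Lemma empiricalZ k g t : empirical (fun x => k * g x) t = k * empirical g t.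
Proof. by rewrite /empirical -mulr_sumr mulrCA. Qed.

Lemma empirical_cst k t : empirical (fun=> k) t = k.
Proof. by rewrite /empirical sumr_const card_ord -[X in _ * X = _]mulr_natl mulKf. Qed.

Definition smean (t : T) : seqR R := fun j => empirical (fun x => zeta x j) t.

Lemma ip_smean c t : ip m c (smean t) = empirical (fun x => ip m c (zeta x)) t.
Proof.
rewrite /ip /empirical exchange_big mulr_sumr; apply: eq_bigr => j _.
by rewrite -mulr_sumr /smean /empirical mulrCA.
Qed.

Let sigma2 := \int[P]_t N (X 0%N t).
Let tail b := \int[P]_t above b (N (X 0%N t)).

Let Iabove b : rintegrable P (fun t => above b (N (X 0%N t))).
Proof.
apply: rintegrable_le IN _; first by apply: measurable_above; exact: mX.
by move=> t; rewrite ger0_norm ?above_ge0// above_le.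
Qed.

Let mabove b : measurable_fun setT (fun x => above b (N x)).
Proof. exact: measurable_above. Qed.

Lemma qn_smean_integral : rintegrable P (fun t => qn m (smean t)) /\
  \int[P]_t qn m (smean t) <= n%:R^-1 * sigma2.
Proof.
have I2 j : rintegrable P (fun t => zeta (X 0%N t) j ^+ 2).
  apply: rintegrable_le IN _.
    by apply: measurable_funX; exact: (mX 0 (mcoord j)).
  move=> t; rewrite ger0_norm ?sqr_ge0//.
  exact: le_trans (sqr_coord_le_qn _ _) (zetaN _ _).
have J j := sum_second_moment indep ident (mcoord j) (I2 j) (centred j).
have E t : qn m (smean t) =
    \sum_(j < m) n%:R^-1 ^+ 2 * (\sum_(i < n) zeta (X i t) j) ^+ 2.
  by apply: eq_bigr => j _; rewrite -exprMn.
have IJ (j : 'I_m) : rintegrable P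
    (fun t => n%:R^-1 ^+ 2 * (\sum_(i < n) zeta (X i t) j) ^+ 2).
  by apply: rintegrableZ; exact: (J j).1.
split; first by under eq_fun do rewrite E; exact: rintegrable_sum.
under eq_Rintegral do rewrite E.
rewrite Rintegral_sum//.
rewrite (eq_bigr (fun j : 'I_m => n%:R^-1 * \int[P]_t zeta (X 0%N t) j ^+ 2)); last first.
  by move=> j _; rewrite RintegralZl ?(J j).2 ?mulrA ?expr2 ?mulfVK//; exact: (J j).1.
rewrite -mulr_sumr ler_wpM2l ?invr_ge0// -Rintegral_sum//.
by apply: le_Rint => //; [exact: rintegrable_sum|move=> t; exact: zetaN].
Qed.

Let low b x : R := if b < N x then 0 else 1.

Let mlow b : measurable_fun setT (low b).
Proof. by apply: measurable_fun_ifT => //; exact: measurable_fun_ltr. Qed.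

Let dev g t := empirical g t - \int[P]_s g (X 0%N s).

Let devB f g t : rintegrable P (fun t => f (X 0%N t)) ->
  rintegrable P (fun t => g (X 0%N t)) ->
  dev (fun x => f x + g x) t = dev f t + dev g t.
Proof.
move=> If Ig; rewrite /dev empiricalD RintegralD//; ring.
Qed.

(** [h] is the part of [g] where [N] exceeds [b]. It lacks a second moment, so its empirical and its
    true mean are bounded separately by the tail of [N]; only the bounded part keeps a genuine
    deviation. *)
Let dev_above (g h : S -> R) b t : measurable_fun setT h -> measurable_fun setT g ->
  (forall x, 0 <= g x) -> (forall x, 0 <= h x) -> forall k, 0 <= k ->
  rintegrable P (fun t => g (X 0%N t)) ->
  (forall x, g x = low b x * g x + h x) -> (forall x, h x <= k * above b (N x)) ->
  `|dev g t| <= `|dev (fun x => low b x * g x) t| +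
    k * (empirical (fun x => above b (N x)) t + tail b).
Proof.
move=> mh mg g0 h0 k k0 Ig gE hk.
have Ih : rintegrable P (fun t => h (X 0%N t)).
  apply: rintegrable_le (rintegrableZ k (Iabove b)) _; first exact: mX.
  by move=> s; rewrite ger0_norm.
have Il : rintegrable P (fun t => low b (X 0%N t) * g (X 0%N t)).
  apply: rintegrable_le Ig _; first by apply: (mX 0 (measurable_funM (mlow b) mg)).
  by move=> s; rewrite /low; case: ifP; rewrite ?mul0r ?mul1r ?normr0// ger0_norm.
have -> : dev g t = dev (fun x => low b x * g x) t + dev h t.
  by rewrite -devB//; congr dev; apply/funext => x; exact: gE.
apply: le_trans (ler_normD _ _) _; rewrite lerD2l /dev.
apply: le_trans (ler_normB _ _) _; rewrite mulrDr; apply: lerD.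
  rewrite ger0_norm ?empirical_ge0// -empiricalZ; exact: le_empirical.
rewrite ger0_norm ?Rintegral_ge0// /tail -RintegralZl//; last exact: Iabove.
by apply: le_Rint => //; exact: rintegrableZ.

Qed.

(* The empirical covariance approaches the true one both in Hilbert-Schmidt norm
   and in trace, uniformly in the dimension [m]; the products of coordinates are
   truncated at [N <= b] because only second moments are available. *)
Lemma covariance_close (l b : R) : 0 < l -> 0 <= b ->
  exists G : T -> R, [/\ rintegrable P G,
    \int[P]_t G t <= l + 2 * b ^+ 2 / (n%:R * l) + 2 * tail b + n%:R^-1 * sigma2,
    forall t, 0 <= G t,
    forall t c, `|empirical (fun x => ip m c (zeta x) ^+ 2) t - ip m c (smean t) ^+ 2
        - \int[P]_s ip m c (zeta (X 0%N s)) ^+ 2| <= qn m c * G t &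
    forall t, `|empirical (fun x => qn m (zeta x)) t - qn m (smean t)
        - \int[P]_s qn m (zeta (X 0%N s))| <= G t].
Proof.
move=> l0 b0.
pose tau j k x := low b x * (zeta x j * zeta x k).
pose tau0 x := low b x * qn m (zeta x).
have mqn : measurable_fun setT (fun x => qn m (zeta x)) by exact: measurable_qn.
have mtau j k : measurable_fun setT (tau j k).
  by apply: measurable_funM => //; exact: measurable_funM.
have mtau0 : measurable_fun setT tau0 by exact: measurable_funM.
have lowN x : low b x * qn m (zeta x) <= b.
  rewrite /low; case: (leP (N x) b) => h; rewrite ?mul0r// mul1r.
  exact: le_trans (zetaN m x) h.
have low0 x : 0 <= low b x by rewrite /low; case: ifP.
have tau02 x : tau0 x ^+ 2 <= b ^+ 2.
  have t0 : 0 <= tau0 x by rewrite mulr_ge0 ?qn_ge0.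
  by rewrite ler_pXn2r ?nnegrE//; exact: lowN.
(* The Hilbert-Schmidt norm of the rank-one matrix z z^T is |z|^2, its trace. Therefore [m] does not
   enter the bound. *)
have tau2 x : \sum_(j < m) \sum_(k < m) tau j k x ^+ 2 <= b ^+ 2.
  apply: le_trans (tau02 x).
  rewrite le_eqVlt; apply/orP; left; apply/eqP.
  rewrite exprMn [qn m _ ^+ 2]expr2 {1}/qn mulr_suml mulr_sumr; apply: eq_bigr => j _.
  by rewrite /qn !mulr_sumr; apply: eq_bigr => k _; rewrite /tau; ring.
have Ib (f : S -> R) : measurable_fun setT f -> (forall x, f x ^+ 2 <= b ^+ 2) ->
    rintegrable P (fun t => f (X 0%N t) ^+ 2).
  move=> mf fb; apply: rintegrable_le (rintegrable_cst P (b ^+ 2)) _.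
    by apply: measurable_funX; exact: mX.
  by move=> t; rewrite ger0_norm ?sqr_ge0.
have taujk (j k : 'I_m) x : tau j k x ^+ 2 <= b ^+ 2.
  apply: le_trans (tau2 x); rewrite (bigD1 j)//= (bigD1 k)//= -addrA lerDl addr_ge0//.
    by apply: sumr_ge0 => i _; exact: sqr_ge0.
  by apply: sumr_ge0 => i _; apply: sumr_ge0 => i' _; exact: sqr_ge0.
have Dm0 := deviation_second_moment indep ident n0 mtau0 (Ib _ mtau0 tau02).
have Dm (j k : 'I_m) := deviation_second_moment indep ident n0 (mtau j k)
  (Ib _ (mtau j k) (taujk j k)).
pose Dv t := \sum_(j < m) \sum_(k < m) dev (tau j k) t ^+ 2 + dev tau0 t ^+ 2.
have IDj (j : 'I_m) : rintegrable P (fun t => \sum_(k < m) dev (tau j k) t ^+ 2).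
  by apply: rintegrable_sum => k; exact: (Dm j k).1.
have IDs : rintegrable P (fun t => \sum_(j < m) \sum_(k < m) dev (tau j k) t ^+ 2).
  exact: rintegrable_sum.
have ID : rintegrable P Dv by apply: rintegrableD => //; exact: Dm0.1.
have Dv0 t : 0 <= Dv t.
  rewrite addr_ge0 ?sqr_ge0//.
  by apply: sumr_ge0 => j _; apply: sumr_ge0 => k _; exact: sqr_ge0.
have DvE : \int[P]_t Dv t <= n%:R^-1 * (2 * b ^+ 2).
  rewrite RintegralD//; last exact: Dm0.1.
  rewrite mulrDl mul1r mulrDr; apply: lerD.
    rewrite Rintegral_sum//.
    apply: (@le_trans _ _ (\sum_(j < m) \sum_(k < m)
        n%:R^-1 * \int[P]_t tau j k (X 0%N t) ^+ 2)).
      apply: ler_sum => j _; rewrite Rintegral_sum; last by move=> k; exact: (Dm j k).1.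
      by apply: ler_sum => k _; exact: (Dm j k).2.
    under eq_bigr do rewrite -mulr_sumr.
    rewrite -mulr_sumr ler_wpM2l ?invr_ge0//.
    have Itau (j k : 'I_m) := Ib _ (mtau j k) (taujk j k).
    under eq_bigr => j _ do rewrite -(Rintegral_sum _ (Itau j)).
    rewrite -Rintegral_sum; last by move=> j; exact: rintegrable_sum.
    rewrite -[leRHS](Rintegral_prob_cst P); apply: le_Rint => //.
      by apply: rintegrable_sum => j; exact: rintegrable_sum.
    exact: rintegrable_cst.
  apply: le_trans Dm0.2 _; rewrite ler_wpM2l ?invr_ge0//.
  rewrite -[leRHS](Rintegral_prob_cst P); apply: le_Rint => //.
    exact: Ib.
  exact: rintegrable_cst.
have [Ea1 Ea2] := empirical_integral (mabove b) (Iabove b).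
have [Iq1 Iq2] := qn_smean_integral.
(* The first two terms dominate the root of the squared deviations, the next is the truncation
   error, and the last one comes from centring at the sample mean. *)
pose G t := l + l^-1 * Dv t +
  (empirical (fun x => above b (N x)) t + tail b) + qn m (smean t).
have I1 : rintegrable P (fun t => l + l^-1 * Dv t).
  by apply: rintegrableD; [exact: rintegrable_cst|exact: rintegrableZ].
have I2 : rintegrable P (fun t => empirical (fun x => above b (N x)) t + tail b).
  by apply: rintegrableD => //; exact: rintegrable_cst.
have I12 := rintegrableD I1 I2.
have a0 t : 0 <= empirical (fun x => above b (N x)) t + tail b.
  apply: addr_ge0; first by apply: empirical_ge0 => x; exact: above_ge0.
  by apply: Rintegral_ge0 => s _; exact: above_ge0.
have G1 t : Num.sqrt (Dv t) <= l + l^-1 * Dv t.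
  by rewrite mulrC; exact: sqrt_le_split.
exists G; split.
- exact: rintegrableD.
- rewrite RintegralD// RintegralD//.
  rewrite (@RintegralD _ _ _ _ _ (fun=> l))//; [|exact: rintegrable_cst|exact: rintegrableZ].
  rewrite RintegralZl// Rintegral_prob_cst.
  rewrite (@RintegralD _ _ _ _ _ _ (fun=> tail b))//; last exact: rintegrable_cst.
  rewrite Rintegral_prob_cst Ea2 -/(tail b).
  have h : l^-1 * \int[P]_t Dv t <= 2 * b ^+ 2 / (n%:R * l).
    have -> : 2 * b ^+ 2 / (n%:R * l) = l^-1 * (n%:R^-1 * (2 * b ^+ 2)).
      by rewrite invfM; ring.
    by rewrite ler_wpM2l// invr_ge0 ltW.
  lra.
- move=> t; rewrite addr_ge0 ?qn_ge0// addr_ge0//.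
  by rewrite addr_ge0 ?(ltW l0)// mulr_ge0// invr_ge0 ltW.
- move=> t c.
  pose h x := if b < N x then ip m c (zeta x) ^+ 2 else 0.
  have mip : measurable_fun setT (fun x => ip m c (zeta x) ^+ 2).
    by apply: measurable_funX; exact: measurable_ip.
  have mh : measurable_fun setT h.
    by apply: measurable_fun_ifT => //; exact: measurable_fun_ltr.
  have c0 := qn_ge0 m c.
  have ipN x : ip m c (zeta x) ^+ 2 <= qn m c * N x.
    by apply: le_trans (ip_sqr_le _ _ _) _; rewrite ler_wpM2l.
  have Iip : rintegrable P (fun t => ip m c (zeta (X 0%N t)) ^+ 2).
    apply: rintegrable_le (rintegrableZ (qn m c) IN) _; first exact: (mX 0 mip).
    by move=> s; rewrite ger0_norm ?sqr_ge0.
  have k1 := @dev_above _ h b t mh mip (fun x => sqr_ge0 _).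
  have {}k1 : `|dev (fun x => ip m c (zeta x) ^+ 2) t| <=
      `|dev (fun x => low b x * ip m c (zeta x) ^+ 2) t| +
      qn m c * (empirical (fun x => above b (N x)) t + tail b).
    apply: k1 => //.
    + by move=> x; rewrite /h; case: ifP => // _; exact: sqr_ge0.
    + by move=> x; rewrite /h /low; case: ifP => _; rewrite ?mul0r ?mul1r ?add0r ?addr0.
    + by move=> x; rewrite /h /above; case: ifP => // _; rewrite mulr0.
  have k2 : dev (fun x => low b x * ip m c (zeta x) ^+ 2) t =
      \sum_(j < m) \sum_(k < m) c j * c k * dev (tau j k) t.
    have E x : low b x * ip m c (zeta x) ^+ 2 =
        \sum_(j < m) \sum_(k < m) c j * c k * tau j k x.
      rewrite expr2 {1}/ip mulr_suml mulr_sumr; apply: eq_bigr => j _.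
      by rewrite /ip !mulr_sumr; apply: eq_bigr => k _; rewrite /tau; ring.
    have Itau (j k : 'I_m) : rintegrable P (fun s => tau j k (X 0%N s)).
      by apply: rintegrable_sqr (Ib _ (mtau j k) (taujk j k)); exact: (mX 0 (mtau j k)).
    rewrite /dev; under eq_Rintegral do rewrite E.
    rewrite Rintegral_sum; last first.
      by move=> j; apply: rintegrable_sum => k; exact: rintegrableZ.
    have -> : empirical (fun x => low b x * ip m c (zeta x) ^+ 2) t =
        \sum_(j < m) \sum_(k < m) c j * c k * empirical (tau j k) t.
      rewrite /empirical; under eq_bigr do rewrite E.
      rewrite exchange_big mulr_sumr; apply: eq_bigr => j _.
      rewrite exchange_big mulr_sumr; apply: eq_bigr => k _.
      by rewrite -mulr_sumr mulrCA.
    rewrite -sumrB; apply: eq_bigr => j _.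
    rewrite Rintegral_sum; last by move=> k; exact: rintegrableZ.
    rewrite -sumrB; apply: eq_bigr => k _.
    by rewrite RintegralZl//; [rewrite mulrBr|exact: Itau].
  have k3 := quadratic_form_le m c (fun j k => dev (tau j k) t).
  have k4 : Num.sqrt (\sum_(j < m) \sum_(k < m) dev (tau j k) t ^+ 2) <= Num.sqrt (Dv t).
    by rewrite ler_wsqrtr// lerDl sqr_ge0.
  have k5 : ip m c (smean t) ^+ 2 <= qn m c * qn m (smean t) by exact: ip_sqr_le.
  rewrite addrAC; apply: le_trans (ler_normB _ _) _.
  rewrite (ger0_norm (sqr_ge0 _)).
  apply: le_trans (lerD k1 k5) _.
  rewrite [leRHS]mulrDr lerD2r [leRHS]mulrDr lerD2r k2.
  by apply: le_trans k3 _; rewrite ler_wpM2l//; exact: le_trans k4 (G1 t).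
- move=> t.
  pose h x := if b < N x then qn m (zeta x) else 0.
  have mh : measurable_fun setT h.
    by apply: measurable_fun_ifT => //; exact: measurable_fun_ltr.
  have Iqn : rintegrable P (fun t => qn m (zeta (X 0%N t))).
    apply: rintegrable_le IN _; first exact: (mX 0 mqn).
    by move=> s; rewrite ger0_norm ?qn_ge0.
  have k1 := @dev_above _ h b t mh mqn (fun x => qn_ge0 _ _).
  have {}k1 : `|dev (fun x => qn m (zeta x)) t| <= `|dev tau0 t| +
      1 * (empirical (fun x => above b (N x)) t + tail b).
    apply: k1 => //.
    + by move=> x; rewrite /h; case: ifP => // _; exact: qn_ge0.
    + by move=> x; rewrite /h /low; case: ifP => _; rewrite ?mul0r ?mul1r ?add0r ?addr0.
    + by move=> x; rewrite /h /above mul1r; case: ifP.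
  have k4 : `|dev tau0 t| <= Num.sqrt (Dv t).
    rewrite -sqrtr_sqr ler_wsqrtr// /Dv lerDr.
    by apply: sumr_ge0 => j _; apply: sumr_ge0 => k _; exact: sqr_ge0.
  rewrite addrAC; apply: le_trans (ler_normB _ _) _.
  rewrite (ger0_norm (qn_ge0 _ _)) lerD2r.
  apply: le_trans k1 _; rewrite mul1r lerD2r.
  exact: le_trans k4 (G1 t).
Qed.

End covariance.

(** * Comparison of the statistic with its bootstrap version *)

Section uniform_law.
Context d (T : measurableType d) (R : realType) (P : probability T R).
Variables (n : nat) (K : {mfun T >-> nat}).
Hypothesis n0 : (0 < n)%N.
Hypothesis Kunif : forall j, (j < n)%N -> P (K @^-1` [set j]) = (n%:R^-1)%:E.

Let mK j : measurable (K @^-1` [set j]). Proof. exact: measurable_funPTI. Qed.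

Let nn : n%:R != 0 :> R. Proof. by rewrite pnatr_eq0 -lt0n. Qed.


(** The n given masses add up to 1, so the index is almost surely below [n] and [g (K t)] is almost
    everywhere a finite combination of indicators. *)
Lemma uniform_integral (g : nat -> R) :
  rintegrable P (fun t => g (K t)) /\
  \int[P]_t g (K t) = n%:R^-1 * \sum_(j < n) g j.
Proof.
pose ind j t : R := \1_(K @^-1` [set j]) t.
have Iind j : rintegrable P (ind j) by exact: integrable_indic.
have Eind j : (j < n)%N -> \int[P]_t ind j t = n%:R^-1.
  move=> jn; rewrite /Rintegral /ind integral_indic// setIT.
  by rewrite [X in fine X](Kunif jn).
have indE j t : ind j t = (K t == j)%:R.
  rewrite /ind indicE; suff -> : (t \in K @^-1` [set j]) = (K t == j) by [].
  by apply/idP/eqP => [/set_mem//|Kj]; exact/mem_set.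
pose tot t := \sum_(j < n) ind j t.
have totE t : tot t = (K t < n)%N%:R.
  rewrite /tot; have [Kn|Kn] := ltnP (K t) n.
    rewrite (bigD1 (Ordinal Kn))//= indE eqxx big1 ?addr0// => j.
    by rewrite -val_eqE /= indE eq_sym => /negbTE ->.
  by rewrite big1// => j _; rewrite indE gtn_eqF// (leq_trans (ltn_ord j)).
have Itot : rintegrable P tot by exact: rintegrable_sum.
have tot1 : \int[P]_t (1 - tot t) = 0.
  rewrite RintegralB//; last exact: rintegrable_cst.
  rewrite Rintegral_prob_cst /tot Rintegral_sum// (eq_bigr (fun=> n%:R^-1)).
    by rewrite sumr_const card_ord -[X in 1 - X]mulr_natl mulfV// subrr.
  by move=> j _; exact: Eind.
have mtot : measurable_fun setT (fun t => 1 - tot t).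
  exact: measurable_funB (rintegrable_measurable Itot).
have ae1 : ae_eq P setT (fun t => (1 - tot t)%:E) (cst 0%E).
  apply/ae_eq_integral_abs => //; first exact/measurable_EFinP.
  have I1 : rintegrable P (fun t => 1 - tot t).
    by apply: rintegrableB => //; exact: rintegrable_cst.
  transitivity (\int[P]_t (1 - tot t)%:E)%E.
    apply: eq_integral => t _; rewrite abse_EFin ger0_norm// totE subr_ge0.
    by case: ltnP.
  by rewrite -Rintegral_EFin// tot1.
pose g' t := \sum_(j < n) g j * ind j t.
have Ig' : rintegrable P g'.
  by apply: rintegrable_sum => j; exact: rintegrableZ.
have mg : measurable_fun setT (fun t => g (K t)).
  have : measurable_fun setT g by [].
  by move=> h; exact: measurableT_comp.
have ae2 : ae_eq P setT (EFin \o fun t => g (K t)) (EFin \o g').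
  apply: filterS ae1 => t /(_ I) /=; rewrite totE => h _; congr EFin.
  have Kn : (K t < n)%N.
    by move: h; case: ltnP => // _ [/eqP]; rewrite subr0 oner_eq0.
  rewrite /g' (bigD1 (Ordinal Kn))//= indE eqxx mulr1 big1 ?addr0// => j.
  by rewrite -val_eqE /= indE eq_sym => /negbTE ->; rewrite mulr0.
have mg'E : measurable_fun setT (EFin \o g').
  by apply/measurable_EFinP; exact: rintegrable_measurable Ig'.
have mgE : measurable_fun setT (EFin \o fun t => g (K t)) by exact/measurable_EFinP.
split.
  apply/integrableP; split=> //.
  have /integrableP[_] := Ig'.
  rewrite (@ae_eq_integral _ _ _ _ _ (abse \o (EFin \o fun t => g (K t)))) //.
  - exact: measurableT_comp.
  - exact: measurableT_comp.
  - by apply: filterS ae2 => t /(_ I) /= [h] _; rewrite /= h.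
transitivity (\int[P]_t g' t).
  by congr fine; exact: ae_eq_integral.
rewrite /g' Rintegral_sum; last by move=> j; exact: rintegrableZ.
rewrite mulr_sumr; apply: eq_bigr => j _.
by rewrite RintegralZl//; [rewrite Eind// mulrC|exact: Iind].
Qed.

End uniform_law.

Lemma uniform_identically_distributed d (T : measurableType d) (R : realType)
    (P : probability T R) n (K : nat -> {mfun T >-> nat}) : (0 < n)%N ->
  (forall k j, (k < n)%N -> (j < n)%N ->
    P (K k @^-1` [set j]) = (n%:R^-1)%:E) ->
  identically_distributed P n K.
Proof.
move=> n0 Kunif i B ltin mB.
have E k : (k < n)%N ->
    P (K k @^-1` B) = (n%:R^-1 * \sum_(j < n) \1_B (j : nat))%:E.
  move=> kn; have mKB : measurable (K k @^-1` B) by exact: measurable_funPTI.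
  have [_ <-] := @uniform_integral _ _ _ P n (K k) n0
    (fun j jn => Kunif k j kn jn) (\1_B).
  rewrite Rintegral_EFin; last exact: (integrable_indic P mKB).
  transitivity (\int[P]_t (\1_(K k @^-1` B) t)%:E)%E => //.
  by rewrite integral_indic// setIT.
by rewrite E// E.
Qed.

Section bootstrap_comparison.
Context d dS dO (T : measurableType d) (S : measurableType dS)
  (OmegaS : measurableType dO) (R : realType).
Context (P : probability T R) (PS : probability OmegaS R).
Context (n : nat) (X : nat -> {mfun T >-> S}) (K : nat -> {mfun OmegaS >-> nat}).
Hypothesis indep : product_rule P n X.
Hypothesis ident : identically_distributed P n X.
Hypothesis n0 : (0 < n)%N.
Hypothesis Kindep : product_rule PS n K.
Hypothesis Kunif : forall k j, (k < n)%N -> (j < n)%N ->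
  PS (K k @^-1` [set j]) = (n%:R^-1)%:E.
Variables (zeta : S -> seqR R) (N : S -> R).
Hypothesis mzeta : measurable_fun setT zeta.
Hypothesis mN : measurable_fun setT N.
Hypothesis zetaN : forall m x, qn m (zeta x) <= N x.
Hypothesis IN : rintegrable P (fun t => N (X 0%N t)).
Hypothesis centred : forall j, \int[P]_t zeta (X 0%N t) j = 0.
Variable m : nat.

Let nn : n%:R != 0 :> R. Proof. by rewrite pnatr_eq0 -lt0n. Qed.
Let N0 x : 0 <= N x. Proof. exact: le_trans (qn_ge0 0 _) (zetaN 0 x). Qed.

(** For fixed data [t], resampling draws independently and uniformly from these centred vectors;
    their mean is 0 and their covariance is the empirical one. *)
Definition residual (t : T) (i : nat) : seqR R :=
  sadd (zeta (X i t)) (sscale (-1) (smean n X zeta t)).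

Let unif (g : nat -> R) := @uniform_integral _ _ _ PS n (K 0%N) n0
  (fun j jn => Kunif n0 jn) g.

Let empiricalE (g : S -> R) t :
  n%:R^-1 * \sum_(i < n) g (X i t) = empirical n X g t. Proof. by []. Qed.

Lemma residual_mean c t : \int[PS]_w ip m c (residual t (K 0%N w)) = 0.
Proof.
rewrite (unif (fun i => ip m c (residual t i))).2 /residual.
under eq_bigr do rewrite ip_sadd ip_sscale.
rewrite big_split mulrDr/= (empiricalE (fun x => ip m c (zeta x))).
rewrite sumr_const card_ord -[X in _ * X]mulr_natl mulKf// ip_smean.
by rewrite mulN1r subrr.
Qed.

Lemma residual_ip2 c t : \int[PS]_w ip m c (residual t (K 0%N w)) ^+ 2 =
  empirical n X (fun x => ip m c (zeta x) ^+ 2) t - ip m c (smean n X zeta t) ^+ 2.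
Proof.
rewrite (unif (fun i => ip m c (residual t i) ^+ 2)).2 /residual.
set y := ip m c (smean _ _ _ _).
rewrite (eq_bigr (fun i : 'I_n => ip m c (zeta (X i t)) ^+ 2 +
  ((- 2 * y) * ip m c (zeta (X i t)) + y ^+ 2))); last first.
  by move=> i _; rewrite ip_sadd ip_sscale -/y; ring.
rewrite big_split mulrDr/= (empiricalE (fun x => ip m c (zeta x) ^+ 2)).
rewrite big_split mulrDr/= -mulr_sumr mulrCA.
rewrite (empiricalE (fun x => ip m c (zeta x))) -ip_smean -/y.
by rewrite (empiricalE (fun=> y ^+ 2) t) empirical_cst//; ring.
Qed.

Lemma residual_qn t : \int[PS]_w qn m (residual t (K 0%N w)) =
  empirical n X (fun x => qn m (zeta x)) t - qn m (smean n X zeta t).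
Proof.
rewrite (unif (fun i => qn m (residual t i))).2 /residual.
set y := smean _ _ _ _.
rewrite (eq_bigr (fun i : 'I_n => qn m (zeta (X i t)) +
  ((- 2) * ip m y (zeta (X i t)) + qn m y))); last first.
  by move=> i _; rewrite qn_sadd ip_sscale qn_sscale ipC; ring.
rewrite big_split mulrDr/= (empiricalE (fun x => qn m (zeta x))).
rewrite big_split mulrDr/= -mulr_sumr mulrCA.
rewrite (empiricalE (fun x => ip m y (zeta x))) -ip_smean -/y.
have -> : ip m y y = qn m y by apply: eq_bigr => j _; rewrite expr2.
by rewrite (empiricalE (fun=> qn m y) t) empirical_cst//; ring.
Qed.

Let sigma2 := \int[P]_t N (X 0%N t).
Let tail b := \int[P]_t above b (N (X 0%N t)).

Let mabove b : measurable_fun setT (fun x => above b (N x)).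
Proof. exact: measurable_above. Qed.

Let Iabove b : rintegrable P (fun t => above b (N (X 0%N t))).
Proof.
apply: rintegrable_le IN _; first exact: (measurableT_comp (mabove b)).
by move=> t; rewrite ger0_norm ?above_ge0// above_le.
Qed.

(** The Lindeberg remainder of the resampled vectors depends on the data. It is dominated through
    |residual|^2 <= 2 N + 2 |mean|^2, and the dominating function has a mean controlled by the tail
    of [N] and by sigma2 / n. *)
Lemma residual_remainder th B : 0 < th -> exists H : T -> R,
  [/\ rintegrable P H,
    \int[P]_t H t <= th * (2 * sigma2 + 2 * (n%:R^-1 * sigma2)) +
      4 * tail (B / 4) + 4 * (n%:R^-1 * sigma2) &
    forall t, th * \int[PS]_w qn m (residual t (K 0%N w)) +
      \int[PS]_w above B (qn m (residual t (K 0%N w))) <= H t].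
Proof.
move=> th0.
have [Iq1 Iq2] := qn_smean_integral indep ident n0 mzeta zetaN IN centred m.
have [Ie1 Ie2] := empirical_integral ident n0 mN IN.
have [Ia1 Ia2] := empirical_integral ident n0 (mabove (B / 4)) (Iabove (B / 4)).
pose q t := qn m (smean n X zeta t).
exists (fun t => th * (2 * empirical n X N t + 2 * q t) +
  4 * empirical n X (fun x => above (B / 4) (N x)) t + 4 * q t).
have I1 : rintegrable P (fun t => 2 * empirical n X N t + 2 * q t).
  by apply: rintegrableD; exact: rintegrableZ.
have I2 : rintegrable P (fun t => th * (2 * empirical n X N t + 2 * q t)).
  exact: rintegrableZ.
have I3 : rintegrable P (fun t => 4 * empirical n X (fun x => above (B / 4) (N x)) t).
  exact: rintegrableZ.
have I4 : rintegrable P (fun t => 4 * q t) by exact: rintegrableZ.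
have I23 := rintegrableD I2 I3.
split; first exact: rintegrableD.
- have E1 : \int[P]_t (2 * empirical n X N t + 2 * q t) =
      2 * sigma2 + 2 * \int[P]_t q t.
    rewrite RintegralD//; [|exact: rintegrableZ..].
    by rewrite RintegralZl// RintegralZl// Ie2.
  rewrite RintegralD// RintegralD// (RintegralZl th)// E1.
  have E2 : \int[P]_t (4 * empirical n X (fun x => above (B / 4) (N x)) t) =
      4 * tail (B / 4) by rewrite RintegralZl// Ia2.
  have E3 : \int[P]_t (4 * q t) = 4 * \int[P]_t q t by rewrite RintegralZl.
  rewrite E2 E3.
  rewrite lerD//; last by rewrite ler_wpM2l.
  by rewrite lerD2r ler_wpM2l ?(ltW th0)// lerD2l ler_wpM2l.
move=> t.
have q0 : 0 <= q t by exact: qn_ge0.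
have h1 i : qn m (residual t i) <= 2 * N (X i t) + 2 * q t.
  apply: le_trans (qn_sadd_le _ _ _) _; rewrite qn_sscale sqrrN expr1n mul1r lerD2r.
  by rewrite ler_wpM2l.
(* One halving of the level comes from [above_add], the other from the factor 2 in front of [N]. The
   mean needs no truncation, since it is already small. *)
have h2 i : above B (qn m (residual t i)) <= 4 * above (B / 4) (N (X i t)) + 4 * q t.
  have Nq : 0 <= 2 * N (X i t) + 2 * q t by rewrite addr_ge0// mulr_ge0.
  apply: le_trans (above_homo _ Nq (h1 i)) _.
  apply: le_trans (above_add _ _ _) _; rewrite ?mulr_ge0//.
  have -> : B / 2 = 2 * (B / 4) by lra.
  have q2 : 0 <= 2 * q t by rewrite mulr_ge0.
  by rewrite aboveM//; have := above_le (2 * (B / 4)) q2; lra.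
rewrite (unif (fun i => qn m (residual t i))).2.
rewrite (unif (fun i => above B (qn m (residual t i)))).2.
rewrite -addrA; apply: lerD.
  rewrite ler_wpM2l ?(ltW th0)//.
  apply: (@le_trans _ _ (n%:R^-1 * \sum_(i < n) (2 * N (X i t) + 2 * q t))).
    by rewrite ler_wpM2l ?invr_ge0// ler_sum.
  rewrite (empiricalE (fun x => 2 * N x + 2 * q t)) empiricalD empiricalZ.
  by rewrite (empirical_cst _ n0).
apply: (@le_trans _ _ (n%:R^-1 *
    \sum_(i < n) (4 * above (B / 4) (N (X i t)) + 4 * q t))).
  by rewrite ler_wpM2l ?invr_ge0// ler_sum.
rewrite (empiricalE (fun x => 4 * above (B / 4) (N x) + 4 * q t)) empiricalD empiricalZ.
by rewrite (empirical_cst _ n0).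
Qed.

End bootstrap_comparison.

Lemma step1_scaled_le (R : realType) (e y : R) : 0 < e -> `|step1 y / e| <= 36 / e.
Proof.
move=> e0; rewrite normrM (@gtr0_norm _ e^-1) ?invr_gt0//.
by rewrite ler_wpM2r ?step1_le// invr_ge0 ltW.
Qed.

(* The second derivative vanishes outside a ball, which absorbs the factor
   [qn m c]. *)
Lemma step2_scaled_le (R : realType) m (e M s : R) (c : seqR R) :
  0 < e -> 0 <= M -> s + 3 * e <= M ->
  `|step2 ((qn m c - s) / e) / e ^+ 2| * qn m c <= 24 * M / e ^+ 2.
Proof.
move=> e0 M0 sM; have e2 : 0 < (e ^+ 2)^-1 by rewrite invr_gt0 exprn_gt0.
have [h|h] := leP 3 ((qn m c - s) / e).
  rewrite step2_eq0// mul0r normr0 mul0r mulr_ge0 ?(ltW e2)// mulr_ge0//.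
have cM : qn m c <= M by move: h; rewrite ltr_pdivrMr//; lra.
rewrite normrM (gtr0_norm e2) mulrAC ler_wpM2r ?(ltW e2)//.
by rewrite ler_pM ?qn_ge0// step2_le.
Qed.

(** Two expansions at the same point, both with vanishing mean increment (the [2 * 0]): traces are
    compared through [q1 - q2], covariances through [v1 - v2]. *)
Lemma lindeberg_combine (R : realFieldType)
    (u1 u2 f0 a b q1 q2 v1 v2 E1 E2 D1 D2 r2 : R) :
  `|u1 - f0 - a * (2 * 0 + r2 * q1) - 2 * b * (r2 * v1)| <= r2 * E1 ->
  `|u2 - f0 - a * (2 * 0 + r2 * q2) - 2 * b * (r2 * v2)| <= r2 * E2 ->
  0 <= r2 -> `|a| * `|q1 - q2| <= D1 -> `|b| * `|v1 - v2| <= D2 ->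
  `|u1 - u2| <= r2 * (E1 + E2 + D1 + 2 * D2).
Proof.
move=> h1 h2 r20; rewrite -!normrM => h3 h4.
have {}h3 : `|r2 * (a * (q1 - q2))| <= r2 * D1.
  by rewrite normrM (ger0_norm r20) ler_wpM2l.
have {}h4 : `|r2 * (b * (v1 - v2))| <= r2 * D2.
  by rewrite normrM (ger0_norm r20) ler_wpM2l.
move: h1 h2 h3 h4; rewrite !ler_norml => /andP[? ?] /andP[? ?] /andP[? ?] /andP[? ?].
by apply/andP; split; lra.
Qed.

Section bootstrap_transfer.
Context d dS dO (T : measurableType d) (S : measurableType dS)
  (OmegaS : measurableType dO) (R : realType).
Context (P : probability T R) (PS : probability OmegaS R).
Context (n : nat) (X : nat -> {mfun T >-> S}) (K : nat -> {mfun OmegaS >-> nat}).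
Hypothesis indep : product_rule P n X.
Hypothesis ident : identically_distributed P n X.
Hypothesis n0 : (0 < n)%N.
Hypothesis Kindep : product_rule PS n K.
Hypothesis Kunif : forall k j, (k < n)%N -> (j < n)%N ->
  PS (K k @^-1` [set j]) = (n%:R^-1)%:E.
Variables (zeta : S -> seqR R) (N : S -> R).
Hypothesis mzeta : measurable_fun setT zeta.
Hypothesis mN : measurable_fun setT N.
Hypothesis zetaN : forall m x, qn m (zeta x) <= N x.
Hypothesis IN : rintegrable P (fun t => N (X 0%N t)).
Hypothesis centred : forall j, \int[P]_t zeta (X 0%N t) j = 0.

Let sigma2 := \int[P]_t N (X 0%N t).
Let tail b := \int[P]_t above b (N (X 0%N t)).

Lemma rintegrable_coord j : rintegrable P (fun t => zeta (X 0%N t) j).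
Proof.
apply: rintegrable_sqr.
  exact: (measurableT_comp (measurable_fun_coord j mzeta)).
apply: rintegrable_le IN _.
  by apply: measurable_funX; exact: (measurableT_comp (measurable_fun_coord j mzeta)).
move=> t; rewrite ger0_norm ?sqr_ge0//.
exact: le_trans (sqr_coord_le_qn _ _) (zetaN _ _).
Qed.

Lemma centred_ip m c : \int[P]_t ip m c (zeta (X 0%N t)) = 0.
Proof.
rewrite Rintegral_sum; last by move=> j; apply: rintegrableZ; exact: rintegrable_coord.
rewrite big1// => j _; rewrite RintegralZl ?centred ?mulr0//.
exact: rintegrable_coord.
Qed.

(** With the data frozen, both laws are [n]-fold iterates of averaging operators. One exchange costs
    r^2 times a function of the data, and n r^2 = 1. That function does not involve the level
    [s]. *)
Lemma bootstrap_transfer m (e M C th l b r : R) : 0 < e -> 0 <= M -> 0 <= C ->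
  qstep_remainder_le e M C ->
  0 < th -> th <= 1 -> 0 < l -> 0 <= b -> 0 < r -> r ^+ 2 * n%:R = 1 ->
  exists Rn : T -> R, [/\ rintegrable P Rn,
    \int[P]_t Rn t <=
      C * (th * (2 * sigma2 + 2 * (n%:R^-1 * sigma2)) +
        4 * tail (th ^+ 2 * n%:R / 4) + 4 * (n%:R^-1 * sigma2)) +
      C * (th * sigma2 + tail (th ^+ 2 * n%:R)) +
      (36 / e + 2 * (24 * M / e ^+ 2)) *
      (l + 2 * b ^+ 2 / (n%:R * l) + 2 * tail b + n%:R^-1 * sigma2) &
    forall t s, s + 3 * e <= M ->
    `|\int[PS]_w qstep m e s
        (psum K (fun i => sscale r (residual n X zeta t i)) n w) -
      \int[P]_w qstep m e s (psum X (fun x => sscale r (zeta x)) n w)| <= Rn t].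
Proof.
move=> e0 M0 C0 taylor th0 th1 l0 b0 r0 rn.
have nn : n%:R != 0 :> R by rewrite pnatr_eq0 -lt0n.
have thr : th ^+ 2 / r ^+ 2 = th ^+ 2 * n%:R.
  have r2 : r ^+ 2 != 0 by rewrite lt0r_neq0// exprn_gt0.
  by congr (_ * _); apply: (mulfI r2); rewrite rn mulfV.
have [G [IG EG G0 G1 G2]] :=
  covariance_close indep ident n0 mzeta mN zetaN IN centred m l0 b0.
have [H [IH EH H1]] := residual_remainder indep ident n0 Kunif
  mzeta mN zetaN IN centred m (th ^+ 2 * n%:R) th0.
set A := 36 / e + 2 * (24 * M / e ^+ 2).
pose B0 := C * (th * sigma2 + tail (th ^+ 2 * n%:R)).
have IR1 : rintegrable P (fun t => C * H t + B0).
  by apply: rintegrableD; [exact: rintegrableZ|exact: rintegrable_cst].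
exists (fun t => C * H t + B0 + A * G t); split.
- by apply: rintegrableD => //; exact: rintegrableZ.
- have A0 : 0 <= A.
    by rewrite addr_ge0// ?mulr_ge0 ?invr_ge0 ?exprn_ge0// ltW.
  rewrite RintegralD//; last exact: rintegrableZ.
  rewrite RintegralD//; [|exact: rintegrableZ|exact: rintegrable_cst].
  rewrite (RintegralZl C)// (RintegralZl A)// Rintegral_prob_cst.
  by apply: lerD; [rewrite lerD2r ler_wpM2l|rewrite ler_wpM2l].
move=> t s sM.
set f := qstep m e s.
have bf : bounded_measurable f by exact: bounded_measurable_qstep.
pose xi1 i := sscale r (residual n X zeta t i).
pose xi2 x := sscale r (zeta x).
have mxi1 : measurable_fun setT xi1 by [].
have mxi2 : measurable_fun setT xi2 by exact: measurable_sscale.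
have Kident := uniform_identically_distributed n0 Kunif.
have sz x : sadd (szero R) x = x by rewrite saddC saddx0.
have -> : \int[PS]_w f (psum K xi1 n w) =
    iter n (avg PS (fun w => xi1 (K 0%N w))) f (szero R).
  rewrite -(integral_psum mxi1 Kindep Kident)//.
  by apply: eq_Rintegral => w _; rewrite sz.
have -> : \int[P]_w f (psum X xi2 n w) =
    iter n (avg P (fun w => xi2 (X 0%N w))) f (szero R).
  rewrite -(integral_psum mxi2 indep ident)//.
  by apply: eq_Rintegral => w _; rewrite sz.
have m1 : measurable_fun setT (fun w => xi1 (K 0%N w)) by exact: measurableT_comp.
have m2 : measurable_fun setT (fun w => xi2 (X 0%N w)) by exact: measurableT_comp.
have step x : `|avg PS (fun w => xi1 (K 0%N w)) f x -
      avg P (fun w => xi2 (X 0%N w)) f x| <=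
    r ^+ 2 * (C * H t + B0 + A * G t).
  pose N1 w := qn m (residual n X zeta t (K 0%N w)).
  have mres : measurable_fun setT (fun w => residual n X zeta t (K 0%N w)).
    have h : measurable_fun setT (residual n X zeta t) by [].
    exact: (measurableT_comp h).
  have IN1 : rintegrable PS N1.
    by have [h _] := uniform_integral n0 (fun j jn => Kunif n0 jn)
      (fun i => qn m (residual n X zeta t i)).
  have E1 := avg_taylor mres IN1 (fun w => lexx _) C0 taylor x sM th0 th1 r0.
  have mzX : measurable_fun setT (fun w => zeta (X 0%N w)) by exact: measurableT_comp.
  have E2 := avg_taylor mzX IN (fun w => zetaN _ _) (m := m) C0 taylor x sM th0 th1 r0.
  rewrite thr (residual_mean _ n0 Kunif) mulr0 in E1.
  rewrite thr centred_ip mulr0 in E2.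
  rewrite [X in _ <= X]mulrCA in E1; rewrite [X in _ <= X]mulrCA in E2.
  have D1 : `|step1 ((qn m x - s) / e) / e| *
      `|\int[PS]_w qn m (residual n X zeta t (K 0%N w)) -
        \int[P]_w qn m (zeta (X 0%N w))| <=
      36 / e * G t.
    by rewrite (residual_qn _ n0 Kunif); apply: ler_pM => //; exact: step1_scaled_le.
  have D2 : `|step2 ((qn m x - s) / e) / e ^+ 2| *
      `|\int[PS]_w ip m x (residual n X zeta t (K 0%N w)) ^+ 2 -
        \int[P]_w ip m x (zeta (X 0%N w)) ^+ 2| <= 24 * M / e ^+ 2 * G t.
    rewrite (residual_ip2 _ n0 Kunif).
    apply: (@le_trans _ _ (`|step2 ((qn m x - s) / e) / e ^+ 2| * (qn m x * G t))).
      by rewrite ler_wpM2l.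
    by rewrite mulrA ler_wpM2r//; exact: step2_scaled_le.
  have := lindeberg_combine E1 E2 (sqr_ge0 r) D1 D2.
  move=> h; apply: le_trans h _; rewrite ler_wpM2l ?sqr_ge0//.
  have := ler_wpM2l C0 (H1 t); rewrite /N1 /B0 /A /sigma2 /tail; lra.
have := iter_averaging_dist n (avg_averaging PS m1) (avg_averaging P m2) _ bf
  step (szero R).
rewrite mulrA [n%:R * _]mulrC rn mul1r; apply.
move=> g bg; apply/funext => x; exact: avg_comm.
Qed.

End bootstrap_transfer.

(** * Anti-concentration of the statistic *)

Lemma iter_avg_ub d (T : measurableType d) (R : realType) (P : probability T R)
    xi (g : seqR R -> R) k K : measurable_fun setT xi -> bounded_measurable g ->
  (forall x, g x <= K) -> forall c, iter k (avg P xi) g c <= K.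
Proof.
move=> mxi bg gK; elim: k => //= k IH c.
have bk : bounded_measurable (iter k (avg P xi) g).
  by apply: averaging_bm => //; apply: iter_averaging; exact: avg_averaging.
have bK : bounded_measurable (cst K : seqR R -> R).
  by split=> //; exists `|K|.
apply: le_trans (le_avg P mxi c bk bK IH) _.
by rewrite /avg Rintegral_prob_cst.
Qed.

Section covariance_preserving_smoothing.
Context d dS (T : measurableType d) (S : measurableType dS) (R : realType).
Context (P : probability T R) (X0 : {mfun T >-> S}).
Variables (zeta : S -> seqR R) (N : S -> R).
Hypothesis mzeta : measurable_fun setT zeta.
Hypothesis mN : measurable_fun setT N.
Hypothesis zetaN : forall m x, qn m (zeta x) <= N x.
Hypothesis IN : rintegrable P (fun t => N (X0 t)).
Hypothesis centred : forall j, \int[P]_t zeta (X0 t) j = 0.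
Variable j0 : nat.

Let Z t := zeta (X0 t).
Let mZ : measurable_fun setT Z. Proof. exact: measurableT_comp. Qed.
Let sigma2 := \int[P]_t N (X0 t).
Let s2 := \int[P]_t Z t j0 ^+ 2.
Hypothesis s20 : 0 < s2.

Let mcoord j : measurable_fun setT (fun t => Z t j).
Proof. exact: measurable_fun_coord. Qed.

Let coordN t j : Z t j ^+ 2 <= N (X0 t).
Proof. exact: le_trans (sqr_coord_le_qn _ _) (zetaN _ _). Qed.

Let N0 t : 0 <= N (X0 t). Proof. exact: le_trans (sqr_ge0 _) (coordN t 0). Qed.

Let IZZ j k : rintegrable P (fun t => Z t j * Z t k).
Proof.
apply: rintegrable_le IN _; first exact: measurable_funM.
move=> t; have h1 := coordN t j; have h2 := coordN t k.
rewrite normrM; have := sqr_ge0 (`|Z t j| - `|Z t k|).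
by rewrite sqrrB !real_normK ?num_real// => h; lra.
Qed.

Let Icoord j : rintegrable P (fun t => Z t j).
Proof.
apply: rintegrable_sqr => //; under eq_fun do rewrite expr2; exact: IZZ.
Qed.

Let Iip m c : rintegrable P (fun t => ip m c (Z t)).
Proof. by apply: rintegrable_ip IN (fun t => zetaN m (X0 t)) c. Qed.

Let Iip2 m c : rintegrable P (fun t => ip m c (Z t) ^+ 2).
Proof. by apply: rintegrable_ip2 IN (fun t => zetaN m (X0 t)) c. Qed.

Let ip0 m c : \int[P]_t ip m c (Z t) = 0.
Proof.
rewrite Rintegral_sum; last by move=> j; apply: rintegrableZ.
by rewrite big1// => j _; rewrite RintegralZl ?centred ?mulr0//; exact: Icoord.
Qed.

Definition cov_row : seqR R := fun j => \int[P]_t (Z t j0 * Z t j).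

Let v := cov_row.

Let Ijip m c : rintegrable P (fun t => Z t j0 * ip m c (Z t)).
Proof.
under eq_fun do rewrite mulr_sumr.
apply: rintegrable_sum => j; under eq_fun do rewrite mulrCA.
exact: rintegrableZ.
Qed.

Let jip m c : \int[P]_t (Z t j0 * ip m c (Z t)) = ip m c v.
Proof.
under eq_Rintegral do rewrite mulr_sumr.
rewrite Rintegral_sum; last first.
  by move=> j; under eq_fun do rewrite mulrCA; exact: rintegrableZ.
apply: eq_bigr => j _; under eq_Rintegral do rewrite mulrCA.
by rewrite RintegralZl//; exact: IZZ.
Qed.

Let s2_le : s2 <= sigma2.
Proof.
apply: le_Rint => //; under eq_fun do rewrite expr2; exact: IZZ.
Qed.

(** |v|^2 is the mean of Z_j <v, Z>. The weighted inequality 2xy <= sigma2 x^2 + y^2 / sigma2 gives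
    2 |v|^2 <= sigma2 s2 + |v|^2. *)
Lemma qn_cov_row_le m : qn m v <= sigma2 * s2.
Proof.
have -> : qn m v = ip m v v by apply: eq_bigr => j _; rewrite expr2.
have vv : ip m v v = qn m v by apply: eq_bigr => j _; rewrite expr2.
have sg : 0 < sigma2 by exact: lt_le_trans s2_le.
have Ij : rintegrable P (fun t => Z t j0 ^+ 2).
  by under eq_fun do rewrite expr2; exact: IZZ.
have I1 := rintegrableZ sigma2 Ij; have I2 := rintegrableZ sigma2^-1 (Iip2 m v).
have : 2 * ip m v v <= sigma2 * s2 + sigma2^-1 * (qn m v * sigma2).
  rewrite -jip -RintegralZl; [|by []|exact: Ijip].
  apply: (@le_trans _ _
      (\int[P]_t (sigma2 * Z t j0 ^+ 2 + sigma2^-1 * ip m v (Z t) ^+ 2))).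
    apply: le_Rint; [exact: rintegrableZ (Ijip m v)|exact: rintegrableD|move=> t].
    rewrite -(ler_pM2l sg) mulrDr !mulrA mulfV ?lt0r_neq0// mul1r.
    by have := sqr_ge0 (sigma2 * Z t j0 - ip m v (Z t)); rewrite sqrrB; lra.
  rewrite RintegralD// RintegralZl// lerD2l RintegralZl; [|by []|exact: Iip2].
  rewrite ler_wpM2l ?invr_ge0 ?(ltW sg)// /sigma2 -RintegralZl//.
  apply: le_Rint => //; first exact: rintegrableZ.
  move=> t; apply: le_trans (ip_sqr_le _ _ _) _; rewrite ler_wpM2l ?qn_ge0//.
  exact: zetaN.
rewrite vv [sigma2^-1 * _]mulrC mulfK ?lt0r_neq0//; lra.
Qed.

(* [residual_part] is uncorrelated with the [j0]-th coordinate; adding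
   [direction] with a random sign restores the covariance of [Z]. *)
Definition direction : seqR R := sscale (Num.sqrt s2)^-1 v.
Let u := direction.

Definition residual_part (x : S) : seqR R :=
  sadd (zeta x) (sscale (- (zeta x j0 / s2)) v).
Let W t := residual_part (X0 t).

(** From |W +- u|^2 <= 2 |W|^2 + 2 |u|^2, where |W|^2 <= 2 N + 2 N sigma2 / s2 and |u|^2 <= sigma2,
    in every dimension. *)
Definition envelope (x : S) : R := (4 + 4 * (sigma2 / s2)) * N x + 2 * sigma2.

Lemma measurable_residual_part : measurable_fun setT residual_part.
Proof.
apply: measurable_sadd => //; apply: measurable_fun_seqP => j.
apply: measurable_funM => //; apply: measurableT_comp => //.
by apply: measurable_funM => //; exact: measurable_fun_coord.
Qed.

Lemma rintegrable_envelope : rintegrable P (fun t => envelope (X0 t)).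
Proof. by apply: rintegrableD; [exact: rintegrableZ|exact: rintegrable_cst]. Qed.

(** Coordinate [j0] of the direction is s2 / sqrt s2. *)
Lemma qn_direction_ge m : (j0 < m)%N -> s2 <= qn m u.
Proof.
move=> jm; rewrite /qn (bigD1 (Ordinal jm))//=.
have -> : u j0 ^+ 2 = s2.
  rewrite /u /direction /sscale /v /cov_row.
  have -> : \int[P]_t (Z t j0 * Z t j0) = s2.
    by apply: eq_Rintegral => t _; rewrite expr2.
  rewrite exprMn exprVn sqr_sqrtr ?(ltW s20)// expr2 mulKf// lt0r_neq0//.
by rewrite lerDl; apply: sumr_ge0 => i _; exact: sqr_ge0.
Qed.

Let qnu m : qn m u <= sigma2.
Proof.
rewrite /u qn_sscale exprVn sqr_sqrtr ?(ltW s20)//.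
by rewrite mulrC ler_pdivrMr// qn_cov_row_le.
Qed.

Lemma qn_residual_le m e x : e ^+ 2 = 1 ->
  qn m (sadd (residual_part x) (sscale e u)) <= envelope x.
Proof.
move=> e1; apply: le_trans (qn_sadd_le _ _ _) _.
rewrite qn_sscale e1 mul1r /envelope; apply: lerD; last by rewrite ler_wpM2l.
have h1 := qn_sadd_le m (zeta x) (sscale (- (zeta x j0 / s2)) v).
rewrite qn_sscale sqrrN in h1.
have h2 : (zeta x j0 / s2) ^+ 2 * qn m v <= N x * (sigma2 / s2).
  apply: (@le_trans _ _ ((zeta x j0 / s2) ^+ 2 * (sigma2 * s2))).
    by rewrite ler_wpM2l ?sqr_ge0// qn_cov_row_le.
  have -> : (zeta x j0 / s2) ^+ 2 * (sigma2 * s2) = zeta x j0 ^+ 2 * (sigma2 / s2).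
    by field; rewrite lt0r_neq0.
  rewrite ler_wpM2r//.
    by rewrite divr_ge0// ltW//; exact: lt_le_trans s2_le.
  exact: le_trans (sqr_coord_le_qn _ _) (zetaN _ _).
have h3 := zetaN m x.
rewrite -/(residual_part x) in h1; lra.
Qed.

Let mW : measurable_fun setT W.
Proof. exact: (measurableT_comp measurable_residual_part). Qed.

Let ipW m c t : ip m c (W t) = ip m c (Z t) - (ip m c v / s2) * Z t j0.
Proof. by rewrite /W /residual_part ip_sadd ip_sscale -/(Z t); ring. Qed.

Let IipW m c : rintegrable P (fun t => ip m c (W t)).
Proof.
by under eq_fun do rewrite ipW; apply: rintegrableB => //; exact: rintegrableZ.
Qed.

Let ipW0 m c : \int[P]_t ip m c (W t) = 0.
Proof.
under eq_Rintegral do rewrite ipW.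
rewrite RintegralB//; [|exact: Iip|exact: rintegrableZ].
have cj : \int[P]_t Z t j0 = 0 := centred j0.
by rewrite ip0 RintegralZl//; [rewrite cj mulr0 subr0|exact: Icoord].
Qed.

Lemma ip_shifted_mean m c e :
  \int[P]_t ip m c (sadd (W t) (sscale e u)) = e * ip m c u.
Proof.
under eq_Rintegral do rewrite ip_sadd ip_sscale.
rewrite RintegralD//; [|exact: IipW|exact: rintegrable_cst].
by rewrite ipW0 Rintegral_prob_cst add0r.
Qed.

(** Removing the regression on Z_j lowers the second moment by <c, v>^2 / s2, which is exactly <c,
    u>^2; the cross term vanishes because the residual has mean 0. So either sign alone preserves
    second moments. *)
Lemma ip2_shifted_mean m c e : e ^+ 2 = 1 ->
  \int[P]_t ip m c (sadd (W t) (sscale e u)) ^+ 2 = \int[P]_t ip m c (Z t) ^+ 2.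
Proof.
move=> e1; set w := ip m c v.
have uw : ip m c u ^+ 2 = w ^+ 2 / s2.
  by rewrite /u ip_sscale exprMn exprVn sqr_sqrtr ?(ltW s20)// mulrC.
have Ij : rintegrable P (fun t => Z t j0 ^+ 2).
  by under eq_fun do rewrite expr2; exact: IZZ.
have E t : ip m c (sadd (W t) (sscale e u)) ^+ 2 =
    ip m c (Z t) ^+ 2 + ((- 2 * (w / s2)) * (Z t j0 * ip m c (Z t)) +
     ((w / s2) ^+ 2 * Z t j0 ^+ 2 +
      ((2 * e * ip m c u) * ip m c (W t) + w ^+ 2 / s2))).
  have h : e ^+ 2 * ip m c u ^+ 2 = ip m c u ^+ 2 by rewrite e1 mul1r.
  by rewrite ip_sadd ip_sscale -uw -h ipW -/w; ring.
under eq_Rintegral do rewrite E.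
have J1 := rintegrableZ (- 2 * (w / s2)) (Ijip m c).
have J2 := rintegrableZ ((w / s2) ^+ 2) Ij.
have J3 := rintegrableZ (2 * e * ip m c u) (IipW m c).
have J4 := rintegrableD J3 (rintegrable_cst P (w ^+ 2 / s2)).
have J5 := rintegrableD J2 J4; have J6 := rintegrableD J1 J5.
rewrite RintegralD//; last exact: Iip2.
rewrite RintegralD// RintegralD// RintegralD//; last exact: rintegrable_cst.
rewrite (RintegralZl (- 2 * (w / s2)))//; last exact: Ijip.
rewrite (RintegralZl ((w / s2) ^+ 2))//.
rewrite (RintegralZl (2 * e * ip m c u))//; last exact: IipW.
rewrite ipW0 jip -/w -/s2 Rintegral_prob_cst.
by field; rewrite lt0r_neq0.
Qed.

Lemma qn_shifted_mean m e : e ^+ 2 = 1 ->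
  \int[P]_t qn m (sadd (W t) (sscale e u)) = \int[P]_t qn m (Z t).
Proof.
move=> e1; pose del (j : nat) : seqR R := fun k => (k == j)%:R.
have E x : qn m x = \sum_(j < m) ip m (del j) x ^+ 2.
  apply: eq_bigr => j _; congr (_ ^+ 2).
  rewrite /ip (bigD1 j)//= /del eqxx mul1r big1 ?addr0// => k kj.
  by rewrite -val_eqE in kj; rewrite (negbTE kj) mul0r.
under eq_Rintegral do rewrite E.
under [RHS]eq_Rintegral do rewrite E.
have mY : measurable_fun setT (fun t => sadd (W t) (sscale e u)).
  exact: measurable_sadd.
have IY (j : 'I_m) := @rintegrable_ip2 _ _ _ _ _ _ _ mY rintegrable_envelope
  (fun t => qn_residual_le m _ e1) (del j).
rewrite Rintegral_sum// Rintegral_sum; last by move=> j; exact: Iip2.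
by apply: eq_bigr => j _; exact: ip2_shifted_mean.
Qed.

(** Three expansions at [c], for Z, W + u and W - u. Second-order terms agree, and the means +u and
    -u cancel in the average over the sign, leaving only remainders. *)
Lemma smoothing_taylor m (e M C th r : R) : 0 < e -> 0 <= C ->
  qstep_remainder_le e M C ->
  0 < th -> th <= 1 -> 0 < r -> forall s c, s + 3 * e <= M ->
  `|avg P (fun t => sscale r (Z t)) (qstep m e s) c -
    avg P (fun t => sscale r (W t)) (rademacher (sscale r u) (qstep m e s)) c| <=
  r ^+ 2 * (C * (th * sigma2 + \int[P]_t above (th ^+ 2 / r ^+ 2) (N (X0 t))) +
    C * (th * \int[P]_t envelope (X0 t) +
      \int[P]_t above (th ^+ 2 / r ^+ 2) (envelope (X0 t)))).
Proof.
move=> e0 C0 taylor th0 th1 r0 s c sM.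
have mY (k : R) : measurable_fun setT (fun t => sadd (W t) (sscale k u)).
  exact: measurable_sadd.
have one : (1 : R) ^+ 2 = 1 by rewrite expr1n.
have mone : (-1 : R) ^+ 2 = 1 by rewrite sqrrN expr1n.
have h0 := avg_taylor mZ IN (fun t => zetaN m (X0 t)) C0 taylor c sM th0 th1 r0.
have hp := avg_taylor (mY 1) rintegrable_envelope
  (fun t => qn_residual_le m (X0 t) one) C0 taylor c sM th0 th1 r0.
have hm := avg_taylor (mY (-1)) rintegrable_envelope
  (fun t => qn_residual_le m (X0 t) mone) C0 taylor c sM th0 th1 r0.
rewrite ip0 in h0.
rewrite ip_shifted_mean ip2_shifted_mean// qn_shifted_mean// in hp.
rewrite ip_shifted_mean ip2_shifted_mean// qn_shifted_mean// in hm.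
have bf : bounded_measurable (qstep m e s) by exact: bounded_measurable_qstep.
rewrite -(rademacher_avg_comm P (sscale r u) c (measurable_sscale r mW) bf) /rademacher.
have shift k : avg P (fun t => sscale r (W t)) (qstep m e s)
      (sadd c (sscale k (sscale r u))) =
    avg P (fun t => sscale r (sadd (W t) (sscale k u))) (qstep m e s) c.
  apply: eq_Rintegral => t _; congr qstep; apply/funext => j.
  by rewrite /sadd /sscale; ring.
have -> : sadd c (sscale r u) = sadd c (sscale 1 (sscale r u)).
  by apply/funext => j; rewrite /sadd /sscale mul1r.
rewrite !shift.
move: h0 hp hm; rewrite !ler_norml => /andP[? ?] /andP[? ?] /andP[? ?].
by apply/andP; split; rewrite /sigma2; lra.
Qed.

End covariance_preserving_smoothing.

Definition invsqrt (R : realType) (n : nat) : R := (Num.sqrt n%:R)^-1.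

Lemma invsqrt_gt0 (R : realType) n : (0 < n)%N -> 0 < invsqrt R n.
Proof. by move=> n0; rewrite invr_gt0 sqrtr_gt0 ltr0n. Qed.

Lemma invsqrt_sqr (R : realType) n : (0 < n)%N -> invsqrt R n ^+ 2 * n%:R = 1.
Proof.
move=> n0; rewrite /invsqrt exprVn sqr_sqrtr// mulVf// pnatr_eq0.
by rewrite -lt0n.
Qed.

Lemma div_invsqrt_sqr (R : realType) n (x : R) : (0 < n)%N ->
  x / invsqrt R n ^+ 2 = x * n%:R.
Proof.
move=> n0; have r2 : invsqrt R n ^+ 2 != 0.
  by rewrite lt0r_neq0// exprn_gt0// invsqrt_gt0.
by congr (_ * _); apply: (mulfI r2); rewrite invsqrt_sqr// mulfV.
Qed.

Lemma invsqrt_le (R : realType) n (x : R) : 0 < x -> (x ^+ 2)^-1 <= n%:R ->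
  invsqrt R n <= x.
Proof.
move=> x0 xn; rewrite /invsqrt -[x]invrK lef_pV2 ?posrE ?invr_gt0//.
  by rewrite -(@ger0_norm _ x^-1) ?invr_ge0 ?(ltW x0)// -sqrtr_sqr exprVn ler_wsqrtr.
rewrite sqrtr_gt0; apply: lt_le_trans xn.
by rewrite invr_gt0 exprn_gt0.
Qed.

Lemma small_factor (R : realType) (a x : R) : 0 <= a -> 0 < x ->
  exists k : R, [/\ 0 < k, k <= 1 & k * a <= x].
Proof.
move=> a0 x0; have a1 : 0 < a + 1 by lra.
exists (Num.min 1 (x / (a + 1))); split.
- by rewrite lt_min ltr01 divr_gt0.
- by rewrite ge_min lexx.
apply: (@le_trans _ _ (x / (a + 1) * a)).
  by rewrite ler_wpM2r// ge_min lexx orbT.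
by rewrite mulrAC ler_pdivrMr// ler_wpM2l ?(ltW x0)//; lra.
Qed.

(** * Choice of the constants, with thresholds for [n] that serve every dimension *)

Section asymptotics.
Context d dS (T : measurableType d) (S : measurableType dS) (R : realType).
Context (P : probability T R) (X : nat -> {mfun T >-> S}).
Hypothesis indep : forall n, product_rule P n X.
Hypothesis ident : forall n, identically_distributed P n X.
Variables (zeta : S -> seqR R) (N : S -> R).
Hypothesis mzeta : measurable_fun setT zeta.
Hypothesis mN : measurable_fun setT N.
Hypothesis zetaN : forall m x, qn m (zeta x) <= N x.
Hypothesis IN : rintegrable P (fun t => N (X 0%N t)).
Hypothesis centred : forall j, \int[P]_t zeta (X 0%N t) j = 0.

Definition normalized_sum n : T -> seqR R :=
  psum X (fun x => sscale (invsqrt R n) (zeta x)) n.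

Definition smooth_tail n m (e s : R) : R :=
  \int[P]_t qstep m e s (normalized_sum n t).

Let sigma2 := \int[P]_t N (X 0%N t).
Let tail b := \int[P]_t above b (N (X 0%N t)).

Let N0 x : 0 <= N x. Proof. exact: le_trans (qn_ge0 0 _) (zetaN 0 x). Qed.
Let sigma20 : 0 <= sigma2. Proof. exact: Rintegral_ge0. Qed.

Section anticoncentration.
Variable j0 : nat.
Hypothesis s20 : 0 < \int[P]_t zeta (X 0%N t) j0 ^+ 2.

Let s2 := \int[P]_t zeta (X 0%N t) j0 ^+ 2.
Let W t := residual_part P (X 0%N) zeta j0 (X 0%N t).
Let u := direction P (X 0%N) zeta j0.
Let env x := envelope P (X 0%N) zeta N j0 x.

Let env0 x : 0 <= env x.
Proof.
apply: le_trans (qn_ge0 0 _)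
  (@qn_residual_le _ _ _ _ _ _ _ _ _ mzeta zetaN IN _ s20 0 1 x _).
by rewrite expr1n.
Qed.

(** At each of the two levels the observations are exchanged for signed residuals, hence the factor
    2. The difference of the two steps is at most 1 and vanishes off the shell from [s] to
    [s + 6 * e], to which the binomial bound applies. *)
Lemma smooth_tail_shell n m (e M C th s : R) : 0 < e -> 0 <= C ->
  qstep_remainder_le e M C ->
  (0 < n)%N -> (j0 < m)%N -> 0 < th -> th <= 1 -> s + 6 * e <= M ->
  smooth_tail n m e s - smooth_tail n m e (s + 3 * e) <=
  2 * (C * (th * sigma2 + tail (th ^+ 2 * n%:R)) +
       C * (th * \int[P]_t env (X 0%N t) +
         \int[P]_t above (th ^+ 2 * n%:R) (env (X 0%N t)))) +
  Num.sqrt (6 * e / s2) + 2 * invsqrt R n.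
Proof.
move=> e0 C0 taylor n0 jm th0 th1 sM.
set D := C * _ + C * _.
have r0 := invsqrt_gt0 R n0; have r2 := invsqrt_sqr R n0.
set r := invsqrt R n in r0 r2 *.
have mZ : measurable_fun setT (fun t => zeta (X 0%N t)) by exact: measurableT_comp.
have mW : measurable_fun setT W.
  exact: (measurableT_comp (measurable_residual_part P (X 0%N) mzeta j0)).
pose UZ := avg P (fun t => sscale r (zeta (X 0%N t))).
pose UW := avg P (fun t => sscale r (W t)).
pose UR := rademacher (sscale r u).
pose UY f := UW (UR f).
have aZ : averaging UZ by apply: avg_averaging; exact: measurable_sscale.
have aW : averaging UW by apply: avg_averaging; exact: measurable_sscale.
have aR : averaging UR by exact: rademacher_averaging.
have aY : averaging UY by exact: comp_averaging.
have WR g : bounded_measurable g -> UW (UR g) = UR (UW g).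
  move=> bg; apply/funext => x; rewrite /UW /UR rademacher_avg_comm//.
  exact: measurable_sscale.
have ZW g : bounded_measurable g -> UZ (UW g) = UW (UZ g).
  by move=> bg; apply/funext => x; apply: avg_comm => //; exact: measurable_sscale.
have ZR g : bounded_measurable g -> UZ (UR g) = UR (UZ g).
  move=> bg; apply/funext => x; rewrite /UZ /UR rademacher_avg_comm//.
  exact: measurable_sscale.
have ZY g : bounded_measurable g -> UZ (UY g) = UY (UZ g).
  by move=> bg; rewrite /UY ZW ?ZR//; exact: averaging_bm.
have HE q : smooth_tail n m e q = iter n UZ (qstep m e q) (szero R).
  have mxi : measurable_fun setT (fun x => sscale r (zeta x)) by exact: measurable_sscale.
  rewrite /UZ -(integral_psum mxi (@indep n) (@ident n))//; last first.
    exact: bounded_measurable_qstep.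
  by apply: eq_Rintegral => t _; rewrite saddC saddx0.
have close q : q + 3 * e <= M ->
    `|iter n UZ (qstep m e q) (szero R) - iter n UY (qstep m e q) (szero R)| <= D.
  move=> qM.
  have b : bounded_measurable (qstep m e q) by exact: bounded_measurable_qstep.
  have D1 x : `|UZ (qstep m e q) x - UY (qstep m e q) x| <= r ^+ 2 * D.
    have := smoothing_taylor mzeta zetaN IN centred s20 m e0 C0 taylor th0 th1 r0 x qM.
    by rewrite div_invsqrt_sqr.
  have := iter_averaging_dist n aZ aY ZY b D1 (szero R).
  by rewrite mulrA [n%:R * _]mulrC r2 mul1r.
have c1 := close s _; have c2 := close (s + 3 * e) _.
pose f x := qstep m e s x - qstep m e (s + 3 * e) x.
have b1 := bounded_measurable_qstep m e s.
have b2 := bounded_measurable_qstep m e (s + 3 * e).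
have bf : bounded_measurable f by exact: bounded_measurableB.
have shell : iter n UY f (szero R) <= Num.sqrt (6 * e / s2) + 2 * r.
  (* Commutation collects all signs innermost; their bound holds at every point, so averaging over
     the residual parts keeps it. *)
  rewrite (iter_comp n aW aR WR bf).
  have bRf : bounded_measurable (iter n UR f).
    by apply: averaging_bm => //; exact: iter_averaging.
  apply: iter_avg_ub => // [|x]; first exact: measurable_sscale.
  have us : s2 <= qn m u by exact: qn_direction_ge.
  have u0 : 0 < qn m u by exact: lt_le_trans us.
  have := @iter_rademacher_shell R m u f s (s + 6 * e) r n x r0 r2 u0 _ _ _.
  have -> : s + 6 * e - s = 6 * e by ring.
  move=> h; apply: le_trans (h _ _ _) _.
  - by rewrite lerDl mulr_ge0// ltW.
  - move=> y; have /andP[? ?] := qstep_itv m e s y.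
    by have /andP[? ?] := qstep_itv m e (s + 3 * e) y; rewrite /f; lra.
  - move=> y; rewrite negb_and -!ltNge => /orP[h1|h1]; rewrite /f /qstep.
      rewrite !step_eq0 ?subrr//.
        by rewrite ler_pdivrMr//; lra.
      by rewrite ler_pdivrMr//; lra.
    rewrite !step_eq1 ?subrr//.
      by rewrite ler_pdivlMr//; lra.
    by rewrite ler_pdivlMr//; lra.
  rewrite lerD2r ler_wsqrtr// ler_wpM2l ?mulr_ge0 ?(ltW e0)//.
  by rewrite lef_pV2.
have UYB : iter n UY f (szero R) =
    iter n UY (qstep m e s) (szero R) - iter n UY (qstep m e (s + 3 * e)) (szero R).
  by apply: averagingB => //; exact: iter_averaging.
rewrite !HE.
have {}c1 : `|iter n UZ (qstep m e s) (szero R) -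
    iter n UY (qstep m e s) (szero R)| <= D.
  by apply: c1; lra.
have {}c2 : `|iter n UZ (qstep m e (s + 3 * e)) (szero R) -
    iter n UY (qstep m e (s + 3 * e)) (szero R)| <= D.
  by apply: c2; lra.
rewrite UYB in shell.
move: c1 c2; rewrite !ler_norml => /andP[? ?] /andP[? ?]; lra.
Qed.

Lemma anticoncentration (e M eps : R) : 0 < e -> 0 <= M -> 0 < eps ->
  exists n0 : nat, forall n m s, (n0 <= n)%N -> (j0 < m)%N -> s + 6 * e <= M ->
  smooth_tail n m e s - smooth_tail n m e (s + 3 * e) <=
  Num.sqrt (6 * e / s2) + eps.
Proof.
move=> e0 M0 eps0; have [C C0 taylor] := qstep_taylor e0 M0.
set Ee := \int[P]_t env (X 0%N t).
have Ee0 : 0 <= Ee by apply: Rintegral_ge0.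
have [th [th0 th1 thC]] : exists k : R,
    [/\ 0 < k, k <= 1 & k * (C * (sigma2 + Ee)) <= eps / 8].
  by apply: small_factor; [rewrite mulr_ge0// addr_ge0|lra].
have [dl [dl0 _ dlC]] : exists k : R, [/\ 0 < k, k <= 1 & k * (2 * C) <= eps / 8].
  by apply: small_factor; [rewrite mulr_ge0|lra].
have [b1 b10 B1] := tail_vanishes IN (fun t => N0 _) dl0.
have [b2 b20 B2] := tail_vanishes (rintegrable_envelope zeta IN j0) (fun t => env0 _) dl0.
have th2 : 0 < th ^+ 2 by rewrite exprn_gt0.
(* The first term brings the truncation level [th ^+ 2 * n] beyond both [b1] and [b2], the second
   makes n^(-1/2) at most [eps / 4]. The remainders and the term [2 * invsqrt R n] then take half of
   [eps] each. *)
pose B := (b1 + b2) / th ^+ 2 + ((eps / 4) ^+ 2)^-1.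
have e4 : 0 < ((eps / 4) ^+ 2)^-1 by rewrite invr_gt0 exprn_gt0// divr_gt0.
have bt : 0 < (b1 + b2) / th ^+ 2 by rewrite divr_gt0// addr_gt0.
have B0 : 0 < B by rewrite addr_gt0.
exists (Num.bound B) => n m s nB jm sM.
have Bn : B <= n%:R.
  by rewrite (le_trans (ltW (archi_boundP (ltW B0))))// ler_nat.
have n0 : (0 < n)%N by rewrite -(ltr_nat R) (lt_le_trans B0).
have bn : b1 + b2 <= th ^+ 2 * n%:R.
  by rewrite mulrC -ler_pdivrMr//; move: Bn; rewrite /B; lra.
apply: le_trans (smooth_tail_shell e0 C0 taylor n0 jm th0 th1 sM) _.
have r1 : invsqrt R n <= eps / 4.
  by apply: invsqrt_le; [rewrite divr_gt0|move: Bn; rewrite /B; lra].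
have T1 : tail (th ^+ 2 * n%:R) <= dl by apply: B1; lra.
have T2 : \int[P]_t above (th ^+ 2 * n%:R) (env (X 0%N t)) <= dl by apply: B2; lra.
have CT1 := ler_wpM2l C0 T1; have CT2 := ler_wpM2l C0 T2.
rewrite -/Ee; lra.
Qed.

End anticoncentration.

Lemma bootstrap_consistent dO (OmegaS : measurableType dO)
    (PS : probability OmegaS R) (K : nat -> nat -> {mfun OmegaS >-> nat})
    (e M eps : R) :
  (forall n, product_rule PS n (K n)) ->
  (forall n k j, (k < n)%N -> (j < n)%N ->
    PS (K n k @^-1` [set j]) = (n%:R^-1)%:E) ->
  0 < e -> 0 <= M -> 0 < eps ->
  exists n0 : nat, forall n m, (n0 <= n)%N -> (0 < n)%N /\
    exists Rn : T -> R, [/\ rintegrable P Rn, \int[P]_t Rn t <= eps &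
      forall t s, s + 3 * e <= M ->
      `|\int[PS]_w qstep m e s (psum (K n)
          (fun i => sscale (invsqrt R n) (residual n X zeta t i)) n w) -
        smooth_tail n m e s| <= Rn t].
Proof.
move=> Kindep Kunif e0 M0 eps0; have [C C0 taylor] := qstep_taylor e0 M0.
set A := 36 / e + 2 * (24 * M / e ^+ 2).
have A0 : 0 <= A.
  by rewrite addr_ge0// ?mulr_ge0 ?invr_ge0 ?exprn_ge0// ltW.
(* [dl] serves both as [th] and as [l]. The remainders amount to at most [2 * sigma2 + 10] and
   [sigma2 + 1] times [dl], the covariance error to [5 * dl]. *)
have [dl [dl0 dl1 dlC]] : exists k : R, [/\ 0 < k, k <= 1 &
    k * (C * (3 * sigma2 + 11) + 5 * A) <= eps].
  by apply: small_factor => //; rewrite addr_ge0// mulr_ge0// addr_ge0// mulr_ge0.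
have [b0 b00 B0] := tail_vanishes IN (fun t => N0 _) dl0.
have dl2 : 0 < dl ^+ 2 by rewrite exprn_gt0.
(* The summands control, in this order, the truncation level, sigma2 / n and the variance of the
   truncated products. *)
pose B := 4 * b0 / dl ^+ 2 + sigma2 / dl + 2 * b0 ^+ 2 / (dl * dl).
have p1 : 0 < 4 * b0 / dl ^+ 2 by rewrite divr_gt0// mulr_gt0.
have p2 : 0 <= sigma2 / dl by rewrite divr_ge0// ltW.
have p3 : 0 <= 2 * b0 ^+ 2 / (dl * dl).
  by rewrite divr_ge0 ?mulr_ge0 ?sqr_ge0// ltW.
have Bp : 0 < B by rewrite /B; lra.
exists (Num.bound B) => n m nB.
have Bn : B <= n%:R.
  by rewrite (le_trans (ltW (archi_boundP (ltW Bp))))// ler_nat.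
have nR : 0 < n%:R :> R by exact: lt_le_trans Bn.
have n0 : (0 < n)%N by rewrite -(ltr_nat R).
split=> //.
have [Rn [IR ER HR]] := bootstrap_transfer (@indep n) (@ident n) n0 (Kindep n)
  (Kunif n) mzeta mN zetaN IN centred m e0 M0 C0 taylor dl0 dl1 dl0 (ltW b00)
  (invsqrt_gt0 R n0) (invsqrt_sqr R n0).
exists Rn; split=> //; apply: le_trans ER _.
rewrite -/sigma2 -/A -/(tail _) -/(tail _) -/(tail b0).
have q1 : n%:R^-1 * sigma2 <= dl.
  rewrite mulrC ler_pdivrMr// mulrC -ler_pdivrMr//; move: Bn; rewrite /B; lra.
have q2 : 2 * b0 ^+ 2 / (n%:R * dl) <= dl.
  have h : 2 * b0 ^+ 2 / (dl * dl) <= n%:R.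
    by apply: le_trans Bn; rewrite /B lerDr addr_ge0// ltW.
  rewrite ler_pdivrMr ?mulr_gt0// [dl * _]mulrCA.
  by rewrite ler_pdivrMr ?mulr_gt0// in h.
have q3 : 4 * b0 <= dl ^+ 2 * n%:R.
  rewrite [leRHS]mulrC -ler_pdivrMr//; apply: le_trans Bn.
  by rewrite /B -addrA lerDl addr_ge0.
have t1 : tail (dl ^+ 2 * n%:R / 4) <= dl by apply: B0; lra.
have t2 : tail (dl ^+ 2 * n%:R) <= dl by apply: B0; lra.
have t3 : tail b0 <= dl by exact: B0.
apply: le_trans dlC.
have dd : dl * (n%:R^-1 * sigma2) <= dl by rewrite ler_piMr ?(ltW dl0)//; lra.
have k1 : dl * (2 * sigma2 + 2 * (n%:R^-1 * sigma2)) + 4 * tail (dl ^+ 2 * n%:R / 4) +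
    4 * (n%:R^-1 * sigma2) <= dl * (2 * sigma2 + 10) by lra.
have k2 : dl * sigma2 + tail (dl ^+ 2 * n%:R) <= dl * (sigma2 + 1) by lra.
have k3 : dl + 2 * b0 ^+ 2 / (n%:R * dl) + 2 * tail b0 + n%:R^-1 * sigma2 <= 5 * dl.
  by lra.
have := ler_wpM2l C0 k1; have := ler_wpM2l C0 k2; have := ler_wpM2l A0 k3; lra.
Qed.

End asymptotics.

(** * Critical values *)

Lemma Rintegral_indic d (T : measurableType d) (R : realType)
    (P : probability T R) (A : set T) : measurable A ->
  \int[P]_t (\1_A t : R) = fine (P A).
Proof. by move=> mA; rewrite /Rintegral integral_indic// setIT. Qed.

Lemma rintegrable_indic d (T : measurableType d) (R : realType)
    (P : probability T R) (A : set T) : measurable A ->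
  rintegrable P (fun t => \1_A t : R).
Proof. by move=> mA; exact: integrable_indic. Qed.

Section critical_value.
Context d (T : measurableType d) (R : realType) (P : probability T R).
Variable W : {RV P >-> R}.
Hypothesis W0 : forall t, 0 <= W t.
Variable alpha : R.
Hypotheses (alpha0 : 0 < alpha) (alpha1 : alpha < 1).

Let G (x : R) : R := fine (cdf W x).
Let S : set R := [set x | 1 - alpha <= G x].

Let mle x : measurable [set t | W t <= x].
Proof.
rewrite (_ : [set t | W t <= x] = W @^-1` `]-oo, x]); first exact: measurable_funPTI.
by apply/seteqP; split=> t /=; rewrite in_itv.
Qed.

Let GE x : G x = fine (P [set t | W t <= x]).
Proof.
by rewrite /G /cdf /distribution/= /pushforward; congr (fine (P _)).
Qed.

Let Gmono x y : x <= y -> G x <= G y.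
Proof.
move=> xy; rewrite !GE fine_le ?fin_num_measure//.
apply: le_measure; [exact: mem_set|exact: mem_set|].
by move=> t /= h; exact: le_trans xy.
Qed.

Let S0 : S !=set0.
Proof.
have h := @cvg_cdfy1 _ _ _ P W.
have h1 : fine (cdf W r) @[r --> +oo%R] --> (1 : R).
  exact: (fine_cvg h).
have h2 : (1 - alpha < 1 :> R) by rewrite gtrBl.
have [r [_ hr]] := cvgr_gt _ h1 _ h2.
by exists (r + 1); apply: ltW; apply: hr; rewrite ltrDl.
Qed.

Let lbS : has_lbound S.
Proof.
exists 0 => x Sx; rewrite leNgt; apply/negP => x0; move: Sx; rewrite /S /= GE.
rewrite (_ : [set t | W t <= x] = set0) ?measure0 /=.
  by rewrite subr_le0 leNgt alpha1.
by apply/seteqP; split=> // t /= h; have := W0 t; lra.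
Qed.

(** Only the infimum property is used: the existential over [y] makes right continuity of [G] and
    attainment unnecessary. *)
Lemma quantile_lt (x : R) : quantile G (1 - alpha) < x <->
  exists2 y, y < x & 1 - alpha <= G y.
Proof.
split=> [/(inf_lt S0)[y Sy yx]|[y yx Sy]]; first by exists y.
by apply: le_lt_trans yx; exact: ge_inf.
Qed.

Lemma quantile_gt (x : R) : x < quantile G (1 - alpha) -> G x < 1 - alpha.
Proof.
move=> xq; rewrite ltNge; apply/negP => Sx.
by move: xq; rewrite ltNge => /negP; apply; exact: ge_inf.
Qed.

Let gtE x : \int[P]_t (\1_[set t | x < W t] t : R) = 1 - G x.
Proof.
have -> : [set t | x < W t] = ~` [set t | W t <= x].
  by apply/seteqP; split=> t /=; rewrite ltNge => /negP.
rewrite Rintegral_indic; last exact: measurableC.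
by rewrite GE probability_setC// fineB// fin_num_measure.
Qed.

Let mgt x : measurable [set t | x < W t].
Proof.
have -> : [set t | x < W t] = ~` [set t | W t <= x].
  by apply/seteqP; split=> t /=; rewrite ltNge => /negP.
exact: measurableC.
Qed.

Let Istep e x : rintegrable P (fun t => step ((W t - x) / e)).
Proof.
apply: (@bounded_integrable _ _ _ _ _ 1).
  have h : measurable_fun setT (fun t => (W t - x) / e).
    by apply: measurable_funM => //; exact: measurable_funB.
  exact: (measurableT_comp (@measurable_step R) h).
by move=> t; have /andP[? ?] := step_itv ((W t - x) / e); rewrite ger0_norm.
Qed.

(** The smoothed indicator at [x] lies between those of the half-lines beyond [x + 3 * e] and beyond
    [x]; the upper comparison serves here, the lower one in the companion lemma. *)
Lemma smooth_tail_quantile_lt (e x : R) : 0 < e ->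
  quantile G (1 - alpha) < x -> \int[P]_t step ((W t - x) / e) <= alpha.
Proof.
move=> e0 /quantile_lt[y yx Sy].
have h : 1 - alpha <= G x by apply: le_trans Sy (Gmono (ltW yx)).
apply: (@le_trans _ _ (1 - G x)); last lra.
rewrite -gtE; apply: le_Rint => //; first exact: rintegrable_indic.
move=> t; rewrite indicE; case: (ltP x (W t)) => h'.
  by rewrite mem_set//; have /andP[] := step_itv ((W t - x) / e).
by rewrite step_eq0// ler_pdivrMr//; lra.
Qed.

Lemma smooth_tail_quantile_gt (e x : R) : 0 < e ->
  x + 3 * e < quantile G (1 - alpha) -> alpha < \int[P]_t step ((W t - x) / e).
Proof.
move=> e0 /quantile_gt h.
apply: (@lt_le_trans _ _ (1 - G (x + 3 * e))); first lra.
rewrite -gtE; apply: le_Rint => //; first exact: rintegrable_indic.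
move=> t; rewrite indicE; case: (ltP (x + 3 * e) (W t)) => h'.
  by rewrite mem_set// step_eq1// ler_pdivlMr//; lra.
rewrite memNset; last by move=> /=; rewrite ltNge h'.
by have /andP[] := step_itv ((W t - x) / e).
Qed.

End critical_value.

Section rejection_probability.
Context d (T : measurableType d) (R : realType) (P : probability T R).
Variables (V : T -> R) (e : R).
Hypothesis mV : measurable_fun setT V.
Hypothesis V0 : forall t, 0 <= V t.
Hypothesis e0 : 0 < e.

Let H (s : R) : R := \int[P]_t step ((V t - s) / e).

Lemma rintegrable_step s : rintegrable P (fun t => step ((V t - s) / e)).
Proof.
apply: (@bounded_integrable _ _ _ _ _ 1).
  have h : measurable_fun setT (fun t => (V t - s) / e).
    by apply: measurable_funM => //; exact: measurable_funB.
  exact: (measurableT_comp (@measurable_step R) h).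
by move=> t; have /andP[? ?] := step_itv ((V t - s) / e); rewrite ger0_norm.
Qed.

(** Inherited from the Lipschitz bound for [step]. An exact tail function may jump, whereas this one
    attains every level needed by the intermediate value theorem. *)
Lemma smooth_tail_continuous : continuous H.
Proof.
move=> s; apply/cvgrPdist_le => /= eps eps0.
near=> x.
have xe : `|s - x| <= e by near: x; apply: cvgr_dist_le => //; exact: cvg_id.
have xs : `|s - x| <= eps * e / 50.
  near: x; apply: cvgr_dist_le; last by rewrite !mulr_gt0// invr_gt0.
  exact: cvg_id.
rewrite /H -RintegralB//; [|exact: rintegrable_step..].
apply: norm_Rintegral_le => [|t].
  by apply: measurable_funB; exact: rintegrable_measurable (rintegrable_step _).
have -> : (V t - s) / e = (V t - x) / e + (x - s) / e by field; rewrite lt0r_neq0.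
have ne : `|(x - s) / e| = `|s - x| / e.
  by rewrite normrM distrC normfV (gtr0_norm e0).
apply: le_trans (step_lipschitz _ _) _; rewrite ne ?ler_pdivrMr ?mul1r//.
by rewrite mulrA ler_pdivrMr//; lra.
Unshelve. all: by end_near.
Qed.

Lemma smooth_tail_eq1 s : s + 3 * e <= 0 -> H s = 1.
Proof.
move=> se; rewrite -[RHS](Rintegral_prob_cst P); apply: eq_Rintegral => t _.
by rewrite step_eq1// ler_pdivlMr//; have := V0 t; lra.
Qed.

Lemma smooth_tail_markov s : 0 < s -> rintegrable P V -> H s <= (\int[P]_t V t) / s.
Proof.
move=> s0 IV; rewrite mulrC -RintegralZl//; apply: le_Rint.
- exact: rintegrable_step.
- exact: rintegrableZ.
move=> t; rewrite [leRHS]mulrC; have [Vs|Vs] := leP (V t) s.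
  rewrite step_eq0; first by rewrite divr_ge0// ltW.
  by rewrite ler_pdivrMr//; lra.
apply: (@le_trans _ _ 1); first by have /andP[] := step_itv ((V t - s) / e).
by rewrite ler_pdivlMr// mul1r ltW.
Qed.

(** Intermediate values between [- (3 * e)], where nonnegativity of [V] gives 1, and [s2 / v], where
    Markov's inequality gives at most [v]. The bound on [s] depends on the law only through its
    mean. *)
Lemma smooth_tail_level (s2 v : R) : 0 < v -> v <= 1 -> rintegrable P V ->
  0 < s2 -> \int[P]_t V t <= s2 -> exists2 s, s <= s2 / v & H s = v.
Proof.
move=> v0 v1 IV s20 Vs2.
have sv : 0 < s2 / v by rewrite divr_gt0.
have ab : - (3 * e) <= s2 / v.
  by apply: le_trans (ltW sv); rewrite oppr_le0 mulr_ge0// ltW.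
have H1 : H (- (3 * e)) = 1 by apply: smooth_tail_eq1; lra.
have H2 : H (s2 / v) <= v.
  apply: le_trans (smooth_tail_markov sv IV) _.
  by rewrite ler_pdivrMr// mulrC divfK// lt0r_neq0.
have [|s] := @IVT R H _ _ v ab (continuous_subspaceT smooth_tail_continuous).
  by rewrite H1 ge_min le_max H2 v1 orbT.
by rewrite in_itv /= => /andP[_ ss] Hs; exists s.
Qed.

Variables (dstar : T -> R) (Hs : T -> R -> R) (Rn : T -> R).
Variables (alpha kappa delta eta t0 : R).
Hypothesis mE : measurable [set t | dstar t < V t].
Hypothesis IR : rintegrable P Rn.
Hypothesis ER : \int[P]_t Rn t <= eta.
Hypothesis kappa0 : 0 < kappa.
Hypothesis HsR : forall t, `|Hs t t0 - H t0| <= Rn t.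

Let Rn0 t : 0 <= Rn t. Proof. exact: le_trans (HsR t). Qed.

Let IRk : rintegrable P (fun t => kappa^-1 * Rn t).
Proof. exact: rintegrableZ. Qed.

Let ERk : \int[P]_t (kappa^-1 * Rn t) <= kappa^-1 * eta.
Proof. by rewrite RintegralZl// ler_wpM2l// invr_ge0 ltW. Qed.

Let Rk1 t : kappa <= Rn t -> 1 <= kappa^-1 * Rn t.
Proof. by move=> h; rewrite mulrC ler_pdivlMr// mul1r. Qed.

Let Rk0 t : 0 <= kappa^-1 * Rn t.
Proof. by rewrite mulr_ge0// invr_ge0 ltW. Qed.

(** A rejection has either V > t0, where the step at [t0 - 3 * e] is 1, or a critical value below
    [t0]. The latter forces the bootstrap tail at [t0] down to alpha, an error of at least kappa,
    which Markov's inequality makes rare. *)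
Lemma rejection_upper : H t0 = alpha + kappa ->
  (forall t, dstar t < t0 -> Hs t t0 <= alpha) ->
  H (t0 - 3 * e) - H t0 <= delta ->
  fine (P [set t | dstar t < V t]) <= alpha + kappa + delta + kappa^-1 * eta.
Proof.
move=> Ht lo dl; rewrite -Rintegral_indic//.
apply: (@le_trans _ _ (H (t0 - 3 * e) + \int[P]_t (kappa^-1 * Rn t))); last first.
  by have := ERk; lra.
rewrite /H -RintegralD//; [|exact: rintegrable_step].
apply: le_Rint; first exact: rintegrable_indic.
  by apply: rintegrableD => //; exact: rintegrable_step.
move=> t; have /andP[st0 st1] := step_itv ((V t - (t0 - 3 * e)) / e).
rewrite indicE; have [dV|dV] := ltP (dstar t) (V t); last first.
  rewrite memNset; last by move=> /=; rewrite ltNge dV.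
  exact: addr_ge0.
rewrite mem_set//=; have [Vt|Vt] := leP (V t) t0; last first.
  by rewrite step_eq1 ?lerDl// ler_pdivlMr//; lra.
have k : kappa <= Rn t.
  apply: le_trans (HsR t); rewrite distrC; apply: le_trans (ler_norm _).
  by have := lo t (lt_le_trans dV Vt); lra.
by have := Rk1 k; lra.
Qed.

(** If V > t0 + 3e without rejection, the critical value exceeds [t0 + 3 * e] too, and the bootstrap
    tail at [t0] is off by at least kappa. *)
Lemma rejection_lower : H t0 = alpha - kappa ->
  (forall t, t0 + 3 * e < dstar t -> alpha < Hs t t0) ->
  H t0 - H (t0 + 3 * e) <= delta ->
  alpha - kappa - delta - kappa^-1 * eta <= fine (P [set t | dstar t < V t]).
Proof.
move=> Ht hi dl; rewrite -Rintegral_indic//.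
suff : H (t0 + 3 * e) <= \int[P]_t (\1_[set t | dstar t < V t] t : R) +
    \int[P]_t (kappa^-1 * Rn t) by have := ERk; lra.
rewrite -RintegralD//; last exact: rintegrable_indic.
apply: le_Rint; first exact: rintegrable_step.
  by apply: rintegrableD => //; exact: rintegrable_indic.
move=> t; have /andP[st0 st1] := step_itv ((V t - (t0 + 3 * e)) / e).
rewrite indicE; have [dV|dV] := ltP (dstar t) (V t).
  by rewrite mem_set//=; have := Rk0 t; lra.
rewrite memNset; last by move=> /=; rewrite ltNge dV.
rewrite add0r; have [Vt|Vt] := leP (V t) (t0 + 3 * e).
  by rewrite step_eq0// ler_pdivrMr//; lra.
apply: le_trans st1 (Rk1 _).
apply: le_trans (HsR t); apply: le_trans (ler_norm _).
by have := hi t (lt_le_trans Vt dV); lra.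
Qed.

End rejection_probability.

(** * The sequence space and the theorem *)

Section l2_facts.
Context (R : realType).
Implicit Types z h : l2 R.

Lemma l2_normE z : `|z| = l2norm z. Proof. by []. Qed.

Lemma qn_le_l2 m z : qn m (z : nat -> R) <= `|z| ^+ 2.
Proof.
rewrite l2_normE sqr_l2norm.
have cz := square_summableM (l2valP z) (l2valP z).
apply: le_trans (nondecreasing_cvgn_le _ cz m); last first.
  by apply: nondecreasing_series => i _ _; rewrite -expr2 sqr_ge0.
by rewrite /series/= big_mkord /qn; apply: ler_sum => j _; rewrite expr2.
Qed.

Lemma l2_coord_le j z : `|z j| <= `|z|.
Proof.
rewrite -(@ler_pXn2r _ 2)// ?nnegrE// real_normK ?num_real//.
exact: le_trans (sqr_coord_le_qn z j) (qn_le_l2 j.+1 z).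
Qed.

Lemma l2_coord_continuous j : continuous (fun z => z j).
Proof.
move=> z; apply/(@cvgrPdist_lt _ _ _ (nbhs z) (nbhs_filter z)) => /= eps eps0.
apply/nbhs_ballP; exists eps => //= y; rewrite -ball_normE /= => zy.
exact: le_lt_trans (l2_coord_le j (z - y)) zy.
Qed.

Lemma l2_continuous_measurable (f : l2 R -> R) :
  continuous f -> measurable_fun setT f.
Proof.
move=> cf; apply: (measurability _ (RGenOInfty.measurableE R)).
move=> _ [_ [x ->] <-]; rewrite setTI; apply: sub_sigma_algebra.
by apply: open_comp => //; exact: interval_open.
Qed.

Lemma measurable_l2_coord j : measurable_fun setT (fun z => z j).
Proof. exact: l2_continuous_measurable (@l2_coord_continuous j). Qed.

Lemma measurable_l2_norm : measurable_fun setT (fun z => `|z|).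
Proof. apply: l2_continuous_measurable; exact: norm_continuous. Qed.

Lemma l2_basis_square_summable j :
  (fun k => (k == j)%:R : R) \in @square_summable R.
Proof.
apply/square_summableP; apply/cvg_ex; exists 1.
apply: cvg_near_cst; near=> n.
have jn : (j < n)%N by near: n; exact: nbhs_infty_gt.
rewrite /series /= big_mkord (bigD1 (Ordinal jn))//= eqxx expr1n big1 ?addr0//.
by move=> k; rewrite -val_eqE /= => /negbTE ->; rewrite expr0n.
Unshelve. all: by end_near.
Qed.

Definition l2_basis j : l2 R := L2 (l2_basis_square_summable j).

Lemma l2dot_basis z j : l2dot z (l2_basis j) = z j.
Proof.
apply: lim_near_cst => //; near=> n.
have jn : (j < n)%N by near: n; exact: nbhs_infty_gt.
rewrite /series /= big_mkord (bigD1 (Ordinal jn))//= eqxx mulr1 big1 ?addr0//.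
by move=> k; rewrite -val_eqE /= => /negbTE ->; rewrite mulr0.
Unshelve. all: by end_near.
Qed.

End l2_facts.

Lemma mutually_independent_product_rule d d' (T : measurableType d)
    (S : measurableType d') (R : realType) (P : probability T R) n
    (X : nat -> {mfun T >-> S}) :
  mutually_independent P (fun (i : 'I_n) t => X i t) -> product_rule P n X.
Proof.
move=> mi B mB; pose J : {fset 'I_n} := [fset i | i in 'I_n]%fset.
have := mi J (fun i => B i) (fun i _ => mB i).
have -> : \bigcap_(i in [set` J]) ((fun t => X i t) @^-1` B i) =
    \bigcap_(i < n) (X i @^-1` B i).
  apply/seteqP; split=> t h i /=.
    by move=> ltin; apply: (h (Ordinal ltin)); rewrite /= !inE.
  by move=> _; exact: (h i (ltn_ord i)).
move=> ->; rewrite (perm_big (index_enum 'I_n))//=.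
apply: uniq_perm; [exact: fset_uniq|exact: index_enum_uniq|].
by move=> i; rewrite mem_index_enum; apply/imfsetP; exists i.
Qed.

Lemma mutually_independent_ord d d' (T : measurableType d)
    (S : measurableType d') (R : realType) (P : probability T R) n
    (X : nat -> T -> S) :
  mutually_independent P X -> mutually_independent P (fun (i : 'I_n) t => X i t).
Proof.
move=> mi J B mB.
pose J' : {fset nat} := [fset val i | i in J]%fset.
pose B' k := if insub k is Some i then B i else setT.
have B'E (i : 'I_n) : B' (val i) = B i by rewrite /B' valK.
have mB' k : k \in J' -> measurable (B' k).
  by move=> /imfsetP[i /= iJ ->]; rewrite B'E; exact: mB.
have := mi J' B' mB'.
have -> : \bigcap_(i in [set` J']) (X i @^-1` B' i) =
    \bigcap_(i in [set` J]) ((fun t => X i t) @^-1` B i).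
  apply/seteqP; split=> t h i /= iJ.
    rewrite -B'E; apply: (h (val i)) => /=.
    by apply/imfsetP; exists i.
  move/imfsetP: iJ => [k /= kJ ->]; rewrite B'E; exact: (h k kJ).
move=> ->; rewrite (perm_big [seq val i | i <- enum_fset J]).
  by rewrite big_map; apply: eq_bigr => i _; rewrite B'E.
apply: uniq_perm; first exact: fset_uniq.
  by rewrite map_inj_uniq ?fset_uniq//; exact: val_inj.
move=> k; apply/imfsetP/mapP => -[i iJ ->]; by exists i.
Qed.

(** Joint measurability of an observation picked by a random index, by a countable union over the
    index. *)
Lemma measurable_fun_nat_pair d d' (T : measurableType d) (U : measurableType d')
    (g : nat -> T -> U) : (forall i, measurable_fun setT (g i)) ->
  measurable_fun setT (fun z : nat * T => g z.1 z.2).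
Proof.
move=> mg _ B mB; rewrite setTI.
have -> : (fun z : nat * T => g z.1 z.2) @^-1` B =
    \bigcup_i ([set i] `*` (g i @^-1` B)).
  apply/seteqP; split=> [[i t] /= Bt|[i t] /= [k _ [/= -> Bt]]//].
  by exists i.
apply: bigcup_measurable => i _; apply: measurableX => //.
by rewrite -[X in measurable X]setTI; exact: mg.
Qed.

Section statistics.
Context dO dS (Omega : measurableType dO) (OmegaS : measurableType dS)
  (R : realType) (P : probability Omega R) (PS : probability OmegaS R).
Context (Z : nat -> {RV P >-> l2 R}) (m n : nat) (K : nat -> {RV PS >-> nat}).
Hypothesis n0 : (0 < n)%N.

Definition l2_seq (z : l2 R) : seqR R := l2val z.

Lemma measurable_l2_seq : measurable_fun setT l2_seq.
Proof. by apply: measurable_fun_seqP => j; exact: measurable_l2_coord. Qed.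

Let x w i : 'rV[R]_m := truncation m (Z i w).
Let r := invsqrt R n.

Let nn : n%:R != 0 :> R. Proof. by rewrite pnatr_eq0 -lt0n. Qed.

Let rr a : n%:R * (n%:R^-1 * a) ^+ 2 = (r * a) ^+ 2 :> R.
Proof.
have r2 : r ^+ 2 = n%:R^-1.
  by apply: (mulIf nn); rewrite invsqrt_sqr// mulVf.
by rewrite !exprMn r2 expr2 !mulrA mulfV// mul1r.
Qed.

Let euclidE (y : 'rV[R]_m) : euclid_norm y ^+ 2 = \sum_(j < m) y ord0 j ^+ 2.
Proof. by rewrite sqr_sqrtr//; apply: sumr_ge0 => j _; exact: sqr_ge0. Qed.

Lemma sample_mean_smean w j : sample_mean n (x w) ord0 j = smean n Z l2_seq w j.
Proof.
rewrite mxE summxE /smean /empirical; congr (_ * _).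
by apply: eq_bigr => i _; rewrite mxE.
Qed.

Lemma test_stat_smean w :
  test_stat n (x w) = n%:R * qn m (smean n Z l2_seq w).
Proof.
rewrite /test_stat euclidE; congr (_ * _); apply: eq_bigr => j _.
by rewrite sample_mean_smean.
Qed.

Lemma test_stat_normalized_sum w :
  test_stat n (x w) = qn m (normalized_sum Z l2_seq n w).
Proof.
rewrite test_stat_smean /qn mulr_sumr; apply: eq_bigr => j _.
by rewrite /smean /empirical rr /normalized_sum /psum -mulr_sumr.
Qed.

Lemma bootstrap_stat_psum w v : bootstrap_stat n (x w) K v =
  qn m (psum K (fun i => sscale r (residual n Z l2_seq w i)) n v).
Proof.
rewrite /bootstrap_stat euclidE /qn mulr_sumr; apply: eq_bigr => j _.
rewrite mxE summxE rr /psum -mulr_sumr; congr ((_ * _) ^+ 2).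
apply: eq_bigr => k _; rewrite /bootstrap_obs !mxE summxE.
rewrite /residual /sadd /sscale mulN1r; congr (_ - _).
by rewrite /smean /empirical; congr (_ * _); apply: eq_bigr => i _; rewrite mxE.
Qed.

Lemma measurable_smean : measurable_fun setT (smean n Z l2_seq).
Proof.
apply: measurable_fun_seqP => j; apply: measurable_funM => //.
apply: measurable_sum => i.
exact: (measurableT_comp (measurable_l2_coord j)).
Qed.

Lemma measurable_test_stat : measurable_fun setT (fun w => test_stat n (x w)).
Proof.
under eq_fun do rewrite test_stat_smean.
by apply: measurable_funM => //; apply: measurable_qn; exact: measurable_smean.
Qed.

Lemma measurable_bootstrap_stat_pair :
  measurable_fun setT (fun z : Omega * OmegaS => bootstrap_stat n (x z.1) K z.2).
Proof.
under eq_fun do rewrite bootstrap_stat_psum.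
apply: (@measurable_qn _ _ _ _ (fun z : Omega * OmegaS =>
  psum K (fun i => sscale r (residual n Z l2_seq z.1 i)) n z.2)).
apply: measurable_fun_seqP => j; apply: measurable_sum => k.
apply: measurable_funM => //; apply: measurable_funD.
  have mg i : measurable_fun setT (fun w => Z i w j).
    exact: (measurableT_comp (measurable_l2_coord j)).
  have mK : measurable_fun setT (fun z : Omega * OmegaS => (K k z.2, z.1)).
    by apply: measurable_fun_pair => //; exact: measurableT_comp.
  exact: (measurableT_comp (measurable_fun_nat_pair mg) mK).
apply: measurable_funM => //.
apply: (@measurable_fun_coord _ _ _ (fun z : Omega * OmegaS => smean n Z l2_seq z.1)).
exact: (measurableT_comp measurable_smean).
Qed.

Lemma bootstrap_stat_ge0 w v : 0 <= bootstrap_stat n (x w) K v.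
Proof. by rewrite bootstrap_stat_psum qn_ge0. Qed.

Lemma test_stat_ge0 w : 0 <= test_stat n (x w).
Proof. by rewrite test_stat_normalized_sum qn_ge0. Qed.

(** The critical value is below [V] exactly if some rational below [V] has bootstrap distribution
    function at least [1 - alpha]. At a fixed rational this function of the data is the measure of a
    section of a jointly measurable set. *)
Lemma measurable_rejection alpha : 0 < alpha -> alpha < 1 ->
  measurable [set w | bootstrap_critical n (x w) K alpha < test_stat n (x w)].
Proof.
move=> a0 a1.
pose G w (q : R) : R := bootstrap_cdf n (x w) K q.
have -> : [set w | bootstrap_critical n (x w) K alpha < test_stat n (x w)] =
    \bigcup_(q : rat) ([set w | ratr q < test_stat n (x w)] `&`
      [set w | 1 - alpha <= G w (ratr q)]).
  apply/seteqP; split=> w /=.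
    move=> /(quantile_lt (bootstrap_stat_ge0 w) a0 a1)[y yV Gy].
    have [q] := rat_in_itvoo yV; rewrite in_itv /= => /andP[yq qV].
    exists q => //; split=> //=; apply: le_trans Gy _.
    rewrite /G /bootstrap_cdf fine_le ?fin_num_measure//.
    by apply: cdf_nondecreasing; exact: ltW.
  move=> [q _ [/= qV Gq]].
  by apply/(quantile_lt (bootstrap_stat_ge0 w) a0 a1); exists (ratr q).
apply: bigcupT_measurable_rat => q; apply: measurableI.
  have -> : [set w | ratr q < test_stat n (x w)] =
      (fun w => test_stat n (x w)) @^-1` `]ratr q, +oo[.
    by apply/seteqP; split=> w /=; rewrite in_itv /= andbT.
  by rewrite -[X in measurable X]setTI; exact: measurable_test_stat.
pose A : set (Omega * OmegaS) :=
  (fun z => bootstrap_stat n (x z.1) K z.2) @^-1` `]-oo, ratr q].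
have mA : measurable A.
  by rewrite -[X in measurable X]setTI; exact: measurable_bootstrap_stat_pair.
have mG : measurable_fun setT (fun w => G w (ratr q)).
  have h : measurable_fun setT (fine \o (PS \o xsection A)).
    by apply: measurableT_comp => //; exact: measurable_fun_xsection.
  by apply: eq_measurable_fun h => w _ /=; rewrite xsectionE.
have -> : [set w | 1 - alpha <= G w (ratr q)] =
    (fun w => G w (ratr q)) @^-1` `[1 - alpha, +oo[.
  by apply/seteqP; split=> w /=; rewrite in_itv /= andbT.
by rewrite -[X in measurable X]setTI; exact: mG.
Qed.

End statistics.

Section l2_moments.
Context d (T : measurableType d) (R : realType) (P : probability T R).
Variable Z : {RV P >-> l2 R}.

Lemma l2_rintegrable_sqr_norm :
  ('E_P[fun w => (`|Z w| ^+ 2)%R] < +oo)%E -> rintegrable P (fun w => `|Z w| ^+ 2).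
Proof.
rewrite unlock => h; apply/integrableP; split.
  apply/measurable_EFinP; apply: measurable_funX.
  exact: (measurableT_comp (@measurable_l2_norm R)).
apply: le_lt_trans h; apply: ge0_le_integral => //=.
- do 2 apply: measurableT_comp => //; apply: measurable_funX.
  exact: (measurableT_comp (@measurable_l2_norm R)).
- by apply/measurable_EFinP; apply: measurable_funX;
    exact: (measurableT_comp (@measurable_l2_norm R)).
- by move=> w _; rewrite lee_fin ger0_norm ?sqr_ge0.
Qed.

Lemma l2_centred_coord j : l2_expectation P Z 0 -> \int[P]_w Z w j = 0.
Proof.
move=> [_ /(_ (l2_basis R j))]; rewrite unlock l2dot0l => h.
rewrite /Rintegral; under eq_integral do rewrite -(l2dot_basis _ j).
by rewrite h.
Qed.

(** Otherwise each coordinate vanishes almost surely, and so do all of them at once, being countably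
    many. *)
Lemma l2_nondegenerate_coord : rintegrable P (fun w => `|Z w| ^+ 2) ->
  ~ {ae P, forall w, Z w = 0} -> exists j, 0 < \int[P]_w Z w j ^+ 2.
Proof.
move=> IZ nd; apply: contrapT => /forallNP h; apply: nd.
have mZ j : measurable_fun setT (fun w => Z w j).
  exact: (measurableT_comp (@measurable_l2_coord R j)).
have ae0 j : {ae P, forall w, Z w j = 0}.
  have I2 : rintegrable P (fun w => Z w j ^+ 2).
    apply: rintegrable_le IZ _; first exact: measurable_funX.
    move=> w; rewrite ger0_norm ?sqr_ge0//.
    exact: le_trans (sqr_coord_le_qn (Z w) j) (qn_le_l2 j.+1 (Z w)).
  have z2 : \int[P]_w Z w j ^+ 2 = 0.
    apply/eqP; rewrite eq_le Rintegral_ge0 ?andbT => [|w _]; last exact: sqr_ge0.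
    by rewrite leNgt; apply/negP; exact: h.
  have : ae_eq P setT (fun w => (Z w j ^+ 2)%:E) (cst 0%E).
    apply/ae_eq_integral_abs => //.
      by apply/measurable_EFinP; exact: measurable_funX.
    transitivity (\int[P]_w (Z w j ^+ 2)%:E)%E.
      by apply: eq_integral => w _; rewrite abse_EFin ger0_norm ?sqr_ge0.
    by rewrite -Rintegral_EFin// z2.
  apply: filterS => w /(_ I) /= [/eqP]; by rewrite sqrf_eq0 => /eqP.
apply: filterS (ae_foralln ae0) => w Zw.
by apply: val_inj; apply/funext => j; exact: Zw.
Qed.

End l2_moments.

(* Sequences are indexed from 0; [K n k], [k < n], are the resampling indices.
   If [Z 0] vanishes almost surely then [V n] and [dstar n] do too and the
   rejection probability is 0, whence [Z_nondegenerate]. *)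
Theorem proposition6 (R : realType)
    (dO : measure_display) (Omega : measurableType dO)
    (P : probability Omega R)
    (dS : measure_display) (OmegaS : measurableType dS)
    (PS : probability OmegaS R)
    (d : nat -> nat) (Z : nat -> {RV P >-> l2 R})
    (K : nat -> nat -> {RV PS >-> nat})
    (d_infty : d n @[n --> \oo] --> \oo)
    (Z_indep : mutually_independent P (fun i w => Z i w))
    (Z_ident : forall i, same_distribution (Z i) (Z 0%N))
    (Z_centered : l2_expectation P (Z 0%N) 0)
    (Z_sqr : ('E_P[fun w => (`|Z 0%N w| ^+ 2)%R] < +oo)%E)
    (Z_nondegenerate : ~ {ae P, forall w, Z 0%N w = 0})
    (K_indep : forall n,
      mutually_independent PS (fun (k : 'I_n) w => K n k w))
    (K_unif : forall n k, (k < n)%N -> uniform_index n (K n k))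
    (alpha : R) (alpha_gt0 : 0 < alpha) (alpha_lt1 : alpha < 1) :
  let X n i w : 'rV[R]_(d n) := truncation (d n) (Z i w) in
  let V n w := test_stat n (fun i => X n i w) in
  let dstar n w := bootstrap_critical n (fun i => X n i w) (K n) alpha in
  P [set w | V n w > dstar n w] @[n --> \oo] --> alpha%:E.
Proof.
move=> X V dstar.
pose zeta := @l2_seq R.
pose N (z : l2 R) : R := `|z| ^+ 2.
have mzeta : measurable_fun setT zeta by exact: measurable_l2_seq.
have mN : measurable_fun setT N.
  by apply: measurable_funX; exact: measurable_l2_norm.
have zetaN m z : qn m (zeta z) <= N z by exact: qn_le_l2.
have IN : rintegrable P (fun w => N (Z 0%N w)) by exact: l2_rintegrable_sqr_norm.
have centred j : \int[P]_w zeta (Z 0%N w) j = 0 by exact: l2_centred_coord.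
have indep n : product_rule P n Z.
  apply: mutually_independent_product_rule.
  exact: (mutually_independent_ord (X := fun i w => Z i w)).
have ident n : identically_distributed P n Z.
  by move=> i B _ mB; exact: Z_ident.
have Kindep n : product_rule PS n (K n).
  by apply: mutually_independent_product_rule; exact: K_indep.
have Kunif n k j : (k < n)%N -> (j < n)%N ->
    PS (K n k @^-1` [set j]) = (n%:R^-1)%:E.
  by move=> kn jn; exact: K_unif kn j jn.
have [j0 s20] : exists j, 0 < \int[P]_w zeta (Z 0%N w) j ^+ 2.
  exact: l2_nondegenerate_coord.
set s2 := \int[P]_w zeta (Z 0%N w) j0 ^+ 2 in s20.
pose sigma2 := \int[P]_w N (Z 0%N w).
have s2sigma : s2 <= sigma2.
  have mz : measurable_fun setT (fun w => zeta (Z 0%N w) j0).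
    exact: (measurableT_comp (@measurable_l2_coord R j0)).
  have le w : zeta (Z 0%N w) j0 ^+ 2 <= N (Z 0%N w).
    exact: le_trans (sqr_coord_le_qn _ _) (zetaN j0.+1 _).
  apply: le_Rint => //; apply: rintegrable_le IN _; first exact: measurable_funX.
  by move=> w; rewrite ger0_norm ?sqr_ge0.
have sigma20 : 0 < sigma2 by exact: lt_le_trans s2sigma.
apply/fine_cvgP; split.
  near=> n; apply: fin_num_measure; apply: measurable_rejection => //.
  by near: n; exact: nbhs_infty_gt.
apply/cvgrPdist_le => /= eps eps0.
(* Keeps alpha - kappa above [alpha / 2] and alpha + kappa below 1, so that both are attainable
   levels. *)
pose kappa := Num.min (eps / 4) (Num.min (alpha / 2) ((1 - alpha) / 2)).
have kappa0 : 0 < kappa by rewrite !lt_min !divr_gt0// subr_gt0.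
have kappa1 : kappa <= eps / 4 by rewrite ge_min lexx.
have kappa2 : kappa <= alpha / 2 by rewrite !ge_min lexx !orbT.
have kappa3 : kappa <= (1 - alpha) / 2 by rewrite !ge_min lexx !orbT.
(* Chosen so that the root in the shell bound equals [eps / 4]. *)
pose e := s2 * (eps / 4) ^+ 2 / 6.
have e0 : 0 < e by rewrite !mulr_gt0// invr_gt0.
have sqrte : Num.sqrt (6 * e / s2) = eps / 4.
  have -> : 6 * e / s2 = (eps / 4) ^+ 2 by rewrite /e; field; rewrite lt0r_neq0.
  by rewrite sqrtr_sqr ger0_norm// divr_ge0// ltW.
(* Levels for tail values of at least [alpha / 2] do not exceed the first term; [6 * e] is the room
   that the shell bound requires. *)
pose M := sigma2 / (alpha / 2) + 6 * e.
have sa : 0 < sigma2 / (alpha / 2) by rewrite !divr_gt0.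
have M0 : 0 <= M by rewrite /M; lra.
have eps4 : 0 < eps / 4 by rewrite divr_gt0.
(* This mean error, divided by kappa in Markov's inequality, leaves [eps / 4]. *)
have eta0 : 0 < kappa * (eps / 4) by rewrite mulr_gt0.
have [n1 anti] := anticoncentration indep ident mzeta zetaN IN centred s20 e0 M0 eps4.
have [n2 boot] := bootstrap_consistent indep ident mzeta mN zetaN IN centred
  Kindep Kunif e0 M0 eta0.
near=> n.
have n1n : (n1 <= n)%N by near: n; exact: nbhs_infty_ge.
have n2n : (n2 <= n)%N by near: n; exact: nbhs_infty_ge.
have dn : (j0 < d n)%N.
  by near: n; exact: (d_infty _ (nbhs_infty_gt j0)).
have [n0 [Rn [IR ER HR]]] := boot n (d n) n2n.
have VE w : V n w = qn (d n) (normalized_sum Z zeta n w).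
  exact: test_stat_normalized_sum.
have WE w v : bootstrap_stat n (fun i => X n i w) (K n) v =
    qn (d n) (psum (K n) (fun i => sscale (invsqrt R n) (residual n Z zeta w i)) n v).
  exact: bootstrap_stat_psum.
have V0 w : 0 <= V n w by exact: test_stat_ge0.
have mV : measurable_fun setT (V n) by exact: measurable_test_stat.
have [IV EV] : rintegrable P (V n) /\ \int[P]_w V n w <= sigma2.
  have [Iq Eq] := qn_smean_integral (indep n) (ident n) n0 mzeta zetaN IN centred (d n).
  have VE' w : V n w = n%:R * qn (d n) (smean n Z zeta w) by exact: test_stat_smean.
  have -> : V n = (fun w => n%:R * qn (d n) (smean n Z zeta w)) by exact/funext.
  split; first exact: rintegrableZ.
  rewrite RintegralZl//; apply: le_trans (ler_wpM2l _ Eq) _ => //.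
  by rewrite mulVKf// pnatr_eq0 -lt0n.
pose H s := \int[P]_w step ((V n w - s) / e).
have HE s : H s = smooth_tail P Z zeta n (d n) e s.
  by apply: eq_Rintegral => w _; rewrite VE.
pose Hs w s := \int[PS]_v step ((bootstrap_stat n (fun i => X n i w) (K n) v - s) / e).
have HsR w s : s + 3 * e <= M -> `|Hs w s - H s| <= Rn w.
  move=> sM; rewrite HE; apply: le_trans (HR w s sM).
  rewrite le_eqVlt; apply/orP; left; apply/eqP; congr `| _ - _ |.
  by apply: eq_Rintegral => v _; rewrite WE.
have mE : measurable [set w | dstar n w < V n w] by exact: measurable_rejection.
have B0 w v : 0 <= bootstrap_stat n (fun i => X n i w) (K n) v.
  exact: bootstrap_stat_ge0.
have etaE : kappa^-1 * (kappa * (eps / 4)) = eps / 4.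
  by rewrite mulKf// lt0r_neq0.
have level v : alpha / 2 <= v -> v <= 1 -> exists2 s, s + 6 * e <= M & H s = v.
  move=> av v1; have v0 : 0 < v by apply: lt_le_trans av; rewrite divr_gt0.
  have [s sle Hv] := smooth_tail_level mV V0 e0 v0 v1 IV sigma20 EV.
  exists s => //; rewrite /M lerD2r; apply: le_trans sle _.
  by rewrite ler_wpM2l ?(ltW sigma20)// lef_pV2 ?posrE// divr_gt0.
(* The four quarters of [eps] are kappa, the two terms of the shell bound, and the probability of a
   bad sample. *)
have up : fine (P [set w | dstar n w < V n w]) <= alpha + eps.
  have [||t tM Ht] := level (alpha + kappa); [lra|lra|].
  have tM3 : t + 3 * e <= M by lra.
  have := rejection_upper (delta := eps / 4 + eps / 4) mV e0 mE IR ER kappa0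
    (fun w => HsR w t tM3) Ht _ _.
  rewrite etaE => h; apply: le_trans (h _ _) _; last by lra.
  - by move=> w; exact: (smooth_tail_quantile_lt (B0 w)).
  - rewrite -!/(H _) !HE.
    have := anti n (d n) (t - 3 * e) n1n dn; rewrite subrK sqrte; apply; lra.
have lo : alpha - eps <= fine (P [set w | dstar n w < V n w]).
  have [||t tM Ht] := level (alpha - kappa); [lra|lra|].
  have tM3 : t + 3 * e <= M by lra.
  have := rejection_lower (delta := eps / 4 + eps / 4) mV e0 mE IR ER kappa0
    (fun w => HsR w t tM3) Ht _ _.
  rewrite etaE => h; apply: le_trans (h _ _); first by lra.
  - by move=> w; exact: (smooth_tail_quantile_gt (B0 w)).
  - rewrite -!/(H _) !HE.
    by have := anti n (d n) t n1n dn; rewrite sqrte; apply.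
by rewrite distrC ler_norml; apply/andP; split; lra.
Unshelve. all: by end_near.
Qed.
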